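(* Let $s>0$ and $0<p<\infty$ satisfy $s+p>1$, and let $\mu$ be a nonnegative Borel measure on $D$. Then: (i) The identity operator $I:F(p,p-2,s)\to T^{\infty}_{p,s}(\mu)$ is bounded if and only if $\mu$ is a $(p,s)$-logarithmic Carleson measure. (ii) The following two conditions are equivalent: (a) for any bounded sequence $\{f_n\}$ in $F(p,p-2,s)$ satisfying $f_n(z)\to 0$ uniformly on every compact subset of $D$, one has $\lim_{n\to\infty}\|f_n\|_{T^{\infty}_{p,s}(\mu)}=0$; (b) $\mu$ is a vanishing $(p,s)$-logarithmic Carleson measure.
   Context: $D$ is the open unit disk of the complex plane, $H(D)$ the space of analytic functions on $D$, $dA$ the normalized area measure on $D$, and $\varphi_a(z)=(a-z)/(1-\bar a z)$ for $a\in D$. For $0<p<\infty$, $-2<q<\infty$, $0\le s<\infty$, $F(p,q,s)$ is the space of $f\in H(D)$ with $$\|f\|_{F(p,q,s)}^p=\sup_{a\in D}\int_D|f'(z)|^p(1-|z|^2)^q(1-|\varphi_a(z)|^2)^s\,dA(z)<\infty,$$ and it is given the norm (quasi-norm if $p<1$) $|||f|||_{F(p,q,s)}=|f(0)|+\|f\|_{F(p,q,s)}$; bounded sequences are bounded with respect to it. For an arc $I\subset\partial D$, $|I|$ is its normalized arc length ($|\partial D|=1$), and the Carleson box is $S(I)=\{z: 1-|I|<|z|<1,\ z/|z|\in I\}$. $T^{\infty}_{p,s}(\mu)$ is the space of all $\mu$-measurable functions $f$ on $D$ with $$\|f\|_{T^{\infty}_{p,s}(\mu)}^p=\sup_{I\subset\partial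 D}|I|^{-s}\int_{S(I)}|f(z)|^p\,d\mu(z)<\infty.$$ The identity operator $I:F(p,q,s)\to T^\infty_{p,s}(\mu)$, $f\mapsto f$, is bounded if there is $C>0$ with $\|f\|_{T^\infty_{p,s}(\mu)}\le C|||f|||_{F(p,q,s)}$ for all $f\in F(p,q,s)$. $\mu$ is a $(p,s)$-logarithmic Carleson measure if $\sup_{I\subset\partial D}\frac{1}{|I|^s}\left(\log\frac{2}{|I|}\right)^p\mu(S(I))<\infty$. It is a vanishing $(p,s)$-logarithmic Carleson measure if it is a $(p,s)$-logarithmic Carleson measure and $\lim_{|I|\to0}\frac{1}{|I|^s}\left(\log\frac{2}{|I|}\right)^p\mu(S(I))=0$. *)

(* Defs.v *)
From HB Require Import structures.
From mathcomp Require Import all_boot all_order all_algebra.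
From mathcomp Require Import all_classical all_reals all_analysis.
From mathcomp.real_closed Require Import complex.

Set Implicit Arguments.
Unset Strict Implicit.
Unset Printing Implicit Defensive.

Import Order.TTheory GRing.Theory Num.Theory.
Import numFieldNormedType.Exports.

Local Open Scope classical_set_scope.
Local Open Scope ring_scope.
Local Open Scope complex_scope.

(* The product of two copies of [R] with its Borel sigma-algebra, that is, the
   Borel sigma-algebra of the plane. *)
Notation plane R := (measurableTypeR R * measurableTypeR R)%type.

Section disk.
Context {R : realType}.

(* [R[i]^o] carries the topology, uniformity and norm of [R[i]] seen as a
   numFieldType, so [derivable] and ['D_1] below are complex differentiation. *)
Local Notation C := (R[i]^o).

Definition modulus (z : R[i]) : R := ComplexField.Normc.normc z.

(* The identification of the plane, where measure theory is done, with [R[i]]. *)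
Definition cplx (w : plane R) : C := w.1 +i* w.2.

Definition unit_disk : set C := [set z | modulus z < 1].

Definition disk : set (plane R) := [set w | unit_disk (cplx w)].

Lemma invr_pi_ge0 : 0 <= (pi : R)^-1.
Proof. by rewrite invr_ge0 pi_ge0. Qed.

Definition area : {measure set (plane R) -> \bar R} :=
  mscale (NngNum invr_pi_ge0) (@lebesgue_measure R \x @lebesgue_measure R)%E.

Definition mobius (a z : R[i]) : R[i] := (a - z) / (1 - (a^*)%C * z).

(* Functions are total; only their values on the disk matter. *)
Definition analytic (f : C -> C) : Prop :=
  forall z, unit_disk z -> derivable f z 1.

End disk.

Section F_space.
Context {R : realType}.
Local Notation C := (R[i]^o).
Implicit Types (p q s : R) (f : C -> C).
Local Open Scope ereal_scope.

Definition F_seminorm p q s f : \bar R :=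
  (ereal_sup [set \int[area]_(w in disk)
     (modulus ('D_1 f (cplx w)) `^ p
      * (1 - modulus (cplx w) ^+ 2) `^ q
      * (1 - modulus (mobius a (cplx w)) ^+ 2) `^ s)%R%:E
     | a in unit_disk]) `^ p^-1.

Definition F_norm p q s f : \bar R := (modulus (f 0%R))%:E + F_seminorm p q s f.

Definition F_space p q s : set (C -> C) :=
  [set f | analytic f /\ F_seminorm p q s f < +oo].

Definition F_bounded p q s (f : nat -> C -> C) : Prop :=
  (forall n, F_space p q s (f n)) /\
  exists M : R, forall n, F_norm p q s (f n) <= M%:E.

Definition cvg_unif_on_compacts (f : nat -> C -> C) (l : C -> C) : Prop :=
  forall K : set C, compact K -> K `<=` unit_disk ->
    {uniform K, f @ \oo --> l}.

End F_space.

Section arcs.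
Context {R : realType}.
Local Notation C := (R[i]^o).

(* A nondegenerate subarc of the unit circle, with or without its endpoints, is
   the image of an interval of length [arc_len], normalized so that the whole
   circle has length 1, under [t |-> exp (2 pi i t)]. *)
Record circle_arc := CircleArc {
  arc_start : R;
  arc_len : R;
  arc_lclosed : bool;
  arc_rclosed : bool;
  arc_len_gt0 : 0 < arc_len;
  arc_len_le1 : arc_len <= 1 }.

Definition arc_param (I : circle_arc) : interval R :=
  Interval (BSide (arc_lclosed I) (arc_start I))
           (BSide (~~ arc_rclosed I) (arc_start I + arc_len I)).

Definition circle_pt (t : R) : C := cos (2 * pi * t) +i* sin (2 * pi * t).

Definition arc_set (I : circle_arc) : set C := circle_pt @` [set` arc_param I].

Definition carleson_box (I : circle_arc) : set (plane R) :=
  [set w | 1 - arc_len I < modulus (cplx w) < 1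
         /\ arc_set I (cplx w / (modulus (cplx w))%:C)].

End arcs.

Arguments circle_arc : clear implicits.

Section T_space.
Context {R : realType}.
Local Notation C := (R[i]^o).
Implicit Types (p s : R) (mu : {measure set (plane R) -> \bar R}) (f : C -> C).
Local Open Scope ereal_scope.

(* Measurability on the disk for the completion of [mu]: equality [mu]-almost
   everywhere with a Borel function. *)
Definition mu_measurable mu f : Prop :=
  exists2 g : plane R -> plane R, measurable_fun setT g &
    {ae mu, forall w, disk w -> f (cplx w) = cplx (g w)}.

Definition T_norm p s mu f : \bar R :=
  (ereal_sup [set ((arc_len I `^ s)^-1)%R%:E *
     \int[mu]_(w in carleson_box I) (modulus (f (cplx w)) `^ p)%R%:E
     | I in [set: circle_arc R]]) `^ p^-1.

Definition T_space p s mu : set (C -> C) :=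
  [set f | mu_measurable mu f /\ T_norm p s mu f < +oo].

Definition identity_bounded p q s mu : Prop :=
  exists2 c : R, (0 < c)%R & forall f, F_space p q s f ->
    T_space p s mu f /\ T_norm p s mu f <= c%:E * F_norm p q s f.

Definition log_carleson_ratio p s mu (I : circle_arc R) : \bar R :=
  ((arc_len I `^ s)^-1 * (ln (2 / arc_len I)) `^ p)%R%:E * mu (carleson_box I).

Definition log_carleson p s mu : Prop :=
  ereal_sup [set log_carleson_ratio p s mu I | I in [set: circle_arc R]] < +oo.

Definition vanishing_log_carleson p s mu : Prop :=
  log_carleson p s mu /\
  forall e : R, (0 < e)%R -> exists2 d : R, (0 < d)%R &
    forall I : circle_arc R, (arc_len I < d)%R -> log_carleson_ratio p s mu I < e%:E.

End T_space.

(* Main.v *)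
(* Sufficiency is a chaining argument. Write tau for |f'|^p (1-|w|^2)^(p-2) dA.
   Since |f'|^p has a submean value property for every p > 0, the increment of f
   between two consecutive dyadic points of the radius ending at z is bounded, to
   the power p, by tau(E_k(z)), where E_k(z) is the part near z of the ring
   1-|w| ~ 2^-k. Hence |f(z)|^p is at most a constant times
   |f(0)|^p + (k0+1)^p L + sum_j (j+1)^p tau(E_(k0+j)(z)), with L the p-th power
   of the seminorm. Integrate this against mu over a box of size 2^-k0 and
   exchange the integrals: the logarithmic Carleson condition gains (k+1)^-p,
   which absorbs the weights, and there remains the integral of (1-|w|^2)^s
   against tau over a larger box at the boundary point zeta, which the seminorm
   controls through a = (1-2^-k0) zeta.

   For the converse, the box of size 2^-N at zeta is tested on L^2/(N+1), where
   L(z) is the sum of 1/(1 + 2^k (1 - conj(zeta) z)) over k <= N: it is of size N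
   on the box, of size 1/N on compact sets, and its derivative is
   O(1/|1 - conj(zeta) z|), so that its norm is bounded uniformly in N and zeta.

   In (ii), (b) implies (a) by applying the embedding to mu restricted to
   |z| >= r, whose logarithmic Carleson constant tends to 0 as r tends to 1; for
   (a) implies (b), small constant functions give the finiteness of mu away from
   0, and the functions above contradict (a) if (b) fails. *)

Require Import Defs.
From mathcomp Require Import all_boot all_order all_algebra.
From mathcomp Require Import all_classical all_reals all_analysis.
From mathcomp Require Import measurable_realfun.
From mathcomp.real_closed Require Import complex.
From mathcomp Require Import zify ring lra.

Set Implicit Arguments.
Unset Strict Implicit.
Unset Printing Implicit Defensive.

Import Order.TTheory GRing.Theory Num.Theory.
Import numFieldNormedType.Exports.

Local Open Scope classical_set_scope.
Local Open Scope ring_scope.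

(** * Goursat's theorem for rectangles *)

Section rectangle_forms.
Context {R : realType}.
Local Notation leb := (@lebesgue_measure R).
Implicit Types (g : R -> R) (P Q : R -> R -> R).

(** All the complex analysis rests on one inequality: the value at the centre of a rectangle is
    controlled by the integrals of the modulus over its four sides. It comes from Goursat's theorem,
    with the crude circulation 4 in place of 2 pi around a simple pole, and it gives both Cauchy's
    estimate and, for well chosen sides, the submean value property. Derivatives are never shown to
    be analytic: they are reached as limits of difference quotients, which are. The obstacle in the
    embedding is that summing increments along a radius costs powers of an index, while the
    logarithmic condition gains exactly (k+1)^-p. Cutting the chain at the scale k0 of the box makes
    the two match: the factor (k0+1)^p is paid by the mass of the box itself, and (j+1)^p by slices
    at scale k0+j, where j+1 <= k0+j+1. The condition s + p > 1 is the integrability of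
    (1-|w|^2)^(p-2+s) on the disk, which is what bounds the norms of the test functions. *)

Lemma integrable_pt_continuous g a b :
  (forall x, a <= x <= b -> {for x, continuous g}) ->
  leb.-integrable `[a, b] (EFin \o g).
Proof.
move=> gc; apply: continuous_compact_integrable; first exact: segment_compact.
apply: continuous_in_subspaceT => x; rewrite inE /= in_itv /= => /gc.
exact.
Qed.

Lemma Rintegral_approx g a b k e : a <= b ->
  (forall x, a <= x <= b -> {for x, continuous g}) ->
  (forall x, a <= x <= b -> `|g x - k| <= e) ->
  `|\int[leb]_(x in `[a, b]) g x - k * (b - a)| <= e * (b - a).
Proof.
move=> ab gc gk.
have mI : measurable (`[a, b] : set (measurableTypeR R)) by [].
have ig := integrable_pt_continuous gc.
have icst c : leb.-integrable `[a, b] (EFin \o (fun=> c)).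
  by apply: integrable_pt_continuous => x _; exact: cst_continuous.
have Icst c : \int[leb]_(x in `[a, b]) c = c * (b - a).
  rewrite Rintegral_cst //=; rewrite lebesgue_measure_itv /= lte_fin.
  case: ltP => // ba; have -> : a = b by apply/eqP; rewrite eq_le ab ba.
  by rewrite subrr /=.
rewrite -Icst -RintegralB //.
apply: le_trans (le_normr_Rintegral _ _) _ => //.
  exact: (integrableB _ ig (icst k)).
rewrite -Icst; apply: le_Rintegral => //.
- apply: integrable_pt_continuous => x /gc gx.
  apply: (@continuous_comp _ _ _ (fun x => g x - k) Num.norm).
    by apply: continuousB => //; exact: cst_continuous.
  exact: norm_continuous.
Qed.

Lemma Rintegral_split g a m b : a <= m <= b ->
  (forall x, a <= x <= b -> {for x, continuous g}) ->
  \int[leb]_(x in `[a, b]) g x =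
  \int[leb]_(x in `[a, m]) g x + \int[leb]_(x in `[m, b]) g x.
Proof.
move=> /andP[am mb] gc.
have ig := integrable_pt_continuous gc.
apply/eqP; rewrite addrC -subr_eq; apply/eqP.
rewrite Rintegral_itvB ?bnd_simp//.
rewrite Rintegral_itv_obnd_cbnd//.
by apply: integrableS ig => //; apply: subset_itvr; rewrite bnd_simp.
Qed.

(* The circulation of the form [P dx + Q dy] around [[a, b] x [c, d]], with the
   two integrals over opposite sides merged into one. *)
Definition circ P Q a b c d : R :=
  \int[leb]_(x in `[a, b]) (P x c - P x d) +
  \int[leb]_(y in `[c, d]) (Q b y - Q a y).

(* [P dx + Q dy] is differentiable at the point and its exterior derivative
   vanishes there: [be] is both dP/dy and dQ/dx. *)
Definition closed_at P Q x0 y0 := exists al be ga : R,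
  forall e : R, 0 < e -> exists2 d : R, 0 < d &
  forall x y, `|x - x0| < d -> `|y - y0| < d ->
  `|P x y - P x0 y0 - al * (x - x0) - be * (y - y0)|
     <= e * (`|x - x0| + `|y - y0|) /\
  `|Q x y - Q x0 y0 - be * (x - x0) - ga * (y - y0)|
     <= e * (`|x - x0| + `|y - y0|).

Lemma pt_continuous_lip g x0 k d : 0 < d ->
  (forall x, `|x - x0| < d -> `|g x - g x0| <= k * `|x - x0|) ->
  {for x0, continuous g}.
Proof.
move=> d0 gk; apply/cvgrPdist_le => /= e e0.
have k1 : 0 < `|k| + 1 by rewrite ltr_wpDl.
near=> x.
have xd : `|x - x0| < d.
  by near: x; apply: cvgr_distC_lt => //; exact: cvg_id.
have xe : `|x - x0| < e / (`|k| + 1).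
  by near: x; apply: cvgr_distC_lt; [exact: cvg_id|exact: divr_gt0].
rewrite distrC (le_trans (gk _ xd))//.
rewrite (@le_trans _ _ ((`|k| + 1) * `|x - x0|))//.
  by rewrite ler_wpM2r// (le_trans (ler_norm k))// lerDl.
by rewrite mulrC -ler_pdivlMr// ltW.
Unshelve. all: by end_near. Qed.

Lemma closed_at_continuous P Q x0 y0 : closed_at P Q x0 y0 ->
  [/\ {for x0, continuous (P ^~ y0)}, {for y0, continuous (P x0)},
      {for x0, continuous (Q ^~ y0)} & {for y0, continuous (Q x0)}].
Proof.
move=> [al [be [ga H]]].
have [d d0 Hd] := H _ ltr01.
split.
- apply: (@pt_continuous_lip _ _ (1 + `|al|) d) => // x xd.
  have [|+ _] := Hd x y0 xd; rewrite ?subrr ?normr0 // mulr0 subr0 addr0 mul1r.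
  move=> h; rewrite mulrDl mul1r -normrM.
  rewrite -[X in `|X|](subrK (al * (x - x0))) (le_trans (ler_normD _ _))//.
  by rewrite lerD2r.
- apply: (@pt_continuous_lip _ _ (1 + `|be|) d) => // y yd.
  have [|//|+ _] := Hd x0 y; rewrite ?subrr ?normr0 // mulr0 subr0 add0r mul1r.
  move=> h; rewrite mulrDl mul1r -normrM.
  rewrite -[X in `|X|](subrK (be * (y - y0))) (le_trans (ler_normD _ _))//.
  by rewrite lerD2r.
- apply: (@pt_continuous_lip _ _ (1 + `|be|) d) => // x xd.
  have [|_] := Hd x y0 xd; rewrite ?subrr ?normr0 // mulr0 subr0 addr0 mul1r.
  move=> h; rewrite mulrDl mul1r -normrM.
  rewrite -[X in `|X|](subrK (be * (x - x0))) (le_trans (ler_normD _ _))//.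
  by rewrite lerD2r.
- apply: (@pt_continuous_lip _ _ (1 + `|ga|) d) => // y yd.
  have [|//|_] := Hd x0 y; rewrite ?subrr ?normr0 // mulr0 subr0 add0r mul1r.
  move=> h; rewrite mulrDl mul1r -normrM.
  rewrite -[X in `|X|](subrK (ga * (y - y0))) (le_trans (ler_normD _ _))//.
  by rewrite lerD2r.
Qed.

End rectangle_forms.

Section goursat.
Context {R : realType}.
Implicit Types (g : R -> R) (P Q : R -> R -> R).
Local Notation leb := (@lebesgue_measure R).

Definition closed_on P Q a b c d :=
  forall x y : R, a <= x <= b -> c <= y <= d -> closed_at P Q x y.

Lemma closed_onS P Q a b c d a' b' c' d' :
  a <= a' -> b' <= b -> c <= c' -> d' <= d ->
  closed_on P Q a b c d -> closed_on P Q a' b' c' d'.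
Proof.
move=> aa bb cc dd H x y /andP[ax xb] /andP[cy yd]; apply: H.
  by rewrite (le_trans aa ax) (le_trans xb bb).
by rewrite (le_trans cc cy) (le_trans yd dd).
Qed.

Lemma closed_on_contX P Q a b c d y : closed_on P Q a b c d -> c <= y <= d ->
  forall x, a <= x <= b -> {for x, continuous (P ^~ y)}.
Proof. by move=> H yc x xa; case: (closed_at_continuous (H _ _ xa yc)). Qed.

Lemma closed_on_contY P Q a b c d x : closed_on P Q a b c d -> a <= x <= b ->
  forall y, c <= y <= d -> {for y, continuous (Q x)}.
Proof. by move=> H xa y yc; case: (closed_at_continuous (H _ _ xa yc)). Qed.

(* Only the seven segments that occur matter, so that a singularity may be
   cut out of the rectangle. *)
Lemma circ_splitx_edges P Q a m b c d : a <= m <= b ->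
  (forall x, a <= x <= b -> closed_at P Q x c /\ closed_at P Q x d) ->
  (forall y, c <= y <= d -> [/\ closed_at P Q a y, closed_at P Q m y &
                                closed_at P Q b y]) ->
  circ P Q a b c d = circ P Q a m c d + circ P Q m b c d.
Proof.
move=> amb HX HY; have /andP[am mb] := amb.
have i1 : leb.-integrable `[c, d] (EFin \o Q a).
  by apply: integrable_pt_continuous => y /HY[/closed_at_continuous[]].
have i2 : leb.-integrable `[c, d] (EFin \o Q m).
  by apply: integrable_pt_continuous => y /HY[_ /closed_at_continuous[]].
have i3 : leb.-integrable `[c, d] (EFin \o Q b).
  by apply: integrable_pt_continuous => y /HY[_ _ /closed_at_continuous[]].
rewrite /circ (Rintegral_split amb); last first.
  move=> x /HX[/closed_at_continuous[? _ _ _] /closed_at_continuous[? _ _ _]].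
  exact: continuousB.
rewrite (RintegralB _ i3 i1)// (RintegralB _ i3 i2)// (RintegralB _ i2 i1)//.
ring.
Qed.

Lemma circ_splity_edges P Q a b c m d : c <= m <= d ->
  (forall x, a <= x <= b -> [/\ closed_at P Q x c, closed_at P Q x m &
                                closed_at P Q x d]) ->
  (forall y, c <= y <= d -> closed_at P Q a y /\ closed_at P Q b y) ->
  circ P Q a b c d = circ P Q a b c m + circ P Q a b m d.
Proof.
move=> cmd HX HY; have /andP[cm md] := cmd.
have i1 : leb.-integrable `[a, b] (EFin \o P ^~ c).
  by apply: integrable_pt_continuous => y /HX[/closed_at_continuous[]].
have i2 : leb.-integrable `[a, b] (EFin \o P ^~ m).
  by apply: integrable_pt_continuous => y /HX[_ /closed_at_continuous[]].
have i3 : leb.-integrable `[a, b] (EFin \o P ^~ d).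
  by apply: integrable_pt_continuous => y /HX[_ _ /closed_at_continuous[]].
rewrite /circ (Rintegral_split cmd); last first.
  move=> y /HY[/closed_at_continuous[_ _ _ ?] /closed_at_continuous[_ _ _ ?]].
  exact: continuousB.
rewrite (RintegralB _ i1 i3)// (RintegralB _ i1 i2)// (RintegralB _ i2 i3)//.
ring.
Qed.

Lemma circ_splitx P Q a m b c d : a <= m <= b -> c <= d ->
  closed_on P Q a b c d ->
  circ P Q a b c d = circ P Q a m c d + circ P Q m b c d.
Proof.
move=> /andP[am mb] cd H; apply: circ_splitx_edges; first by rewrite am mb.
  by move=> x xa; split; apply: H; rewrite ?lexx ?cd.
by move=> y ya; split; apply: H; rewrite ?lexx ?am ?mb// (le_trans am mb).
Qed.

Lemma circ_splity P Q a b c m d : c <= m <= d -> a <= b ->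
  closed_on P Q a b c d ->
  circ P Q a b c d = circ P Q a b c m + circ P Q a b m d.
Proof.
move=> /andP[cm md] ab H; apply: circ_splity_edges; first by rewrite cm md.
  by move=> x xa; split; apply: H; rewrite ?lexx ?cm ?md// (le_trans cm md).
by move=> y ya; split; apply: H; rewrite ?lexx ?ab.
Qed.

(** The affine parts of [P] and [Q] contribute [be * (c - d) * (b - a)] and
    [be * (b - a) * (d - c)], which cancel because the same [be] serves both forms. What remains is
    the error of differentiability, of the order of the size, times a length. *)
Lemma circ_local P Q x0 y0 e : closed_at P Q x0 y0 -> 0 < e ->
  exists2 r : R, 0 < r & forall a b c d, a <= x0 <= b -> c <= y0 <= d ->
  b - a < r -> d - c < r -> closed_on P Q a b c d ->
  `|circ P Q a b c d| <= e * (b - a + (d - c)) ^+ 2.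
Proof.
(* The tolerance is halved because each integrand is a difference of two values. *)
move=> [al [be [ga H]]] e0.
have [r r0 Hr] := H _ (divr_gt0 e0 (ltr0n _ 2)).
exists r => // a b c d /andP[ax xb] /andP[cy yd] abr cdr Hcl.
have ab := le_trans ax xb; have cd := le_trans cy yd.
set S := b - a + (d - c).
have S0 : 0 <= S by rewrite addr_ge0 ?subr_ge0.
have near_x x : a <= x <= b -> `|x - x0| <= b - a.
  by move=> ?; rewrite ler_norml; lra.
have near_y y : c <= y <= d -> `|y - y0| <= d - c.
  by move=> ?; rewrite ler_norml; lra.
have HP x y : a <= x <= b -> c <= y <= d ->
    `|P x y - P x0 y0 - al * (x - x0) - be * (y - y0)| <= e / 2 * S /\
    `|Q x y - Q x0 y0 - be * (x - x0) - ga * (y - y0)| <= e / 2 * S.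
  move=> xa yc; have hx := near_x _ xa; have hy := near_y _ yc.
  have [h1 h2] := Hr x y (le_lt_trans hx abr) (le_lt_trans hy cdr).
  have hS : e / 2 * (`|x - x0| + `|y - y0|) <= e / 2 * S.
    by rewrite ler_wpM2l ?lerD// divr_ge0// ltW.
  by split; [exact: le_trans h1 hS|exact: le_trans h2 hS].
have cc : c <= c <= d by rewrite lexx.
have dd : c <= d <= d by rewrite lexx cd.
have aa : a <= a <= b by rewrite lexx.
have bb : a <= b <= b by rewrite lexx ab.
have h1 : `|\int[leb]_(x in `[a, b]) (P x c - P x d) - be * (c - d) * (b - a)|
    <= e * S * (b - a).
  apply: Rintegral_approx => // x xa.
    by apply: continuousB; apply: (closed_on_contX Hcl).
  have [k1 _] := HP x c xa cc; have [k2 _] := HP x d xa dd.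
  move: k1 k2; rewrite !ler_norml; nra.
have h2 : `|\int[leb]_(y in `[c, d]) (Q b y - Q a y) - be * (b - a) * (d - c)|
    <= e * S * (d - c).
  apply: Rintegral_approx => // y yc.
    by apply: continuousB; apply: (closed_on_contY Hcl).
  have [_ k1] := HP b y bb yc; have [_ k2] := HP a y aa yc.
  move: k1 k2; rewrite !ler_norml; nra.
rewrite /circ.
have -> : forall A B : R, A + B =
  (A - be * (c - d) * (b - a)) + (B - be * (b - a) * (d - c)).
  by move=> A B; ring.
rewrite (le_trans (ler_normD _ _))// (le_trans (lerD h1 h2))//.
by rewrite -mulrDr -/S expr2 mulrA.
Qed.

(** Every left end lies below every right end, so the supremum of the left ends belongs to all the
    intervals. *)
Lemma nested_halving (u : nat -> R) (w : R) :
  (forall n, u n <= u n.+1 /\ u n.+1 + w / 2 ^+ n.+1 <= u n + w / 2 ^+ n) ->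
  0 <= w -> exists x0, forall n, u n <= x0 <= u n + w / 2 ^+ n.
Proof.
move=> H w0.
have nd : {homo u : n m / (n <= m)%N >-> n <= m}.
  by apply/nondecreasing_seqP => n; case: (H n).
have ni : {homo (fun n => u n + w / 2 ^+ n) : n m / (n <= m)%N >-> m <= n}.
  by apply/nonincreasing_seqP => n; case: (H n).
have wp n : 0 <= w / 2 ^+ n by rewrite divr_ge0// exprn_ge0.
have um n m : u n <= u m + w / 2 ^+ m.
  have := nd _ _ (leq_maxl n m); have := ni _ _ (leq_maxr n m).
  by have := wp (maxn n m); lra.
have hs (n : nat) : has_ubound (range u) by exists (u n + w / 2 ^+ n) => _ [m _ <-].
exists (sup (range u)) => n; apply/andP; split.
  by apply: (ub_le_sup (hs n)); exists n.
by apply: sup_le_ub; [exists (u n), n|move=> _ [m _ <-]].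
Qed.

(** Repeated quartering. A suitable quarter keeps at least a fourth of the circulation, while the
    squared size in [circ_local] is also divided by 4; so the original circulation is below any
    multiple of the original squared size. *)
Theorem goursat P Q a b c d : a <= b -> c <= d ->
  closed_on P Q a b c d -> circ P Q a b c d = 0.
Proof.
move=> ab cd H.
pose W := b - a; pose L := d - c.
have W0 : 0 <= W by rewrite subr_ge0.
have L0 : 0 <= L by rewrite subr_ge0.
pose cn n (p : R * R) :=
  circ P Q p.1 (p.1 + W / 2 ^+ n) p.2 (p.2 + L / 2 ^+ n).
(* The first quarter with enough circulation is chosen. The fourth one is the default: if the other
   three fail, the triangle inequality in [stepP] forces it to qualify. *)
pose step n (p : R * R) : R * R :=
  let p1 := (p.1 + W / 2 ^+ n.+1, p.2) in
  let p2 := (p.1, p.2 + L / 2 ^+ n.+1) in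
  let p3 := (p.1 + W / 2 ^+ n.+1, p.2 + L / 2 ^+ n.+1) in
  if `|cn n p| <= 4 * `|cn n.+1 p| then p else
  if `|cn n p| <= 4 * `|cn n.+1 p1| then p1 else
  if `|cn n p| <= 4 * `|cn n.+1 p2| then p2 else p3.
pose fix u n : R * R := if n is n'.+1 then step n' (u n') else (a, c).
have halves (z : R) n : z / 2 ^+ n = z / 2 ^+ n.+1 + z / 2 ^+ n.+1.
  by rewrite exprS invfM; set t := (2 ^+ n)^-1; field.
have wp (z : R) n : 0 <= z -> 0 <= z / 2 ^+ n.
  by move=> ?; rewrite divr_ge0// exprn_ge0.
have uS n : ((u n).1 <= (u n.+1).1 /\
     (u n.+1).1 + W / 2 ^+ n.+1 <= (u n).1 + W / 2 ^+ n) /\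
   ((u n).2 <= (u n.+1).2 /\
     (u n.+1).2 + L / 2 ^+ n.+1 <= (u n).2 + L / 2 ^+ n).
  have := halves W n; have := halves L n.
  have := wp _ n.+1 W0; have := wp _ n.+1 L0.
  by rewrite /= /step; do 3?[case: ifP => _] => /=; split; split; lra.
have [x0 Hx0] := nested_halving (fun n => proj1 (uS n)) W0.
have [y0 Hy0] := nested_halving (fun n => proj2 (uS n)) L0.
have inR n : [/\ a <= (u n).1, (u n).1 + W / 2 ^+ n <= b,
                 c <= (u n).2 & (u n).2 + L / 2 ^+ n <= d].
  elim: n => [|n [i1 i2 i3 i4]].
    by rewrite /= !expr0 !divr1 /W /L; split => //; lra.
  by have [[? ?] [? ?]] := uS n; split; lra.
have cl n : closed_on P Q (u n).1 ((u n).1 + W / 2 ^+ n)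
                          (u n).2 ((u n).2 + L / 2 ^+ n).
  by have [? ? ? ?] := inR n; apply: closed_onS H.
have stepP n : `|cn n (u n)| <= 4 * `|cn n.+1 (u n.+1)|.
  have hW := halves W n; have hL := halves L n.
  have w1 := wp _ n.+1 W0; have l1 := wp _ n.+1 L0.
  rewrite [u n.+1]/= /step; case: ifPn => //; rewrite -ltNge => n1.
  case: ifPn => //; rewrite -ltNge => n2.
  case: ifPn => //; rewrite -ltNge => n3.
  have clu := cl n; have [i1 i2 i3 i4] := inR n.
  have E : cn n (u n) = cn n.+1 (u n) +
      cn n.+1 ((u n).1 + W / 2 ^+ n.+1, (u n).2) +
     (cn n.+1 ((u n).1, (u n).2 + L / 2 ^+ n.+1) +
      cn n.+1 ((u n).1 + W / 2 ^+ n.+1, (u n).2 + L / 2 ^+ n.+1)).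
    rewrite {1}/cn (@circ_splity _ _ _ _ _ ((u n).2 + L / 2 ^+ n.+1)) //;
      [|lra|lra].
    rewrite (@circ_splitx _ _ _ ((u n).1 + W / 2 ^+ n.+1)); [|lra|lra|];
      last by apply: closed_onS clu; lra.
    rewrite [X in _ + X](@circ_splitx _ _ _ ((u n).1 + W / 2 ^+ n.+1));
      [|lra|lra|]; last by apply: closed_onS clu; lra.
    by rewrite /cn /= hW hL !addrA.
  move: E n1 n2 n3; set A := cn n _; set B := cn n.+1 _; set B1 := cn n.+1 _.
  set B2 := cn n.+1 _; set B3 := cn n.+1 _ => E.
  have : `|A| <= `|B| + `|B1| + (`|B2| + `|B3|).
    by rewrite E (le_trans (ler_normD _ _))// lerD// ler_normD.
  lra.
have geo n : `|circ P Q a b c d| <= 4 ^+ n * `|cn n (u n)|.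
  elim: n => [|n /le_trans->//].
    by rewrite expr0 mul1r /cn /= !expr0 !divr1 /W /L !subrKC.
  by rewrite exprSr -mulrA ler_wpM2l// exprn_ge0.
apply/eqP; rewrite -normr_eq0 eq_le normr_ge0 andbT.
apply/ler_addgt0Pr => e e0; rewrite add0r.
pose S := W + L.
have S0 : 0 <= S by rewrite addr_ge0.
have clxy : closed_at P Q x0 y0.
  have := Hx0 0%N; have := Hy0 0%N; have [? ? ? ?] := inR 0%N => ? ?.
  by apply: H; lra.
(* The added 1 covers the rectangle reduced to a point, where [S] is 0. *)
have e1 : 0 < e / (S ^+ 2 + 1) by rewrite divr_gt0// ltr_wpDl// exprn_ge0.
have [r r0 Hr] := circ_local clxy e1.
have [n nr] : exists n, S / 2 ^+ n < r.
  exists (Num.truncn (S / r)).+1; rewrite ltr_pdivrMr ?exprn_gt0// mulrC -ltr_pdivrMr//.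
  apply: lt_trans (Num.Theory.truncnS_gt _) _.
  by rewrite -natrX ltr_nat ltn_expl.
have SE : S / 2 ^+ n = W / 2 ^+ n + L / 2 ^+ n by rewrite /S mulrDl.
have := wp W n W0; have := wp L n L0 => Ln Wn.
have /(_ _ _)/= := Hr (u n).1 ((u n).1 + W / 2 ^+ n) (u n).2 ((u n).2 + L / 2 ^+ n).
have e4 (z : R) : z + W / 2 ^+ n - z = W / 2 ^+ n by ring.
have e5 (z : R) : z + L / 2 ^+ n - z = L / 2 ^+ n by ring.
rewrite !e4 e5 -SE => /(_ (Hx0 n) (Hy0 n)) h.
apply: le_trans (geo n) _.
apply: le_trans (ler_wpM2l _ (h _ _ (cl n))) _; [exact: exprn_ge0|lra|lra|].
have -> : (4 : R) ^+ n = (2 ^+ n) ^+ 2.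
  by rewrite -exprM mulnC exprM; congr (_ ^+ n); ring.
have q0 : (2 : R) ^+ n != 0 by rewrite expf_neq0// pnatr_eq0.
have K0 : S ^+ 2 + 1 != 0 by rewrite gt_eqF// ltr_wpDl// exprn_ge0.
have -> : (2 ^+ n) ^+ 2 * (e / (S ^+ 2 + 1) * (S / 2 ^+ n) ^+ 2) =
    e / (S ^+ 2 + 1) * S ^+ 2 by field; rewrite K0 q0.
rewrite mulrAC ler_pdivrMr; last by rewrite ltr_wpDl// exprn_ge0.
by rewrite ler_wpM2l ?ltW// ltrDl.
Qed.

(* The circulation around a hole does not see the outer rectangle. *)
Lemma circ_frame P Q a a' b' b c c' d' d :
  a <= a' -> a' <= b' -> b' <= b -> c <= c' -> c' <= d' -> d' <= d ->
  (forall x y, a <= x <= b -> c <= y <= d ->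
     ~~ ((a' < x < b') && (c' < y < d')) -> closed_at P Q x y) ->
  circ P Q a b c d = circ P Q a' b' c' d'.
Proof.
move=> aa ab bb cc cd dd H.
rewrite (@circ_splitx_edges _ _ _ a'); first last.
- by move=> y yc; split; apply: H => //; rewrite ?ltxx//; lra.
- by move=> x xc; split; apply: H => //; rewrite ?ltxx//; lra.
- by rewrite aa (le_trans ab bb).
rewrite (@circ_splitx_edges _ _ a' b'); first last.
- by move=> y yc; split; apply: H => //; rewrite ?ltxx//; lra.
- by move=> x xc; split; apply: H => //; rewrite ?ltxx//; lra.
- by rewrite ab bb.
rewrite (@circ_splity_edges _ _ a' b' c c'); first last.
- by move=> y yc; split; apply: H => //; rewrite ?ltxx//; lra.
- by move=> x xc; split; apply: H => //; rewrite ?ltxx//; lra.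
- by rewrite cc (le_trans cd dd).
rewrite (@circ_splity_edges _ _ a' b' c' d'); first last.
- by move=> y yc; split; apply: H => //; rewrite ?ltxx//; lra.
- by move=> x xc; split; apply: H => //; rewrite ?ltxx//; lra.
- by rewrite cd dd.
rewrite [circ _ _ a a' _ _]goursat ?[circ _ _ b' b _ _]goursat
        ?[circ _ _ a' b' c c']goursat ?[circ _ _ a' b' d' d]goursat;
  rewrite ?add0r ?addr0 //; try lra.
all: by move=> x y xa yc; apply: H; lra.
Qed.

End goursat.

(** * Cauchy's estimate *)

Local Open Scope complex_scope.

(* [Num] exports other functions under these names. *)
Notation Re := complex.Re.
Notation Im := complex.Im.

Section modulus_theory.
Context {R : realType}.
Implicit Types (z w : R[i]).
Local Notation C := (R[i]^o).

Lemma modulusE z : (modulus z)%:C = `|z|.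
Proof. by case: z. Qed.

Lemma modulus_ge0 z : 0 <= modulus z.
Proof. by case: z => a b; exact: sqrtr_ge0. Qed.

Lemma modulusM z w : modulus (z * w) = modulus z * modulus w.
Proof. exact: ComplexField.Normc.normcM. Qed.

Lemma modulusV z : modulus z^-1 = (modulus z)^-1.
Proof. exact: ComplexField.Normc.normcV. Qed.

Lemma modulus0 : modulus (0 : R[i]) = 0.
Proof. exact: ComplexField.Normc.normc0. Qed.

Lemma modulus1 : modulus (1 : R[i]) = 1.
Proof. exact: ComplexField.Normc.normc1. Qed.

Lemma modulus_eq0 z : (modulus z == 0) = (z == 0).
Proof.
apply/eqP/eqP => [|->]; [exact: ComplexField.Normc.eq0_normc|exact: modulus0].
Qed.

Lemma modulus_gt0 z : (0 < modulus z) = (z != 0).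
Proof. by rewrite lt_def modulus_eq0 modulus_ge0 andbT. Qed.

Lemma modulusN z : modulus (- z) = modulus z.
Proof. exact: normcN. Qed.

Lemma modulusB z w : modulus (z - w) = modulus (w - z).
Proof. by rewrite -modulusN opprB. Qed.

Lemma modulusD z w : modulus (z + w) <= modulus z + modulus w.
Proof. exact: le_normcD. Qed.

Lemma modulusBD z w : modulus (z - w) <= modulus z + modulus w.
Proof. by rewrite -(modulusN w) modulusD. Qed.

Lemma modulus_dist z w : `|modulus z - modulus w| <= modulus (z - w).
Proof.
have h (a b : R[i]) : modulus a <= modulus (a - b) + modulus b.
  by rewrite -{1}(subrK b a) modulusD.
by have := h z w; have := h w z; rewrite (modulusB w z) ler_norml; lra.
Qed.

Lemma modulusX z n : modulus (z ^+ n) = modulus z ^+ n.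
Proof.
elim: n => [|n IH]; first by rewrite !expr0 modulus1.
by rewrite !exprS modulusM IH.
Qed.

Lemma modulusC (x : R) : modulus x%:C = `|x|.
Proof. by rewrite /modulus /= expr0n /= addr0 sqrtr_sqr. Qed.

Lemma modulus_conj z : modulus z^*%C = modulus z.
Proof. by case: z => a b; rewrite /modulus /= sqrrN. Qed.

Lemma sqr_modulus z : modulus z ^+ 2 = Re z ^+ 2 + Im z ^+ 2.
Proof. by case: z => a b; rewrite sqr_sqrtr// addr_ge0 ?sqr_ge0. Qed.

Lemma Re_le_modulus z : `|Re z| <= modulus z.
Proof.
rewrite -(ler_pXn2r (_ : (0 < 2)%N)) ?nnegrE ?modulus_ge0//.
by rewrite sqr_modulus real_normK ?num_real// lerDl sqr_ge0.
Qed.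

Lemma Im_le_modulus z : `|Im z| <= modulus z.
Proof.
rewrite -(ler_pXn2r (_ : (0 < 2)%N)) ?nnegrE ?modulus_ge0//.
by rewrite sqr_modulus real_normK ?num_real// lerDr sqr_ge0.
Qed.

Lemma modulus_le_ReIm z : modulus z <= `|Re z| + `|Im z|.
Proof.
case: z => a b; rewrite [in leLHS](_ : a +i* b = a%:C + 'i * b%:C).
  by rewrite (le_trans (modulusD _ _))// modulusM !modulusC /=
             expr0n expr1n add0r sqrtr1 mul1r.
by simpc.
Qed.

Lemma conj_unit z : modulus z = 1 -> z^*%C * z = 1.
Proof.
move=> z1; have : modulus z ^+ 2 = 1 by rewrite z1 expr1n.
rewrite sqr_modulus; case: (z) => a b /= h; simpc.
by apply/eqP; rewrite eq_complex /= -h; apply/andP; split; apply/eqP; ring.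
Qed.

Lemma modulus_lt1_neq0 z w : modulus z <= 1 -> modulus w < 1 -> 1 - z * w != 0.
Proof.
move=> z1 w1; rewrite subr_eq0 eq_sym; apply/eqP => /(congr1 modulus).
rewrite modulusM modulus1 => h.
have := modulus_ge0 z; have := modulus_ge0 w; nra.
Qed.

(** Complex differentiability as an inequality between real numbers, with real radii. The case
    [w = z] may stay in, since both sides vanish there. *)
Definition cdiff (f : R[i] -> R[i]) (z l : R[i]) := forall e : R, 0 < e ->
  exists2 d : R, 0 < d & forall w, modulus (w - z) < d ->
    modulus (f w - f z - l * (w - z)) <= e * modulus (w - z).

Lemma derivable_cdiff (f : C -> C) (z : C) :
  derivable f z 1 -> cdiff f z ('D_1 f z).
Proof.
move=> df e e0.
have /cvgrPdist_le /(_ e%:C) := df.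
rewrite ltcR => /(_ e0) /nbhs_ballP[r /= r0 Hr].
have rE : r = (Re r)%:C.
  by move: r0; rewrite ltcE => /andP[/eqP]; case: (r) => a b /= ->.
exists (Re r); first by rewrite -ltcR -rE.
move=> w wz.
have [->|wz0] := eqVneq w z; first by rewrite !subrr mulr0 subrr modulus0 mulr0.
have wz1 : w - z != 0 by rewrite subr_eq0.
have /(_ _ wz1) := Hr (w - z).
rewrite /ball /= sub0r normrN -modulusE [in X in _ < X]rE ltcR => /(_ wz).
rewrite [(w - z) *: 1](_ : _ = w - z); last exact: mulr1.
rewrite subrK -modulusE lecR => h.
rewrite -ler_pdivrMr ?modulus_gt0// -modulusV -modulusM.
move: h; rewrite -[X in X <= _]modulusN opprB; congr (_ <= _); congr modulus.
rewrite mulrBl mulfK//; congr (_ - _).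
by rewrite mulrC.
Qed.

Lemma cdiff_derive (f : C -> C) (z l : C) : cdiff f z l -> is_derive z 1 f l.
Proof.
move=> H.
suff Hc : (fun h : (R[i] : numFieldType) =>
    h^-1 *: ((f \o shift z) (h *: (1 : C)) - f z)) @ 0^' --> l.
  apply: DeriveDef; first by apply/cvg_ex; exists l.
  exact: cvg_lim Hc.
apply/cvgrPdist_le => /= e; rewrite ltcE => /andP[/eqP ie e0].
have eE : e = (Re e)%:C by move: ie; case: (e) => a b /= ->.
have [d d0 Hd] := H _ e0.
apply/nbhs_ballP; exists d%:C => [|h] /=; first by rewrite ltcR.
rewrite /ball /= sub0r normrN -modulusE ltcR => hd h0.
have {}hd : modulus (h + z - z) < d by rewrite addrK.
have := Hd _ hd; rewrite addrK => h1.
rewrite -modulusE eE lecR -modulusN opprB.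
rewrite [h *: 1](_ : _ = h); last exact: mulr1.
have -> : h^-1 *: (f (h + z) - f z) - l = h^-1 * (f (h + z) - f z - l * h).
  by rewrite [in RHS]mulrBr [h^-1 * (l * h)]mulrCA mulVf// mulr1.
by rewrite modulusM modulusV mulrC ler_pdivrMr// modulus_gt0.
Qed.

Lemma cdiff_continuous (f : R[i] -> R[i]) (z l : R[i]) : cdiff f z l ->
  forall e : R, 0 < e -> exists2 d : R, 0 < d & forall w : R[i],
    modulus (w - z) < d -> modulus (f w - f z) <= e.
Proof.
move=> H e e0; have [d d0 Hd] := H 1 ltr01.
have l1 : 0 < 1 + modulus l by rewrite ltr_pwDl// modulus_ge0.
exists (Num.min d (e / (1 + modulus l))).
  by rewrite lt_min d0 divr_gt0.
move=> w; rewrite lt_min => /andP[wd we].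
have h := Hd _ wd.
rewrite -[X in modulus X](subrK (l * (w - z))) (le_trans (modulusD _ _))//.
rewrite modulusM; move: we; rewrite ltr_pdivlMr// => we.
by apply: le_trans (lerD h (lexx _)) _; rewrite -mulrDl mulrC ltW.
Qed.

Lemma cdiff_cst (k z : R[i]) : cdiff (fun=> k) z 0.
Proof.
move=> e e0; exists 1 => // w _.
by rewrite subrr mul0r subrr modulus0 mulr_ge0 ?modulus_ge0 ?ltW.
Qed.

Lemma cdiff_id (z : R[i]) : cdiff id z 1.
Proof.
move=> e e0; exists 1 => // w _.
by rewrite mul1r subrr modulus0 mulr_ge0 ?modulus_ge0 ?ltW.
Qed.

Lemma cdiffD (f g : R[i] -> R[i]) z l m : cdiff f z l -> cdiff g z m ->
  cdiff (fun w => f w + g w) z (l + m).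
Proof.
move=> Hf Hg e e0.
have [r r0 Hr] := Hf _ (divr_gt0 e0 (ltr0n _ 2)).
have [t t0 Ht] := Hg _ (divr_gt0 e0 (ltr0n _ 2)).
exists (Num.min r t) => [|w]; first by rewrite lt_min r0.
rewrite lt_min => /andP[/Hr h1 /Ht h2].
have -> : f w + g w - (f z + g z) - (l + m) * (w - z) =
  (f w - f z - l * (w - z)) + (g w - g z - m * (w - z)) by ring.
by rewrite (le_trans (modulusD _ _))// (le_trans (lerD h1 h2))// -mulrDl -splitr.
Qed.

Lemma cdiffM (f g : R[i] -> R[i]) z l m : cdiff f z l -> cdiff g z m ->
  cdiff (fun w => f w * g w) z (f z * m + l * g z).
Proof.
move=> Hf Hg e e0.
set K := modulus (f z) + 1 + modulus (g z) + modulus m.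
have K0 : 0 < K.
  have := modulus_ge0 (f z); have := modulus_ge0 (g z); have := modulus_ge0 m.
  by rewrite /K; lra.
have e1 : 0 < e / K by rewrite divr_gt0.
have [r r0 Hr] := Hf _ e1; have [t t0 Ht] := Hg _ e1.
have [r' r'0 Hr'] := cdiff_continuous Hf e1.
have [t' t'0 Ht'] := cdiff_continuous Hf ltr01.
exists (Num.min (Num.min r t) (Num.min r' t')) => [|w].
  by rewrite !lt_min r0 t0 r'0.
rewrite !lt_min => /andP[/andP[/Hr h1 /Ht h2] /andP[/Hr' h3 /Ht' h4]].
have -> : f w * g w - f z * g z - (f z * m + l * g z) * (w - z) =
  f w * (g w - g z - m * (w - z)) +
  (g z * (f w - f z - l * (w - z)) + (f w - f z) * (m * (w - z))) by ring.
have fw : modulus (f w) <= modulus (f z) + 1.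
  rewrite -(subrK (f z) (f w)) addrC (le_trans (modulusD _ _))//.
  by rewrite lerD2l.
set D := modulus (w - z) in h1 h2 *.
have D0 : 0 <= D by exact: modulus_ge0.
have -> : e * D = (modulus (f z) + 1) * (e / K * D) +
   (modulus (g z) * (e / K * D) + e / K * (modulus m * D)).
  by rewrite /K; field; rewrite gt_eqF.
rewrite (le_trans (modulusD _ _))// lerD//.
  by rewrite modulusM ler_pM ?modulus_ge0.
rewrite (le_trans (modulusD _ _))// lerD//.
  by rewrite modulusM ler_wpM2l ?modulus_ge0.
by rewrite !modulusM ler_wpM2r// mulr_ge0 ?modulus_ge0.
Qed.

Lemma cdiffV (f : R[i] -> R[i]) z l : f z != 0 -> cdiff f z l ->
  cdiff (fun w => (f w)^-1) z (- l / f z ^+ 2).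
Proof.
move=> fz0 Hf e e0.
have F0 : 0 < modulus (f z) by rewrite modulus_gt0.
set F := modulus (f z) in F0 *.
set K := F + modulus l.
have K0 : 0 < K by rewrite ltr_wpDr ?modulus_ge0.
(* The error of 1/f has denominator [f w * f z ^+ 2], at least F^3/2 in modulus, and a numerator of
   at most [K] times the tolerance times |w - z|. *)
have e1 : 0 < e * F ^+ 3 / (2 * K) by rewrite divr_gt0 ?mulr_gt0 ?exprn_gt0.
have [r r0 Hr] := Hf _ e1.
have [r' r'0 Hr'] := cdiff_continuous Hf e1.
have [t t0 Ht] := cdiff_continuous Hf (divr_gt0 F0 (ltr0n _ 2)).
exists (Num.min r (Num.min r' t)) => [|w]; first by rewrite !lt_min r0 t0 r'0.
rewrite !lt_min => /andP[/Hr h1 /andP[/Hr' h2 /Ht h3]].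
have fw : F / 2 <= modulus (f w).
  have := modulus_dist (f w) (f z); rewrite -/F ler_norml.
  by move: h3; lra.
have fw0 : f w != 0 by rewrite -modulus_gt0; lra.
have -> : (f w)^-1 - (f z)^-1 - - l / f z ^+ 2 * (w - z) =
  ((l * (w - z)) * (f w - f z) - (f w - f z - l * (w - z)) * f z)
   / (f w * f z ^+ 2) by field; rewrite fz0 fw0.
rewrite modulusM modulusV modulusM modulusX -/F.
rewrite ler_pdivrMr ?mulr_gt0 ?exprn_gt0//; last lra.
set D := modulus (w - z) in h1 *.
have D0 : 0 <= D by exact: modulus_ge0.
rewrite (le_trans (modulusBD _ _))//.
have h4 : modulus (l * (w - z) * (f w - f z)) <=
    modulus l * D * (e * F ^+ 3 / (2 * K)).
  by rewrite !modulusM ler_wpM2l// mulr_ge0 ?modulus_ge0.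
have h5 : modulus ((f w - f z - l * (w - z)) * f z) <=
    e * F ^+ 3 / (2 * K) * D * F.
  by rewrite modulusM ler_wpM2r// ltW.
rewrite (le_trans (lerD h4 h5))//.
have -> : modulus l * D * (e * F ^+ 3 / (2 * K)) + e * F ^+ 3 / (2 * K) * D * F
  = e * D * (F / 2 * F ^+ 2) by rewrite /K; field; rewrite gt_eqF.
rewrite ler_wpM2l ?mulr_ge0 ?(ltW e0)//.
by rewrite ler_wpM2r ?exprn_ge0 ?(ltW F0).
Qed.

Definition reP (f : R[i] -> R[i]) (x y : R) := Re (f (x +i* y)).
Definition imP (f : R[i] -> R[i]) (x y : R) := Im (f (x +i* y)).

(** The form Im f dx + Re f dy is the imaginary part of f dz. The Cauchy-Riemann equations say that
    dy-derivative of Im f and dx-derivative of Re f are both Re l. *)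
Lemma cdiff_closed_im (f : R[i] -> R[i]) (x y : R) (l : R[i]) :
  cdiff f (x +i* y) l -> closed_at (imP f) (reP f) x y.
Proof.
move=> H; exists (Im l), (Re l), (- Im l) => e e0.
have [d d0 Hd] := H _ e0.
exists (d / 2) => [|x' y' xd yd]; first exact: divr_gt0.
have E : (x' +i* y') - (x +i* y) = (x' - x) +i* (y' - y) by [].
have lt : modulus ((x' +i* y') - (x +i* y)) <= `|x' - x| + `|y' - y|.
  by rewrite E (le_trans (modulus_le_ReIm _)).
have := Hd (x' +i* y').
rewrite (le_lt_trans lt) => [/(_ isT)|]; last by lra.
move=> h; have {}h := le_trans h (ler_wpM2l (ltW e0) lt).
split.
- apply: le_trans h; apply: le_trans (Im_le_modulus _).
  rewrite /imP E; case: (f _) => a b; case: (f _) => a' b'; case: (l) => u v /=.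
  by rewrite le_eqVlt; apply/orP; left; apply/eqP; congr Num.norm; ring.
- apply: le_trans h; apply: le_trans (Re_le_modulus _).
  rewrite /reP E; case: (f _) => a b; case: (f _) => a' b'; case: (l) => u v /=.
  by rewrite le_eqVlt; apply/orP; left; apply/eqP; congr Num.norm; ring.
Qed.

End modulus_theory.

(** * Circulation around a simple pole *)

Section pole.
Context {R : realType}.
Local Notation C := (R[i]^o).
Local Notation leb := (@lebesgue_measure R).
Implicit Types (h f : R[i] -> R[i]) (z w : R[i]).

Lemma Re_div z (a b : R) : Re (z / (a +i* b)) = (Re z * a + Im z * b) / (a ^+ 2 + b ^+ 2).
Proof.
rewrite -[(a +i* b)^-1]/((a / (a ^+ 2 + b ^+ 2)) -i* (b / (a ^+ 2 + b ^+ 2))).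
by case: z => u v /=; ring.
Qed.

Lemma Im_div z (a b : R) : Im (z / (a +i* b)) = (Im z * a - Re z * b) / (a ^+ 2 + b ^+ 2).
Proof.
rewrite -[(a +i* b)^-1]/((a / (a ^+ 2 + b ^+ 2)) -i* (b / (a ^+ 2 + b ^+ 2))).
by case: z => u v /=; ring.
Qed.

(** Lets a bound on a real part, which is what circulations and the real mean value theorem give,
    serve as a bound on a modulus. *)
Lemma rotate_to_modulus z :
  exists2 u, modulus u = 1 & Re (u * z) = modulus z.
Proof.
have [->|z0] := eqVneq z 0.
  by exists 1; rewrite ?modulus1// mulr0 modulus0.
have hz : modulus z != 0 by rewrite modulus_eq0.
exists (z^*%C / (modulus z)%:C).
  rewrite modulusM modulusV modulus_conj modulusC ger0_norm ?modulus_ge0//.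
  by rewrite divff.
rewrite mulrAC Re_div expr0n addr0 mulr0 addr0.
have -> : Re (z^*%C * z) = modulus z ^+ 2.
  by rewrite sqr_modulus; case: (z) => p q /=; ring.
by move: hz; set m := modulus _ => hz; field.
Qed.

Lemma Rintegral_ge (g : R -> R) a b m : a <= b ->
  (forall x, a <= x <= b -> {for x, continuous g}) ->
  (forall x, a <= x <= b -> m <= g x) ->
  m * (b - a) <= \int[leb]_(x in `[a, b]) g x.
Proof.
move=> ab gc gm.
have -> : m * (b - a) = \int[leb]_(x in `[a, b]) m.
  rewrite Rintegral_cst //=; rewrite lebesgue_measure_itv /= lte_fin.
  case: ltP => // ba; have -> : a = b by apply/eqP; rewrite eq_le ab ba.
  by rewrite subrr /=.
apply: le_Rintegral => //.
- by apply: integrable_pt_continuous => x _; exact: cst_continuous.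
- exact: integrable_pt_continuous.
Qed.

Lemma cdiff_quotient h z0 w l : w != z0 -> cdiff h w l ->
  exists m, cdiff (fun w => h w / (w - z0)) w m.
Proof.
move=> wz dh; exists (h w * (- (1 + 0) / (w - z0) ^+ 2) + l * (w - z0)^-1).
apply: cdiffM => //; apply: cdiffV; first by rewrite subr_eq0.
by apply: cdiffD; [exact: cdiff_id|exact: cdiff_cst].
Qed.

(** The integrand on two opposite sides of a square of half-side [eps] centred at the pole,
    [u + i v] and [u' + i v'] being the values of the numerator there. Pairing the sides cancels the
    [v] terms up to the oscillation [e], and t^2 + eps^2 <= 2 eps^2 replaces the arctangent
    integral. *)
Lemma pole_kernel_bound (u v u' v' u0 v0 e eps t : R) : 0 < eps -> 0 <= u0 ->
  `|t| <= eps -> `|u - u0| <= e -> `|u' - u0| <= e -> `|v - v0| <= e ->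
  `|v' - v0| <= e ->
  (u0 - 4 * e) / eps <= (eps * (u + u') + t * (v - v')) / (t ^+ 2 + eps ^+ 2).
Proof.
move=> e0 u00 te hu hu' hv hv'.
have hn : eps ^+ 2 <= t ^+ 2 + eps ^+ 2 <= 2 * eps ^+ 2.
  have : t ^+ 2 <= eps ^+ 2.
    by rewrite -[t ^+ 2]real_normK ?num_real// lerXn2r ?nnegrE// ltW.
  by have := sqr_ge0 t; lra.
have n0 : 0 < t ^+ 2 + eps ^+ 2.
  by case/andP: hn => + _; apply: lt_le_trans; rewrite exprn_gt0.
have ee : 0 <= e by apply: le_trans hu.
rewrite ler_pdivlMr// mulrAC ler_pdivrMr//.
have hv2 : `|v - v'| <= 2 * e.
  move: hv hv'; rewrite !ler_norml; lra.
have tv : - (2 * e * eps) <= t * (v - v').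
  have : `|t * (v - v')| <= 2 * e * eps.
    by rewrite normrM mulrC ler_pM.
  by rewrite ler_norml => /andP[].
have uu : 2 * u0 - 2 * e <= u + u'.
  move: hu hu'; rewrite !ler_norml; lra.
have h1 : (2 * u0 - 4 * e) * eps <= eps * (u + u') + t * (v - v') by nra.
apply: le_trans (_ : (2 * u0 - 4 * e) * eps * eps <= _); last first.
  by rewrite ler_wpM2r// ltW.
case/andP: hn; rewrite expr2; nra.
Qed.

Section with_pole.
Variables (h : R[i] -> R[i]) (x0 y0 a b c d rho : R).
Hypotheses (rho0 : 0 < rho) (ax : a <= x0 - rho) (xb : x0 + rho <= b)
  (cy : c <= y0 - rho) (yd : y0 + rho <= d).
Hypothesis h_cont : forall e : R, 0 < e -> exists2 r : R, 0 < r &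
  forall w : R[i], modulus (w - (x0 +i* y0)) < r ->
    modulus (h w - h (x0 +i* y0)) <= e.
Hypothesis h_diff : forall x y, a <= x <= b -> c <= y <= d ->
  x +i* y != x0 +i* y0 -> exists l, cdiff h (x +i* y) l.

Let k (w : R[i]) : R[i] := h w / (w - (x0 +i* y0)).

Let k_closed x y : a <= x <= b -> c <= y <= d -> x +i* y != x0 +i* y0 ->
  closed_at (imP k) (reP k) x y.
Proof.
move=> xa yc ne; have [l dh] := h_diff xa yc ne.
by have [m dk] := cdiff_quotient ne dh; apply: cdiff_closed_im dk.
Qed.

Let ne_x x y : x != x0 -> x +i* y != x0 +i* y0.
Proof. by rewrite eq_complex /= => /negbTE ->. Qed.

Let ne_y x y : y != y0 -> x +i* y != x0 +i* y0.
Proof. by rewrite eq_complex /= andbC => /negbTE ->. Qed.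

(** The circulation is really 2 pi times the real part. The bound 1/(2 eps^2) on the kernel gives
    twice that real part for each pair of sides, hence the factor 4. *)
Lemma pole_Re : 0 <= Re (h (x0 +i* y0)) ->
  4 * Re (h (x0 +i* y0)) <= circ (imP k) (reP k) a b c d.
Proof.
move: (rho0) (ax) (xb) (cy) (yd) => ? ? ? ? ?.
(* Each of the two pairs of sides of the tiny square loses [8 * e]. *)
move=> u0; suff main (e : R) : 0 < e ->
    4 * Re (h (x0 +i* y0)) <= circ (imP k) (reP k) a b c d + 16 * e.
  apply/ler_addgt0Pr => e e0; have /main := divr_gt0 e0 (ltr0n R 16).
  by rewrite (_ : 16 * (e / 16) = e)//; field.
move=> e0.
have [r r0 Hr] := h_cont e0.
have [eps [eps0 epsr epsrho]] :
    exists eps : R, [/\ 0 < eps, eps <= r / 3 & eps <= rho].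
  exists (Num.min (r / 3) rho); split.
  - by rewrite lt_min rho0 divr_gt0.
  - by rewrite ge_min lexx.
  - by rewrite ge_min lexx orbT.
have nearP (s t : R) : `|s| <= eps -> `|t| <= eps ->
    `|Re (h ((x0 + s) +i* (y0 + t))) - Re (h (x0 +i* y0))| <= e /\
    `|Im (h ((x0 + s) +i* (y0 + t))) - Im (h (x0 +i* y0))| <= e.
  move=> hs ht; set w := _ +i* (y0 + t).
  have wE : w - (x0 +i* y0) = s +i* t.
    by rewrite /w; simpc; congr (_ +i* _); ring.
  have : modulus (w - (x0 +i* y0)) < r.
    by rewrite wE (le_lt_trans (modulus_le_ReIm _))//=; lra.
  move=> /Hr; set A := h w; set B := h (x0 +i* y0) => hAB.
  split.
    apply: le_trans hAB; apply: le_trans (Re_le_modulus _).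
    by case: A => ? ?; case: B => ? ? /=.
  apply: le_trans hAB; apply: le_trans (Im_le_modulus _).
  by case: A => ? ?; case: B => ? ? /=.
have kE s t : k ((x0 + s) +i* (y0 + t)) = h ((x0 + s) +i* (y0 + t)) / (s +i* t).
  by rewrite /k; congr (_ / _); simpc; congr (_ +i* _); ring.
rewrite (@circ_frame _ _ _ a (x0 - eps) (x0 + eps) b c (y0 - eps) (y0 + eps) d);
  try lra; last first.
  move=> x y xa yc nin; apply: k_closed => //; apply/eqP => -[xx yy].
  by move/negP : nin; apply; rewrite xx yy; lra.
have ee : `|eps| <= eps by rewrite gtr0_norm.
have ee' : `|- eps| <= eps by rewrite normrN.
have in_x x : x0 - eps <= x <= x0 + eps -> a <= x <= b by move=> ?; lra.
have in_y y : y0 - eps <= y <= y0 + eps -> c <= y <= d by move=> ?; lra.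
set u := Re (h (x0 +i* y0)).
have len (t : R) : t + eps - (t - eps) = 2 * eps by ring.
have mE : (u - 4 * e) / eps * (2 * eps) = 2 * u - 8 * e by field; rewrite gt_eqF.
have I1 : 2 * u - 8 * e <= \int[leb]_(x in `[x0 - eps, x0 + eps])
   (imP k x (y0 - eps) - imP k x (y0 + eps)).
  rewrite -mE -(len x0); apply: Rintegral_ge; first by lra.
    move=> x xe; have xa := in_x _ xe; apply: continuousB.
      have : closed_at (imP k) (reP k) x (y0 - eps).
        by apply: k_closed => //; [lra|apply: ne_y; apply/eqP => *; lra].
      by case/closed_at_continuous.
    have : closed_at (imP k) (reP k) x (y0 + eps).
      by apply: k_closed => //; [lra|apply: ne_y; apply/eqP => *; lra].
    by case/closed_at_continuous.
  move=> x xe; pose s := x - x0.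
  have hs : `|s| <= eps by rewrite /s ler_norml; lra.
  have -> : x = x0 + s by rewrite /s; ring.
  rewrite /imP !kE !Im_div sqrrN -mulrBl.
  have [h1 h2] := nearP s (- eps) hs ee'; have [h3 h4] := nearP s eps hs ee.
  apply: le_trans (pole_kernel_bound eps0 u0 hs h1 h3 h2 h4) _.
  by rewrite le_eqVlt; apply/orP; left; apply/eqP; congr (_ / _); ring.
have I2 : 2 * u - 8 * e <= \int[leb]_(y in `[y0 - eps, y0 + eps])
   (reP k (x0 + eps) y - reP k (x0 - eps) y).
  rewrite -mE -(len y0); apply: Rintegral_ge; first by lra.
    move=> y ye; have yc := in_y _ ye; apply: continuousB.
      have : closed_at (imP k) (reP k) (x0 + eps) y.
        by apply: k_closed => //; [lra|apply: ne_x; apply/eqP => *; lra].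
      by case/closed_at_continuous.
    have : closed_at (imP k) (reP k) (x0 - eps) y.
      by apply: k_closed => //; [lra|apply: ne_x; apply/eqP => *; lra].
    by case/closed_at_continuous.
  move=> y ye; pose s := y - y0.
  have hs : `|s| <= eps by rewrite /s ler_norml; lra.
  have -> : y = y0 + s by rewrite /s; ring.
  rewrite /reP !kE !Re_div sqrrN -mulrBl.
  have [h1 h2] := nearP (- eps) s ee' hs; have [h3 h4] := nearP eps s ee hs.
  apply: le_trans (pole_kernel_bound eps0 u0 hs h3 h1 h4 h2) _.
  by rewrite le_eqVlt; apply/orP; left; apply/eqP; congr (_ / _); ring.
rewrite /circ; lra.
Qed.

(** On the sides |w - z0| >= rho, so rho |k| <= |h|. The right-hand side is an extended real because
    its terms are later compared with slices of an area integral. *)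
Lemma circ_le_lines : (rho%:E * (circ (imP k) (reP k) a b c d)%:E <=
  \int[leb]_(x in `[a, b])
     (modulus (h (x +i* c)) + modulus (h (x +i* d)))%:E +
  \int[leb]_(y in `[c, d])
     (modulus (h (a +i* y)) + modulus (h (b +i* y)))%:E)%E.
Proof.
move: (rho0) (ax) (xb) (cy) (yd) => ? ? ? ? ?.
have hc x y : a <= x <= b -> c <= y <= d -> x +i* y != x0 +i* y0 ->
    {for x, continuous (fun t => modulus (h (t +i* y)))} /\
    {for y, continuous (fun t => modulus (h (x +i* t)))}.
  move=> xa yc ne; have [l /cdiff_continuous H] := h_diff xa yc ne.
  split; apply/cvgrPdist_le => /= e e0; have [r r0 Hr] := H _ e0.
    near=> t; rewrite distrC (le_trans (modulus_dist _ _))// Hr//.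
    rewrite -[_ - _]/((t - x) +i* (y - y)) subrr.
    rewrite (le_lt_trans (modulus_le_ReIm _))//= normr0 addr0.
    by near: t; apply: cvgr_distC_lt => //; exact: cvg_id.
  near=> t; rewrite distrC (le_trans (modulus_dist _ _))// Hr//.
  rewrite -[_ - _]/((x - x) +i* (t - y)) subrr.
  rewrite (le_lt_trans (modulus_le_ReIm _))//= normr0 add0r.
  by near: t; apply: cvgr_distC_lt => //; exact: cvg_id.
have key (s t : R) (F G H : R -> R) : s <= t ->
    (forall x, s <= x <= t -> {for x, continuous F}) ->
    (forall x, s <= x <= t -> {for x, continuous G}) ->
    (forall x, s <= x <= t -> {for x, continuous H}) ->
    (forall x, s <= x <= t -> rho * F x <= G x + H x) ->
    (rho%:E * (\int[leb]_(x in `[s, t]) F x)%:E <=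
     \int[leb]_(x in `[s, t]) (G x + H x)%:E)%E.
  move=> st Fc Gc Hc FGH.
  have iF := integrable_pt_continuous Fc.
  have iGH : leb.-integrable `[s, t] (EFin \o (fun x => G x + H x)).
    by apply: integrable_pt_continuous => x xs; apply: continuousD; auto.
  have irF : leb.-integrable `[s, t] (EFin \o (fun x => rho * F x)).
    apply: integrable_pt_continuous => x xs.
    by apply: continuousM; [exact: cst_continuous|exact: Fc].
  have -> : (\int[leb]_(x in `[s, t]) (G x + H x)%:E)%E =
     (\int[leb]_(x in `[s, t]) (G x + H x))%:E.
    by rewrite /Rintegral fineK// integrable_fin_num.
  rewrite -EFinM lee_fin -(RintegralZl _ _ iF)//.
  apply: (le_Rintegral _ irF iGH) => //.
have kb w w' : rho <= modulus (w - (x0 +i* y0)) ->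
   rho <= modulus (w' - (x0 +i* y0)) ->
   rho * (Im (k w) - Im (k w')) <= modulus (h w) + modulus (h w') /\
   rho * (Re (k w) - Re (k w')) <= modulus (h w) + modulus (h w').
  have kw v : rho <= modulus (v - (x0 +i* y0)) -> rho * modulus (k v) <= modulus (h v).
    move=> hv; rewrite modulusM modulusV mulrCA ler_piMr ?modulus_ge0//.
    by rewrite ler_pdivrMr ?mul1r// (lt_le_trans rho0).
  move=> /kw h1 /kw h2.
  have := Im_le_modulus (k w); have := Im_le_modulus (k w').
  have := Re_le_modulus (k w); have := Re_le_modulus (k w').
  rewrite !ler_norml; nra.
have far_x x y : rho <= `|x - x0| -> rho <= modulus ((x +i* y) - (x0 +i* y0)).
  move=> hx; apply: (le_trans hx).
  by have := Re_le_modulus ((x +i* y) - (x0 +i* y0)).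
have far_y x y : rho <= `|y - y0| -> rho <= modulus ((x +i* y) - (x0 +i* y0)).
  move=> hx; apply: (le_trans hx).
  by have := Im_le_modulus ((x +i* y) - (x0 +i* y0)).
have fa : rho <= `|a - x0| by rewrite ler0_norm; lra.
have fb : rho <= `|b - x0| by rewrite ger0_norm; lra.
have fc : rho <= `|c - y0| by rewrite ler0_norm; lra.
have fd : rho <= `|d - y0| by rewrite ger0_norm; lra.
have na y : a +i* y != x0 +i* y0 by apply: ne_x; apply/eqP => *; lra.
have nb y : b +i* y != x0 +i* y0 by apply: ne_x; apply/eqP => *; lra.
have nc x : x +i* c != x0 +i* y0 by apply: ne_y; apply/eqP => *; lra.
have nd x : x +i* d != x0 +i* y0 by apply: ne_y; apply/eqP => *; lra.
have aa : a <= a <= b by lra.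
have bb : a <= b <= b by lra.
have cc : c <= c <= d by lra.
have dd : c <= d <= d by lra.
rewrite /circ EFinD muleDr// leeD//; apply: key; try lra.
- move=> x xa; apply: continuousB.
    by have [] := closed_at_continuous (k_closed xa cc (nc x)).
  by have [] := closed_at_continuous (k_closed xa dd (nd x)).
- by move=> x xa; have [] := hc x c xa cc (nc x).
- by move=> x xa; have [] := hc x d xa dd (nd x).
- by move=> x xa; have [] := kb (x +i* c) (x +i* d) (far_y _ _ fc) (far_y _ _ fd).
- move=> y yc; apply: continuousB.
    by have [] := closed_at_continuous (k_closed bb yc (nb y)).
  by have [] := closed_at_continuous (k_closed aa yc (na y)).
- by move=> y yc; have [] := hc a y aa yc (na y).
- by move=> y yc; have [] := hc b y bb yc (nb y).
- move=> y yc; rewrite [leRHS]addrC.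
  by have [] := kb (b +i* y) (a +i* y) (far_x _ _ fb) (far_x _ _ fa).
Unshelve. all: by end_near. Qed.

End with_pole.

(* The imaginary part of [h w / (w - z0)], with [h z0] rotated to be
   nonnegative, has circulation about [4 * h z0] around a tiny square centred at
   [z0]; [circ_frame] carries this to the outer rectangle. *)
Lemma pole_modulus h x0 y0 a b c d rho :
  0 < rho -> a <= x0 - rho -> x0 + rho <= b -> c <= y0 - rho -> y0 + rho <= d ->
  (forall e : R, 0 < e -> exists2 r : R, 0 < r &
    forall w : R[i], modulus (w - (x0 +i* y0)) < r ->
    modulus (h w - h (x0 +i* y0)) <= e) ->
  (forall x y, a <= x <= b -> c <= y <= d ->
    x +i* y != x0 +i* y0 -> exists l, cdiff h (x +i* y) l) ->
  ((4 * rho * modulus (h (x0 +i* y0)))%:E <=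
  \int[leb]_(x in `[a, b])
     (modulus (h (x +i* c)) + modulus (h (x +i* d)))%:E +
  \int[leb]_(y in `[c, d])
     (modulus (h (a +i* y)) + modulus (h (b +i* y)))%:E)%E.
Proof.
move=> rho0 ax xb cy yd hcont hdiff.
set z0 := x0 +i* y0 in hcont hdiff *.
have [u u1 uh] := rotate_to_modulus (h z0).
pose g (w : R[i]) : R[i] := u * h w.
have gm w : modulus (g w) = modulus (h w) by rewrite modulusM u1 mul1r.
have gcont (e : R) : 0 < e -> exists2 r : R, 0 < r &
    forall w : R[i], modulus (w - (x0 +i* y0)) < r ->
    modulus (g w - g (x0 +i* y0)) <= e.
  move=> /hcont[r r0 Hr]; exists r => // w /Hr.
  by rewrite /g -mulrBr modulusM u1 mul1r.
have gdiff x y : a <= x <= b -> c <= y <= d ->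
    x +i* y != x0 +i* y0 -> exists l, cdiff g (x +i* y) l.
  move=> xa yc ne; have [l dh] := hdiff _ _ xa yc ne.
  by exists (u * l + 0 * h (x +i* y)); apply: cdiffM => //; exact: cdiff_cst.
have g0 : 0 <= Re (g (x0 +i* y0)) by rewrite uh modulus_ge0.
have H1 := pole_Re rho0 ax xb cy yd gcont gdiff g0.
have H2 := circ_le_lines rho0 ax xb cy yd gdiff.
under eq_integral do rewrite -!gm.
under [X in (_ + X)%E]eq_integral do rewrite -!gm.
apply: le_trans H2; rewrite -EFinM lee_fin mulrAC mulrC ler_wpM2l ?(ltW rho0)//.
by rewrite -uh.
Qed.

End pole.

(** * Measurability in the plane *)

Section measure_tools.
Context {R : realType}.

(* Lower integrals are monotone, whence no measurability assumption. *)
Lemma ge0_le_integralW d (T : measurableType d)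
    (mu : {measure set T -> \bar R}) (A B : set T) (f g : T -> \bar R) :
  A `<=` B -> (forall x, A x -> (0 <= f x)%E) ->
  (forall x, B x -> (0 <= g x)%E) -> (forall x, A x -> (f x <= g x)%E) ->
  (\int[mu]_(x in A) f x <= \int[mu]_(x in B) g x)%E.
Proof.
move=> AB f0 g0 fg; rewrite !ge0_integralE//.
apply: ge_ereal_sup => _ [h /= hf <-]; apply: ereal_sup_ubound.
exists h => //= x; apply: le_trans (hf x) _; rewrite /patch.
case: ifPn => [/set_mem Ax|_].
  by rewrite mem_set ?fg//; exact: AB.
by case: ifPn => // /set_mem /g0.
Qed.

Implicit Types (A D : set (plane R)).

Definition box_open A := forall w, A w -> exists2 r : R, 0 < r &
  forall w', `|w'.1 - w.1| < r -> `|w'.2 - w.2| < r -> A w'.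

(** Such a set is the countable union of the rational rectangles that it contains. *)
Lemma box_open_measurable A : box_open A -> measurable A.
Proof.
move=> oA.
pose rect (q : (rat * rat) * (rat * rat)) : set (plane R) :=
  `]ratr q.1.1, ratr q.1.2[ `*` `]ratr q.2.1, ratr q.2.2[.
pose F q := if `[< rect q `<=` A >] then rect q else set0.
have -> : A = \bigcup_q F q.
  apply/seteqP; split => [w Aw|w [q _]]; last first.
    by rewrite /F; case: asboolP => // qA; exact: qA.
  have [r r0 Hr] := oA _ Aw.
  have [q1 /andP[a1 a2]] : exists q : rat, w.1 - r < ratr q < w.1.
    have /rat_in_itvoo[q] : w.1 - r < w.1 by rewrite ltrBlDr ltrDl.
    by rewrite in_itv => ?; exists q.
  have [q2 /andP[b1 b2]] : exists q : rat, w.1 < ratr q < w.1 + r.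
    have /rat_in_itvoo[q] : w.1 < w.1 + r by rewrite ltrDl.
    by rewrite in_itv => ?; exists q.
  have [q3 /andP[c1 c2]] : exists q : rat, w.2 - r < ratr q < w.2.
    have /rat_in_itvoo[q] : w.2 - r < w.2 by rewrite ltrBlDr ltrDl.
    by rewrite in_itv => ?; exists q.
  have [q4 /andP[d1 d2]] : exists q : rat, w.2 < ratr q < w.2 + r.
    have /rat_in_itvoo[q] : w.2 < w.2 + r by rewrite ltrDl.
    by rewrite in_itv => ?; exists q.
  exists ((q1, q2), (q3, q4)) => //; rewrite /F asboolT; last first.
    move=> w' []; rewrite /= !in_itv /= => /andP[e1 e2] /andP[f1 f2].
    apply: Hr; rewrite ltr_norml; apply/andP; split;
      rewrite ?ltrBlDl ?ltrBrDl.
    - exact: lt_trans a1 e1.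
    - exact: lt_trans e2 b2.
    - exact: lt_trans c1 f1.
    - exact: lt_trans f2 d2.
  by split; rewrite /= in_itv /= ?a2 ?b1 ?c2 ?d1.
apply: countable_bigcupT_measurable => // q.
by rewrite /F; case: ifP => _ //; exact: measurableX.
Qed.

(** Continuity at a point of [D] is tested on all nearby points of the plane, inside [D] or not. A
    superlevel set is therefore the trace on [D] of an open set, for any measurable [D]. *)
Lemma box_continuous_measurable D (g : plane R -> R) : measurable D ->
  (forall w, D w -> forall e : R, 0 < e -> exists2 r : R, 0 < r &
    forall w', `|w'.1 - w.1| < r -> `|w'.2 - w.2| < r -> `|g w' - g w| <= e) ->
  measurable_fun D g.
Proof.
move=> mD cg _; apply: (measurability _ (RGenOInfty.measurableE R)) => //.
move=> _ [_ [t ->] <-].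
pose U : set (plane R) := [set w | exists2 r : R, 0 < r &
  forall w', `|w'.1 - w.1| < r -> `|w'.2 - w.2| < r -> t < g w'].
have -> : D `&` g @^-1` `]t, +oo[ = D `&` U.
  apply/seteqP; split => w [Dw]; rewrite /= ?in_itv /= ?andbT => tg; split => //.
    have e0 : 0 < (g w - t) / 2 by rewrite divr_gt0 ?subr_gt0.
    have [r r0 Hr] := cg _ Dw _ e0; exists r => // w' h1 h2.
    by have := Hr _ h1 h2; rewrite ler_norml; lra.
  by case: tg => r r0; apply; rewrite subrr normr0.
apply: measurableI => //; apply: box_open_measurable => w [r r0 Hr].
exists (r / 2) => [|w' h1 h2]; first exact: divr_gt0.
exists (r / 2) => [|w'' k1 k2]; first exact: divr_gt0.
apply: Hr.
  rewrite (splitr r) -(subrK w'.1 w''.1) -addrA (le_lt_trans (ler_normD _ _))//.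
  exact: ltrD.
rewrite (splitr r) -(subrK w'.2 w''.2) -addrA (le_lt_trans (ler_normD _ _))//.
exact: ltrD.
Qed.

Lemma cplx_box (w w' : plane R) (r : R) : `|w'.1 - w.1| < r / 2 ->
  `|w'.2 - w.2| < r / 2 -> modulus (cplx w' - cplx w : R[i]) < r.
Proof.
move=> h1 h2; rewrite (le_lt_trans (modulus_le_ReIm _))//=; lra.
Qed.

Lemma modulus_continuous_measurable D (f : R[i] -> R[i]) : measurable D ->
  (forall w, D w -> forall e : R, 0 < e -> exists2 r : R, 0 < r & forall z,
    modulus (z - cplx w) < r -> modulus (f z - f (cplx w)) <= e) ->
  [/\ measurable_fun D (fun w => modulus (f (cplx w))),
      measurable_fun D (fun w => Re (f (cplx w))) &
      measurable_fun D (fun w => Im (f (cplx w)))].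
Proof.
move=> oD cf; split; apply: box_continuous_measurable => // w Dw e e0.
all: have [r r0 Hr] := cf _ Dw _ e0; exists (r / 2) => [|w' h1 h2].
all: try exact: divr_gt0.
all: have := Hr _ (cplx_box h1 h2); apply: le_trans.
- exact: modulus_dist.
- apply: le_trans (Re_le_modulus _).
  by case: (f _) => ? ?; case: (f _) => ? ?.
- apply: le_trans (Im_le_modulus _).
  by case: (f _) => ? ?; case: (f _) => ? ?.
Qed.

Lemma disk_box_open : box_open (@disk R).
Proof.
move=> w; rewrite /disk /unit_disk /= => w1.
exists ((1 - modulus (cplx w)) / 2) => [|w' h1 h2].
  by rewrite divr_gt0// subr_gt0.
have := le_lt_trans (modulus_dist _ _) (cplx_box h1 h2).
by rewrite ltr_norml => /andP[_]; rewrite ltrBlDr subrK.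
Qed.

Lemma measurable_disk : measurable (@disk R).
Proof. by apply: box_open_measurable; exact: disk_box_open. Qed.

Lemma measurable_modulus : measurable_fun setT (fun w : plane R => modulus (cplx w)).
Proof.
have [] // := @modulus_continuous_measurable setT id.
by move=> w _ e e0; exists e => // z /ltW.
Qed.

End measure_tools.

Section local_estimates.
Context {R : realType}.
Local Notation leb := (@lebesgue_measure R).
Local Notation leb2 := (leb \x leb)%E.
Implicit Types (f g h : R[i] -> R[i]).

Lemma cdiff_near f g z l r : 0 < r ->
  (forall w, modulus (w - z) < r -> f w = g w) -> cdiff f z l -> cdiff g z l.
Proof.
move=> r0 fg H e e0; have [d d0 Hd] := H _ e0.
exists (Num.min r d) => [|w]; first by rewrite lt_min r0.
rewrite lt_min => /andP[wr wd]; rewrite -!fg ?subrr ?modulus0//.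
exact: Hd.
Qed.

Lemma cdiff_line_continuous h x y l : cdiff h (x +i* y) l ->
  {for x, continuous (fun t => modulus (h (t +i* y)))} /\
  {for y, continuous (fun t => modulus (h (x +i* t)))}.
Proof.
move=> /cdiff_continuous H.
split; apply/cvgrPdist_le => /= e e0; have [r r0 Hr] := H _ e0.
  near=> t; rewrite distrC (le_trans (modulus_dist _ _))// Hr//.
  rewrite -[_ - _]/((t - x) +i* (y - y)) subrr.
  rewrite (le_lt_trans (modulus_le_ReIm _))//= normr0 addr0.
  by near: t; apply: cvgr_distC_lt => //; exact: cvg_id.
near=> t; rewrite distrC (le_trans (modulus_dist _ _))// Hr//.
rewrite -[_ - _]/((x - x) +i* (t - y)) subrr.
rewrite (le_lt_trans (modulus_le_ReIm _))//= normr0 add0r.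
by near: t; apply: cvgr_distC_lt => //; exact: cvg_id.
Unshelve. all: by end_near. Qed.

Lemma integral_le_cst (g : R -> R) a b M : a <= b -> 0 <= M ->
  (forall x, a <= x <= b -> 0 <= g x <= M) ->
  (\int[leb]_(x in `[a, b]) (g x)%:E <= (M * (b - a))%:E)%E.
Proof.
move=> ab M0 gM.
have -> : (M * (b - a))%:E = (\int[leb]_(x in `[a, b]) M%:E)%E.
  rewrite integral_cst//=; rewrite lebesgue_measure_itv /= lte_fin.
  case: ltP => // ba; have -> : a = b by apply/eqP; rewrite eq_le ab ba.
  by rewrite subrr mulr0 mule0.
apply: ge0_le_integralW => // x /=; rewrite in_itv /= ?lee_fin => /gM /andP[] //.
Qed.

(** [pole_modulus] is applied to the difference quotient of [f] at z0, given the value [l] there. It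
    only has to be continuous at z0, and is at most 2M/rho on the sides of the square; the four
    sides of length 2 rho sum to 16M, against 4 rho |l|. *)
Lemma cauchy_estimate f x0 y0 rho M l : 0 < rho ->
  (forall x y, `|x - x0| <= rho -> `|y - y0| <= rho ->
    (exists m, cdiff f (x +i* y) m) /\ modulus (f (x +i* y)) <= M) ->
  cdiff f (x0 +i* y0) l -> modulus l <= 4 * M / rho.
Proof.
move=> rho0 H dl; set z0 := x0 +i* y0 in dl *.
have [_ fz0M] := H x0 y0 ltac:(by rewrite subrr normr0 ltW)
                         ltac:(by rewrite subrr normr0 ltW).
have M0 : 0 <= M by apply: le_trans fz0M; exact: modulus_ge0.
pose h w := if w == z0 then l else (f w - f z0) / (w - z0).
have hz0 : h z0 = l by rewrite /h eqxx.
have hw w : w != z0 -> h w = (f w - f z0) / (w - z0) by rewrite /h => /negbTE ->.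
have hcont (e : R) : 0 < e -> exists2 r : R, 0 < r &
    forall w, modulus (w - z0) < r -> modulus (h w - h z0) <= e.
  move=> e0; have [r r0 Hr] := dl _ e0; exists r => // w wr.
  have [->|wz] := eqVneq w z0; first by rewrite subrr modulus0 ltW.
  have wz' : w - z0 != 0 by rewrite subr_eq0.
  rewrite hz0 hw// -[X in _ - X](mulfK wz') -mulrBl modulusM modulusV.
  by rewrite ler_pdivrMr ?modulus_gt0//; exact: Hr.
have hdiff x y : x0 - rho <= x <= x0 + rho -> y0 - rho <= y <= y0 + rho ->
    x +i* y != z0 -> exists m, cdiff h (x +i* y) m.
  move=> xr yr ne; have [||[m dm] _] := H x y; rewrite ?ler_norml; try lra.
  have d1 : cdiff (fun w => f w + - f z0) (x +i* y) (m + 0).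
    by apply: cdiffD => //; exact: cdiff_cst.
  have [m' d2] := cdiff_quotient ne d1.
  exists m'; apply: (cdiff_near _ _ d2).
    by instantiate (1 := modulus ((x +i* y) - z0)); rewrite modulus_gt0 subr_eq0.
  move=> w wr; rewrite hw//; apply/eqP => wz.
  by move: wr; rewrite wz modulusB ltxx.
have bd x y : `|x - x0| <= rho -> `|y - y0| <= rho ->
    rho <= modulus ((x +i* y) - z0) ->
    0 <= modulus (h (x +i* y)) <= 2 * M / rho.
  move=> xr yr far; rewrite modulus_ge0/= hw; last first.
    by apply/eqP => E; move: far; rewrite E subrr modulus0 leNgt rho0.
  have far0 : 0 < modulus ((x +i* y) - z0) by exact: lt_le_trans far.
  rewrite modulusM modulusV ler_pdivrMr//.
  have [_ h1] := H x y xr yr.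
  rewrite (le_trans (modulusBD _ _))// mulrAC ler_pdivlMr//.
  have M2 : 0 <= 2 * M by rewrite mulr_ge0.
  apply: le_trans (_ : 2 * M * rho <= _).
    by rewrite ler_wpM2r ?(ltW rho0)//; rewrite -/z0 in fz0M; lra.
  by rewrite ler_wpM2l.
have rr : `|rho| <= rho by rewrite gtr0_norm.
have len (t : R) : t + rho - (t - rho) = 2 * rho by ring.
have K (s : R) (g1 g2 : R -> R) :
  (forall x, s - rho <= x <= s + rho -> 0 <= g1 x <= 2 * M / rho) ->
  (forall x, s - rho <= x <= s + rho -> 0 <= g2 x <= 2 * M / rho) ->
  (\int[leb]_(x in `[(s - rho)%R, (s + rho)%R]) (g1 x + g2 x)%:E <= (8 * M)%:E)%E.
  move=> h1 h2.
  have -> : 8 * M = (4 * M / rho) * (s + rho - (s - rho)).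
    by rewrite len; field; rewrite gt_eqF.
  apply: integral_le_cst; first lra.
    by rewrite divr_ge0 ?mulr_ge0 ?(ltW rho0).
  move=> x xs; have /andP[? ?] := h1 _ xs; have /andP[? ?] := h2 _ xs.
  have -> : 4 * M / rho = 2 * M / rho + 2 * M / rho by field; rewrite gt_eqF.
  by rewrite addr_ge0//= lerD.
have far_x x y : rho <= `|x - x0| -> rho <= modulus ((x +i* y) - z0).
  by move=> /le_trans; apply; exact: (Re_le_modulus ((x +i* y) - z0)).
have far_y x y : rho <= `|y - y0| -> rho <= modulus ((x +i* y) - z0).
  by move=> /le_trans; apply; exact: (Im_le_modulus ((x +i* y) - z0)).
have e1 (t : R) : `|t - rho - t| = rho.
  by rewrite addrAC subrr add0r normrN gtr0_norm.
have e2 (t : R) : `|t + rho - t| = rho by rewrite addrAC subrr add0r gtr0_norm.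
have := pole_modulus rho0 (lexx _) (lexx _) (lexx _) (lexx _) hcont hdiff.
rewrite hz0 => /le_trans /(_ (leeD (K x0 _ _ _ _) (K y0 _ _ _ _))).
rewrite -EFinD lee_fin => HH.
have : 4 * rho * modulus l <= 16 * M.
  have -> : 16 * M = 8 * M + 8 * M by ring.
  apply: HH => t ts; apply: bd; rewrite ?e1 ?e2 ?ler_norml//; try lra;
    first [by apply: far_x; rewrite ?e1 ?e2|by apply: far_y; rewrite ?e1 ?e2].
by move=> ?; rewrite ler_pdivlMr//; lra.
Qed.

Lemma real_is_derive (phi : R -> R) t m :
  (forall e : R, 0 < e -> exists2 d : R, 0 < d & forall s, `|s - t| < d ->
     `|phi s - phi t - m * (s - t)| <= e * `|s - t|) -> is_derive t 1 phi m.
Proof.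
move=> H.
suff Hc : (fun h : R => h^-1 *: ((phi \o shift t) (h *: (1 : R)) - phi t)) @ 0^' --> m.
  apply: DeriveDef; first by apply/cvg_ex; exists m.
  exact: cvg_lim Hc.
apply/cvgrPdist_le => /= e e0.
have [d d0 Hd] := H _ e0.
apply/nbhs_ballP; exists d => // h; rewrite /ball /= sub0r normrN => hd h0.
have {}hd : `|h + t - t| < d by rewrite addrK.
have := Hd _ hd; rewrite addrK => h1.
rewrite [h *: 1](_ : _ = h); last exact: mulr1.
rewrite distrC.
have -> : h^-1 *: (phi (h + t) - phi t) - m = h^-1 * (phi (h + t) - phi t - m * h).
  by rewrite [in RHS]mulrBr [h^-1 * (m * h)]mulrCA mulVf// mulr1.
by rewrite normrM normrV ?unitfE// mulrC ler_pdivrMr// normr_gt0.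
Qed.

(** The mean value theorem has no complex version, so it is applied to the real function Re (u f)
    along the segment, with the unimodular [u] that makes u (f w - f z) equal to its modulus. *)
Lemma segment_lipschitz f z w L :
  (forall t : R, 0 <= t <= 1 -> exists2 l,
     cdiff f (z + t%:C * (w - z)) l & modulus l <= L) ->
  modulus (f w - f z) <= L * modulus (w - z).
Proof.
move=> H.
set D := f w - f z.
have [u u1 uD] := rotate_to_modulus D.
pose path (t : R) := z + t%:C * (w - z).
pose phi (t : R) := Re (u * f (path t)).
have dphi (t : R) : 0 <= t <= 1 -> exists2 l, is_derive t 1 phi l & l <= L * modulus (w - z).
  move=> t01; have [l dl lL] := H _ t01.
  exists (Re (u * (l * (w - z)))); last first.
    rewrite (le_trans (ler_norm _))// (le_trans (Re_le_modulus _))//.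
    by rewrite !modulusM u1 mul1r ler_wpM2r ?modulus_ge0.
  apply: real_is_derive => e e0.
  have k0 : 0 < 1 + modulus (w - z) by rewrite ltr_pwDl ?modulus_ge0.
  have [d d0 Hd] := dl _ (divr_gt0 e0 k0).
  exists (d / (1 + modulus (w - z))) => [|s sd]; first exact: divr_gt0.
  have pE : path s - (z + t%:C * (w - z)) = (s - t)%:C * (w - z).
    by rewrite /path rmorphB; ring.
  have pm : modulus (path s - (z + t%:C * (w - z))) = `|s - t| * modulus (w - z).
    by rewrite pE modulusM modulusC.
  have sd' : `|s - t| * (1 + modulus (w - z)) < d by rewrite -ltr_pdivlMr.
  have := Hd (path s); rewrite pm => /(_ _) h1.
  have {}h1 : modulus (f (path s) - f (path t) - l * (path s - path t)) <=
      e * `|s - t|.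
    apply: le_trans (h1 _) _.
      by apply: le_lt_trans sd'; rewrite ler_wpM2l// lerDr.
    set m := modulus (w - z) in k0 *.
    have -> : e / (1 + m) * (`|s - t| * m) = e * `|s - t| * (m / (1 + m)) by ring.
    by rewrite ler_piMr ?mulr_ge0 ?(ltW e0)// ler_pdivrMr// mul1r lerDr.
  apply: le_trans h1; rewrite -[leRHS]mul1r -u1 -modulusM.
  apply: le_trans (Re_le_modulus _); rewrite le_eqVlt; apply/orP; left; apply/eqP.
  congr Num.norm; rewrite pE /phi.
  case: (u) => u1' u2; case: (f _) => a b; case: (f _) => a' b'; case: (l) => p q.
  by case: (w - z) => v1 v2 /=; ring.
have cphi : {within `[0, 1], continuous phi}.
  apply: derivable_within_continuous => t; rewrite in_itv /= => /dphi[l [dl _] _].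
  exact: dl.
have [c c01 E] : exists2 c, c \in `](0:R), 1[ & phi 1 - phi 0 = 'D_1 phi c * (1 - 0).
  apply: MVT => // t; rewrite in_itv /= => /andP[t0 t1].
  have [|l dl _] := dphi t; first by rewrite !ltW.
  by apply: DeriveDef => //; apply: ex_derive.
have c01' : 0 <= c <= 1 by move: c01; rewrite in_itv /= => /andP[? ?]; rewrite !ltW.
have [l dl lL] := dphi _ c01'.
have phi10 : phi 1 - phi 0 = modulus D.
  rewrite -uD /phi /path mul1r mul0r addr0 subrKC /D.
  by case: (u) => u1' u2; case: (f _) => a b; case: (f _) => a' b' /=; ring.
by rewrite -phi10 E subr0 mulr1 derive_val.
Qed.

End local_estimates.

(** * Submean value inequalities for the derivative *)

Section mean_value.
Context {R : realType}.
Local Notation leb := (@lebesgue_measure R).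
Local Notation leb2 := (leb \x leb)%E.
Implicit Types (f df g : R[i] -> R[i]).

Lemma cdiff_line_measurable (h : R[i] -> R[i]) a b y : (forall x, a <= x <= b ->
    exists l, cdiff h (x +i* y) l) ->
  measurable_fun (`[a, b]%classic : set R) (fun x : R => modulus (h (x +i* y))).
Proof.
move=> H; apply/measurable_EFinP; apply: (@measurable_int _ _ _ leb).
apply: integrable_pt_continuous => x /H[l].
by case/cdiff_line_continuous.
Qed.

Lemma cdiff_vline_measurable (h : R[i] -> R[i]) c d x : (forall y, c <= y <= d ->
    exists l, cdiff h (x +i* y) l) ->
  measurable_fun (`[c, d]%classic : set R) (fun y : R => modulus (h (x +i* y))).
Proof.
move=> H; apply/measurable_EFinP; apply: (@measurable_int _ _ _ leb).
apply: integrable_pt_continuous => y /H[l].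
by case/cdiff_line_continuous.
Qed.

Definition sq (x0 y0 h : R) : set (plane R) :=
  `[x0 - h, x0 + h] `*` `[y0 - h, y0 + h].

Lemma sqP x0 y0 h (w : plane R) :
  sq x0 y0 h w <-> `|w.1 - x0| <= h /\ `|w.2 - y0| <= h.
Proof.
by rewrite /sq /= !in_itv /= !ler_distl.
Qed.

Lemma measurable_sq x0 y0 h : measurable (sq x0 y0 h).
Proof. exact: measurableX. Qed.

Lemma measure_sq (x0 y0 h : R) : 0 <= h -> leb2 (sq x0 y0 h) = (4 * h ^+ 2)%:E.
Proof.
move=> h0; rewrite product_measure1E//=; rewrite !lebesgue_measure_itv /=.
have E (t : R) : t + h - (t - h) = 2 * h by ring.
have [->|hn] := eqVneq h 0.
  by rewrite !subr0 !addr0 !ltxx mul0e expr0n mulr0.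
have h1 : 0 < h by rewrite lt_def hn.
have l1 : x0 - h < x0 + h by lra.
have l2 : y0 - h < y0 + h by lra.
rewrite !lte_fin l1 l2.
by rewrite -!EFinB !E -EFinM; congr (_%:E); ring.
Qed.

(** Call a line good when the integral of |g| along it is below h T / 2. If one of the four outer
    strips of width h/2 has no good line, Fubini on that strip gives h^2 T / 4. Otherwise four good
    lines bound a rectangle whose sides are at distance at least h/2 from the centre, and
    [pole_modulus] gives 2 h T <= sum of four integrals < 2 h T. *)
Lemma submean1 g (x0 y0 h : R) : 0 < h ->
  (forall x y, `|x - x0| <= h -> `|y - y0| <= h ->
     exists m, cdiff g (x +i* y) m) ->
  ((h ^+ 2 / 4 * modulus (g (x0 +i* y0)))%:E <=
   \int[leb2]_(w in sq x0 y0 h) (modulus (g (cplx w)))%:E)%E.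
Proof.
move=> h0 H; set T := modulus (g (x0 +i* y0)).
have [T0|T0] := eqVneq T 0.
  by rewrite T0 mulr0 integral_ge0// => w _; rewrite lee_fin modulus_ge0.
have {}T0 : 0 < T by rewrite lt_def T0 modulus_ge0.
pose F (w : plane R) : \bar R := (modulus (g (cplx w)))%:E.
have F0 w : (0 <= F w)%E by rewrite lee_fin modulus_ge0.
have mF : measurable_fun (sq x0 y0 h) F.
  apply/measurable_EFinP.
  have [] // := @modulus_continuous_measurable _ (sq x0 y0 h) g.
    exact: measurable_sq.
  move=> w /sqP[wx wy] e e0; have [m dm] := H _ _ wx wy.
  exact: cdiff_continuous dm e e0.
have mFr : measurable_fun setT (F \_ (sq x0 y0 h)).
  by apply/(measurable_restrictT _ _).1 => //; exact: measurable_sq.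
have Fr0 w : (0 <= (F \_ (sq x0 y0 h)) w)%E by rewrite /patch; case: ifP.
rewrite integral_mkcond -/F.
pose X x := (\int[leb]_(y in `[(y0 - h)%R, (y0 + h)%R]) F (x, y))%E.
pose Y y := (\int[leb]_(x in `[(x0 - h)%R, (x0 + h)%R]) F (x, y))%E.
have XF x : `|x - x0| <= h ->
    (X x <= \int[leb]_y ((F \_ (sq x0 y0 h)) (x, y)))%E.
  move=> xh; apply: ge0_le_integralW => // y yh; rewrite /patch ifT// inE.
  by apply/sqP; split => //=; rewrite ler_distl; move: yh; rewrite /= in_itv.
have YF y : `|y - y0| <= h ->
    (Y y <= \int[leb]_x ((F \_ (sq x0 y0 h)) (x, y)))%E.
  move=> yh; apply: ge0_le_integralW => // x xh; rewrite /patch ifT// inE.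
  by apply/sqP; split => //=; rewrite ler_distl; move: xh; rewrite /= in_itv.
have len (s : R) (G : R -> \bar R) : (forall x, (0 <= G x)%E) ->
   (forall x, s <= x <= s + h / 2 -> ((h * T / 2)%:E <= G x)%E) ->
   ((h ^+ 2 / 4 * T)%:E <= \int[leb]_x G x)%E.
  move=> G0 HG.
  have -> : (h ^+ 2 / 4 * T)%:E =
     (\int[leb]_(x in `[s, (s + h / 2)%R]) (h * T / 2)%:E)%E.
    rewrite integral_cst//=; rewrite lebesgue_measure_itv /= lte_fin.
    rewrite ltrDl divr_gt0// -EFinB -EFinM; congr (_%:E).
    by field.
  apply: ge0_le_integralW => // x _.
  by rewrite lee_fin divr_ge0 ?mulr_ge0 ?ltW.
have GX0 x : (0 <= \int[leb]_y ((F \_ (sq x0 y0 h)) (x, y)))%E.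
  exact: integral_ge0.
have GY0 y : (0 <= \int[leb]_x ((F \_ (sq x0 y0 h)) (x, y)))%E.
  exact: integral_ge0.
have viaX s : (forall x, s <= x <= s + h / 2 -> `|x - x0| <= h) ->
    (forall x, s <= x <= s + h / 2 -> ((h * T / 2)%:E <= X x)%E) ->
   ((h ^+ 2 / 4 * T)%:E <= \int[leb2]_w (F \_ (sq x0 y0 h)) w)%E.
  move=> sh sX; rewrite fubini_tonelli1//; apply: (len s) => // x xs.
  exact: le_trans (sX _ xs) (XF _ (sh _ xs)).
have viaY s : (forall y, s <= y <= s + h / 2 -> `|y - y0| <= h) ->
    (forall y, s <= y <= s + h / 2 -> ((h * T / 2)%:E <= Y y)%E) ->
   ((h ^+ 2 / 4 * T)%:E <= \int[leb2]_w (F \_ (sq x0 y0 h)) w)%E.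
  move=> sh sX; rewrite fubini_tonelli2//; apply: (len s) => // y ys.
  exact: le_trans (sX _ ys) (YF _ (sh _ ys)).
have pick (s t : R) (G : R -> \bar R) :
    (forall x, s <= x <= s + h / 2 -> `|x - t| <= h) ->
    (exists2 x, s <= x <= s + h / 2 & (G x < (h * T / 2)%:E)%E) \/
    (forall x, s <= x <= s + h / 2 -> ((h * T / 2)%:E <= G x)%E).
  move=> _; have [|n] := pselect (exists2 x, s <= x <= s + h / 2 &
    (G x < (h * T / 2)%:E)%E); [by left|right => x xs].
  by rewrite leNgt; apply/negP => hx; apply: n; exists x.
have r1 (t x : R) : t + h / 2 <= x <= t + h / 2 + h / 2 -> `|x - t| <= h.
  by move=> ?; rewrite ler_norml; lra.
have r2 (t x : R) : t - h <= x <= t - h + h / 2 -> `|x - t| <= h.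
  by move=> ?; rewrite ler_norml; lra.
(* Right, left, top and bottom strips in turn; the second alternative closes the goal each time. *)
have [[b bx Xb]|/(viaX _ (r1 x0))//] := pick _ _ X (r1 x0).
have [[a ax Xa]|/(viaX _ (r2 x0))//] := pick _ _ X (r2 x0).
have [[d dy Yd]|/(viaY _ (r1 y0))//] := pick _ _ Y (r1 y0).
have [[c cy Yc]|/(viaY _ (r2 y0))//] := pick _ _ Y (r2 y0).
exfalso.
have h20 : 0 < h / 2 by rewrite divr_gt0.
have inx x : a <= x <= b -> `|x - x0| <= h.
  by move=> ?; rewrite ler_norml; lra.
have iny y : c <= y <= d -> `|y - y0| <= h.
  by move=> ?; rewrite ler_norml; lra.
have cc : c <= c <= d by lra.
have dd : c <= d <= d by lra.
have aa : a <= a <= b by lra.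
have bb : a <= b <= b by lra.
have gc (e : R) : 0 < e -> exists2 r : R, 0 < r & forall w,
    modulus (w - (x0 +i* y0)) < r -> modulus (g w - g (x0 +i* y0)) <= e.
  have [||m dm] := H x0 y0; rewrite ?subrr ?normr0 ?ltW//.
  exact: cdiff_continuous dm e.
have gd x y : a <= x <= b -> c <= y <= d -> x +i* y != x0 +i* y0 ->
    exists l, cdiff g (x +i* y) l.
  by move=> /inx ? /iny ? _; exact: H.
have PM : ((4 * (h / 2) * T)%:E <= (Y c + Y d) + (X a + X b))%E.
  have ea : a <= x0 - h / 2 by lra.
  have eb : x0 + h / 2 <= b by lra.
  have ec : c <= y0 - h / 2 by lra.
  have ed : y0 + h / 2 <= d by lra.
  apply: le_trans (pole_modulus h20 ea eb ec ed gc gd) _.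
  under eq_integral do rewrite EFinD.
  under [X in (_ + X)%E]eq_integral do rewrite EFinD.
  have mH y : `|y - y0| <= h ->
      measurable_fun (`[a, b]%classic : set R) (fun x : R => (modulus (g (x +i* y)))%:E).
    move=> yh; apply/measurable_EFinP; apply: cdiff_line_measurable => x /inx xh.
    exact: H.
  have mV x : `|x - x0| <= h ->
      measurable_fun (`[c, d]%classic : set R) (fun y : R => (modulus (g (x +i* y)))%:E).
    move=> xh; apply/measurable_EFinP; apply: cdiff_vline_measurable => y /iny yh.
    exact: H.
  have m0 z : (0 <= (modulus (g z))%:E)%E by rewrite lee_fin modulus_ge0.
  rewrite !ge0_integralD//; first last.
  - exact: mH (iny _ dd).
  - exact: mH (iny _ cc).
  - exact: mV (inx _ bb).
  - exact: mV (inx _ aa).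
  apply: leeD; apply: leeD; apply: ge0_le_integralW => // x /=;
    rewrite !in_itv /=; lra.
move: PM; apply/negP; rewrite -ltNge.
have -> : 4 * (h / 2) * T = h * T / 2 + h * T / 2 + (h * T / 2 + h * T / 2).
  by field.
by rewrite !EFinD; apply: lteD; apply: lteD.
Qed.

End mean_value.

Section holomorphic_derivative.
Context {R : realType}.
Local Notation leb := (@lebesgue_measure R).
Local Notation leb2 := (leb \x leb)%E.
Implicit Types (f df g : R[i] -> R[i]).

(** The derivative is a separate function so that the test functions may supply theirs by a formula;
    ['D_1 f] comes in through [analytic_holo]. *)
Definition holo f df := forall z, modulus z < 1 -> cdiff f z (df z).

Definition sq_in_disk (x0 y0 h : R) := forall x y, `|x - x0| <= h ->
  `|y - y0| <= h -> modulus (x +i* y) < 1.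

Lemma sq_in_diskS x0 y0 h x1 y1 k : `|x1 - x0| + k <= h -> `|y1 - y0| + k <= h ->
  sq_in_disk x0 y0 h -> sq_in_disk x1 y1 k.
Proof.
move=> hx hy H x y xk yk; apply: H.
  by rewrite -(subrK x1 x) -addrA (le_trans (ler_normD _ _))//; lra.
by rewrite -(subrK y1 y) -addrA (le_trans (ler_normD _ _))//; lra.
Qed.

Lemma bounded_on_sq f df (x0 y0 h : R) : 0 <= h -> holo f df ->
  sq_in_disk x0 y0 h -> exists M : R, forall x y, `|x - x0| <= h ->
  `|y - y0| <= h -> modulus (f (x +i* y)) <= M.
Proof.
move=> h0 hf H.
pose A : set (R * R) := `[x0 - h, x0 + h] `*` `[y0 - h, y0 + h].
have AP (x y : R) : A (x, y) <-> `|x - x0| <= h /\ `|y - y0| <= h.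
  by rewrite /A /= !in_itv /= !ler_distl.
have cA : compact A by apply: compact_setX; exact: segment_compact.
have A0 : A !=set0 by exists (x0, y0); apply/AP; rewrite !subrr normr0.
have cf : {within A, continuous (fun w : R * R => modulus (f (w.1 +i* w.2)))}.
  apply: continuous_in_subspaceT => -[x y]; rewrite inE => /AP[xh yh].
  apply/cvgrPdist_le => /= e e0.
  have [r r0 Hr] := cdiff_continuous (hf _ (H _ _ xh yh)) e0.
  have r2 : 0 < r / 2 by rewrite divr_gt0.
  exists (ball x (r / 2), ball y (r / 2)).
    by split => /=; exact: nbhsx_ballx.
  move=> [x' y'] [/= b1 b2]; rewrite distrC (le_trans (modulus_dist _ _))// Hr//.
  rewrite -[_ - _]/((x' - x) +i* (y' - y)).
  rewrite (le_lt_trans (modulus_le_ReIm _))//= (splitr r).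
  by move: b1 b2; rewrite /ball /= ![`|_ - x'|]distrC ![`|_ - y'|]distrC; exact: ltrD.
have [c _ cmax] := compact_EVT_max A0 cA cf.
exists (modulus (f (c.1 +i* c.2))) => x y xh yh.
by apply: (cmax (x, y)); rewrite inE; apply/AP.
Qed.

Lemma deriv_bounded f df (x0 y0 h k : R) : 0 <= h -> 0 < k -> holo f df ->
  sq_in_disk x0 y0 (h + k) -> exists2 L : R, 0 <= L & forall x y, `|x - x0| <= h ->
  `|y - y0| <= h -> modulus (df (x +i* y)) <= L.
Proof.
move=> h0 k0 hf H.
have hk : 0 <= h + k by rewrite addr_ge0// ltW.
have [M HM] := bounded_on_sq hk hf H.
have M0 : 0 <= M.
  have := HM x0 y0; rewrite !subrr normr0 => /(_ hk hk).
  by apply: le_trans; exact: modulus_ge0.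
exists (4 * M / k) => [|x y xh yh]; first by rewrite divr_ge0 ?mulr_ge0 ?(ltW k0).
apply: (@cauchy_estimate _ f x y k M) => // [x' y' xk yk|]; last first.
  by apply: hf; apply: H; lra.
have i1 : `|x' - x0| <= h + k.
  by rewrite -(subrK x x') -addrA (le_trans (ler_normD _ _))//; lra.
have i2 : `|y' - y0| <= h + k.
  by rewrite -(subrK y y') -addrA (le_trans (ler_normD _ _))//; lra.
by split; [exists (df (x' +i* y')); exact/hf/H|exact: HM].
Qed.

Lemma cdiff_shift f z t l : cdiff f (z + t) l -> cdiff (fun w => f (w + t)) z l.
Proof.
move=> H e e0; have [d d0 Hd] := H _ e0; exists d => // w wd.
have E : w + t - (z + t) = w - z by ring.
by have := Hd (w + t); rewrite E => /(_ wd).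
Qed.

Lemma sq_lipschitz f df x0 y0 (h L : R) : holo f df -> sq_in_disk x0 y0 h ->
  (forall x y, `|x - x0| <= h -> `|y - y0| <= h -> modulus (df (x +i* y)) <= L) ->
  forall z w, `|Re z - x0| <= h -> `|Im z - y0| <= h -> `|Re w - x0| <= h ->
   `|Im w - y0| <= h -> modulus (f w - f z) <= L * modulus (w - z).
Proof.
move=> hf H HL z w h1 h2 h3 h4.
apply: segment_lipschitz => t /andP[t0 t1].
have -> : z + t%:C * (w - z) =
    (Re z + t * (Re w - Re z)) +i* (Im z + t * (Im w - Im z)).
  by move: (z) (w) => [a b] [c d]; simpc; congr (_ +i* _); ring.
have conv (u v s : R) : `|u - s| <= h -> `|v - s| <= h ->
    `|u + t * (v - u) - s| <= h.
  have -> : u + t * (v - u) - s = (1 - t) * (u - s) + t * (v - s) by ring.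
  move=> us vs; rewrite (le_trans (ler_normD _ _))// !normrM.
  by rewrite (ger0_norm t0) ger0_norm ?subr_ge0//; nra.
exists (df ((Re z + t * (Re w - Re z)) +i* (Im z + t * (Im w - Im z)))).
  by apply: hf; apply: H; exact: conv.
by apply: HL; exact: conv.
Qed.

Lemma sq_in_disk_near (z : R[i]) : modulus z < 1 ->
  exists2 h, 0 < h & sq_in_disk (Re z) (Im z) h.
Proof.
move=> z1; exists ((1 - modulus z) / 4) => [|x y hx hy].
  by rewrite divr_gt0// subr_gt0.
rewrite -(subrK z (x +i* y)) (le_lt_trans (modulusD _ _))//.
have : modulus ((x +i* y) - z) <= `|x - Re z| + `|y - Im z|.
  by rewrite (le_trans (modulus_le_ReIm _))//; case: (z).
lra.
Qed.

(* Cauchy's estimate is applied to [f (. + t) - f], which is O(t). *)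
Lemma deriv_continuous f df z : holo f df -> modulus z < 1 ->
  forall e : R, 0 < e -> exists2 r : R, 0 < r & forall w,
    modulus (w - z) < r -> modulus (df w - df z) <= e.
Proof.
move=> hf z1 e e0.
have [h h0 Hh] := sq_in_disk_near z1.
pose k := h / 4; have k0 : 0 < k by rewrite divr_gt0.
have hk : h = 4 * k by rewrite /k; field.
have H3 : sq_in_disk (Re z) (Im z) (3 * k + k).
  by have -> : 3 * k + k = h by rewrite hk; ring.
have H2 : sq_in_disk (Re z) (Im z) (3 * k).
  by apply: sq_in_diskS Hh; rewrite subrr normr0 hk; lra.
have k3 : 0 <= 3 * k by rewrite mulr_ge0// (ltW k0).
have [L L0 HL] := deriv_bounded k3 k0 hf H3.
have lip := sq_lipschitz hf H2 HL.
have Lk : 0 <= 4 * L / k by rewrite divr_ge0 ?mulr_ge0// ltW.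
have L1 : 0 < 4 * L / k + 1 by rewrite ltr_wpDl.
exists (Num.min k (e / (4 * L / k + 1))) => [|w].
  by rewrite lt_min k0 divr_gt0.
rewrite lt_min => /andP[wk]; rewrite ltr_pdivlMr// => we.
set t := w - z in wk we *.
have wE : w = z + t by rewrite /t; ring.
have tk : `|Re t| < k /\ `|Im t| < k.
  by split; [exact: le_lt_trans (Re_le_modulus t) wk|
             exact: le_lt_trans (Im_le_modulus t) wk].
apply: le_trans (_ : 4 * (L * modulus t) / k <= _); last first.
  apply: le_trans (ltW we).
  have -> : 4 * (L * modulus t) / k = modulus t * (4 * L / k) by ring.
  by rewrite ler_wpM2l ?modulus_ge0// lerDl.
pose g (w : R[i]) : R[i] := f (w + t) + - f w.
have dg v : modulus v < 1 -> modulus (v + t) < 1 ->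
    cdiff g v (df (v + t) + - df v).
  move=> v1 vt1; apply: cdiffD; first by apply: cdiff_shift; exact: hf.
  have -> : (fun w => - f w) = (fun w => (- 1) * f w).
    by apply/funext => ?; rewrite mulN1r.
  have -> : - df v = (-1) * df v + 0 * f v by ring.
  by apply: cdiffM; [exact: cdiff_cst|exact: hf].
have shiftE x y : (x +i* y) + t = (x + Re t) +i* (y + Im t) by case: (t).
have near_t x y : `|x - Re z| <= k -> `|y - Im z| <= k ->
    `|x + Re t - Re z| <= 3 * k /\ `|y + Im t - Im z| <= 3 * k.
  move: tk; rewrite !ltr_norml !ler_norml; lra.
have zE : z = Re z +i* Im z by case: (z).
have wt1 : modulus (z + t) < 1.
  have zz (u : R) : `|u - u| <= k by rewrite subrr normr0 ltW.
  have [h1 h2] := near_t _ _ (zz (Re z)) (zz (Im z)).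
  by rewrite [z in z + t]zE shiftE; exact: H2.
apply: (@cauchy_estimate _ g (Re z) (Im z) k) => //; last first.
  by rewrite -zE wE; exact: dg.
move=> x y hx hy; have [h1 h2] := near_t _ _ hx hy.
have hx' : `|x - Re z| <= 3 * k by lra.
have hy' : `|y - Im z| <= 3 * k by lra.
split.
  exists (df (x +i* y + t) + - df (x +i* y)); apply: dg; first exact: H2.
  by rewrite shiftE; exact: H2.
have := lip (x +i* y) ((x + Re t) +i* (y + Im t)) hx' hy' h1 h2.
have E : x +i* y + t - (x +i* y) = t by rewrite addrAC subrr add0r.
by rewrite -shiftE E.
Qed.

Lemma deriv_measurable f df : holo f df ->
  measurable_fun (@disk R) (fun w => modulus (df (cplx w))).
Proof.
move=> hf; have [] // := @modulus_continuous_measurable _ (@disk R) df.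
  exact: measurable_disk.
by move=> w w1; exact: deriv_continuous hf w1.
Qed.

Lemma sq_disk x0 y0 h : sq_in_disk x0 y0 h -> sq x0 y0 h `<=` @disk R.
Proof. by move=> H [x y] /sqP[/= hx hy]; exact: H. Qed.

(** [submean1] asks for a differentiable function, which [df] is not known to be. It is applied to
    the difference quotients [g n], which converge to [df] pointwise and are dominated by a
    Lipschitz constant of [f]. *)
Lemma deriv_submean1 f df (x0 y0 h : R) : 0 < h -> holo f df ->
  sq_in_disk x0 y0 (2 * h) ->
  ((h ^+ 2 / 4 * modulus (df (x0 +i* y0)))%:E <=
   \int[leb2]_(w in sq x0 y0 h) (modulus (df (cplx w)))%:E)%E.
Proof.
move=> h0 hf H2.
(* A shift by at most [k] leads from the square of half-side 3k into that of half-side 4k, where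
   [df] is bounded; Cauchy's estimate there reaches out to 5k, within 2h = 6k. *)
pose k := h / 3; have k0 : 0 < k by rewrite divr_gt0.
have hk : h = 3 * k by rewrite /k; field.
have HL0 : sq_in_disk x0 y0 (4 * k + k).
  by apply: sq_in_diskS H2; rewrite subrr normr0 hk; lra.
have H4 : sq_in_disk x0 y0 (4 * k).
  by apply: sq_in_diskS H2; rewrite subrr normr0 hk; lra.
have H1 : sq_in_disk x0 y0 h.
  by apply: sq_in_diskS H2; rewrite subrr normr0; lra.
have k4 : 0 <= 4 * k by rewrite mulr_ge0// (ltW k0).
have [L L0 HL] := deriv_bounded k4 k0 hf HL0.
have lip := sq_lipschitz hf H4 HL.
pose t n : R := k / n.+1%:R.
have t0 n : 0 < t n by rewrite divr_gt0// ltr0n.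
have tk n : t n <= k by rewrite ler_pdivrMr ?ltr0n// ler_peMr ?ler1n// ltW.
have tC n : (t n)%:C != 0 by rewrite eq_complex /= gt_eqF.
pose g n (w : R[i]) : R[i] := (f (w + (t n)%:C) + - f w) * ((t n)%:C)^-1.
have shiftE n x y : (x +i* y) + (t n)%:C = (x + t n) +i* y by simpc.
have in4 n (x : R) : `|x - x0| <= h -> `|x + t n - x0| <= 4 * k.
  by have := t0 n; have := tk n; rewrite !ler_norml hk; lra.
have in4' (x y : R) : `|x - y| <= h -> `|x - y| <= 4 * k by rewrite hk; lra.
have dg n x y : `|x - x0| <= h -> `|y - y0| <= h ->
    exists m, cdiff (g n) (x +i* y) m.
  move=> hx hy.
  eexists; apply: cdiffM; last exact: cdiff_cst.
  apply: cdiffD; first by apply: cdiff_shift; apply: hf; rewrite shiftE;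
    apply: H4; [exact: in4|exact: in4'].
  have -> : (fun w => - f w) = (fun w => (- 1) * f w).
    by apply/funext => ?; rewrite mulN1r.
  by apply: cdiffM; [exact: cdiff_cst|apply: hf; exact: H1].
have gL n x y : `|x - x0| <= h -> `|y - y0| <= h ->
    modulus (g n (x +i* y)) <= L.
  move=> hx hy; rewrite /g modulusM modulusV modulusC gtr0_norm//.
  rewrite ler_pdivrMr//.
  have := lip (x +i* y) ((x + t n) +i* y)
    (in4' _ _ hx) (in4' _ _ hy) (in4 n _ hx) (in4' _ _ hy).
  have E : x +i* y + (t n)%:C - (x +i* y) = (t n)%:C.
    by rewrite addrAC subrr add0r.
  by rewrite -shiftE E modulusC gtr0_norm.
have gcvg z : modulus z < 1 -> (modulus (g n z))%:E @[n --> \oo] --> (modulus (df z))%:E.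
  move=> z1; apply: cvg_EFin; first exact: nearW.
  apply/cvgrPdist_le => e e0.
  have [d d0 Hd] := hf _ z1 _ e0.
  have [N HN] : exists N : nat, k / N.+1%:R < d.
    exists (Num.truncn (k / d)); rewrite ltr_pdivrMr ?ltr0n// mulrC -ltr_pdivrMr//.
    exact: Num.Theory.truncnS_gt.
  exists N => // n /= Nn.
  have tnd : t n < d.
    apply: le_lt_trans HN; rewrite ler_wpM2l ?(ltW k0)// lef_pV2 ?posrE ?ltr0n//.
    by rewrite ler_nat.
  rewrite distrC (le_trans (modulus_dist _ _))//.
  have E : z + (t n)%:C - z = (t n)%:C by rewrite addrAC subrr add0r.
  have := Hd (z + (t n)%:C); rewrite E modulusC gtr0_norm// => /(_ tnd) h1.
  rewrite -[X in _ - X](mulfK (tC n)) /g -mulrBl modulusM modulusV modulusC.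
  by rewrite gtr0_norm// ler_pdivrMr.
have msq : measurable (sq x0 y0 h) by exact: measurable_sq.
have mdf : measurable_fun (sq x0 y0 h) (fun w => (modulus (df (cplx w)))%:E).
  apply/measurable_EFinP; apply: measurable_funS (deriv_measurable hf).
    exact: measurable_disk.
  exact: sq_disk.
have mg n : measurable_fun (sq x0 y0 h) (fun w => (modulus (g n (cplx w)))%:E).
  apply/measurable_EFinP.
  have [] // := @modulus_continuous_measurable _ (sq x0 y0 h) (g n) msq.
  move=> w /sqP[wx wy] e e0; have [m dm] := dg n _ _ wx wy.
  exact: cdiff_continuous dm e e0.
have iL : leb2.-integrable (sq x0 y0 h) (fun=> L%:E).
  apply/integrableP; split; first exact: measurable_cst.
  by rewrite integral_cst//= measure_sq ?(ltW h0)// -EFinM ltry.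
have gc w : sq x0 y0 h w ->
    (fun n => (modulus (g n (cplx w)))%:E) @ \oo --> (modulus (df (cplx w)))%:E.
  by move=> hw; apply: gcvg; exact: sq_disk H1 _ hw.
have gd w n : sq x0 y0 h w -> (`|(modulus (g n (cplx w)))%:E| <= L%:E)%E.
  by move=> /sqP[wx wy]; rewrite /= ger0_norm ?modulus_ge0// lee_fin; exact: gL.
have [_ _ dc] := @dominated_convergence _ _ _ leb2 _ msq
   (fun n w => (modulus (g n (cplx w)))%:E) (fun w => (modulus (df (cplx w)))%:E)
   (fun=> L%:E) mg mdf (aeW _ gc) iL (aeW _ gd).
have z01 : modulus (x0 +i* y0) < 1 by apply: H1; rewrite subrr normr0 ltW.
have lhs : (fun n => (h ^+ 2 / 4)%:E * (modulus (g n (x0 +i* y0)))%:E)%E @ \oo -->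
    ((h ^+ 2 / 4)%:E * (modulus (df (x0 +i* y0)))%:E)%E.
  by apply: cvgeZl => //; exact: gcvg.
rewrite EFinM; apply: lee_cvg_to lhs dc _; apply: nearW => n.
by rewrite -EFinM; apply: submean1 => // x y; exact: dg.
Qed.

End holomorphic_derivative.

Section submean_power.
Context {R : realType}.
Local Notation leb := (@lebesgue_measure R).
Local Notation leb2 := (leb \x leb)%E.
Implicit Types (f df g : R[i] -> R[i]).

Lemma ler_powR_inv (p x y : R) : 0 < p -> 0 <= x -> 0 <= y ->
  x `^ p <= y `^ p -> x <= y.
Proof.
move=> p0 x0 y0 xy; rewrite leNgt; apply/negP => yx.
by move: xy; rewrite leNgt gt0_ltr_powR.
Qed.

(** For t > G/32 one writes t = t^(1-p) t^p and bounds t^(1-p) by its value at the upper end [k * G]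
    if p <= 1, at the lower end [G / 32] if p > 1. The number 32 is such that integrating G/32 over
    a square of area 4 r^2 costs half of the r^2 G / 4 of [deriv_submean1]. *)
Lemma power_split (p k t G : R) : 0 < p -> 0 < G -> 0 <= t -> t <= k * G ->
  t <= G / 32 + (k `^ (1 - p) + 32 `^ (p - 1)) * G `^ (1 - p) * t `^ p.
Proof.
move=> p0 G0 t0 tk; set K := k `^ _ + _.
have K0 : 0 <= K by rewrite addr_ge0 ?powR_ge0.
have [tG|tG] := leP t (G / 32).
  by rewrite (le_trans tG)// lerDl !mulr_ge0 ?powR_ge0.
have {t0}t0 : 0 < t by apply: lt_trans tG; rewrite divr_gt0.
have tE : t = t `^ (1 - p) * t `^ p.
  by rewrite -powRD ?subrK ?powRr1 ?(ltW t0)// gt_eqF ?implybT.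
rewrite {1}tE (@le_trans _ _ (K * G `^ (1 - p) * t `^ p))//; last first.
  by rewrite lerDr divr_ge0 ?(ltW G0).
rewrite ler_wpM2r ?powR_ge0//.
have [p1|p1] := leP p 1.
  apply: le_trans (_ : (k * G) `^ (1 - p) <= _).
    by rewrite ge0_ler_powR ?nnegrE ?subr_ge0 ?(ltW t0)// (le_trans (ltW t0)).
  have k0 : 0 <= k by rewrite -(pmulr_lge0 _ G0) (le_trans (ltW t0)).
  by rewrite powRM ?(ltW G0)// ler_wpM2r ?powR_ge0// lerDl powR_ge0.
have E (u : R) : u `^ (1 - p) = (u `^ (p - 1))^-1 by rewrite -powRN opprB.
rewrite !E; set K' := K.
have Gp : 0 < G `^ (p - 1) by rewrite powR_gt0.
have tp : 0 < t `^ (p - 1) by rewrite powR_gt0.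
rewrite -ler_pdivrMr ?invr_gt0// invrK mulrC.
apply: le_trans (_ : 32 `^ (p - 1) <= _); last by rewrite lerDr powR_ge0.
rewrite ler_pdivrMr// -powRM ?(ltW t0)//.
rewrite ge0_ler_powR ?nnegrE ?subr_ge0 ?mulr_ge0 ?(ltW t0) ?(ltW G0) ?(ltW p1)//.
by rewrite mulrC -ler_pdivrMr// ltW.
Qed.

(** Jensen's inequality cannot carry exponent 1 down to p < 1, and subharmonicity of |df|^p would
    need the zeros of [df]. A maximum principle for |df|^p weighted by the squared distance to the
    boundary treats all exponents alike. *)
Lemma deriv_submean_power (p : R) : 0 < p -> exists2 c : R, 0 < c &
  forall f df x0 y0 h, 0 < h -> holo f df -> sq_in_disk x0 y0 (2 * h) ->
  ((h ^+ 2 * modulus (df (x0 +i* y0)) `^ p)%:E <=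
   c%:E * \int[leb2]_(w in sq x0 y0 h) (modulus (df (cplx w)) `^ p)%:E)%E.
Proof.
(* k^p = 8: a factor 2 since the maximum is attained only up to 1/2, and a factor 4 since the
   distance to the boundary is at worst halved, and squared. *)
move=> p0; pose k : R := 8 `^ p^-1; pose K := k `^ (1 - p) + 32 `^ (p - 1).
have K0 : 0 < K by rewrite ltr_wpDl ?powR_ge0// powR_gt0.
have kp : k `^ p = 8 by rewrite /k -powRrM mulVf ?gt_eqF// powRr1.
(* The inequality r^2 G^p / 8 <= K J1 is multiplied by 64, as the near-maximum gives S0 <= 2 (2r)^2
   G^p = 8 r^2 G^p. *)
exists (64 * K) => [|f df x0 y0 h h0 hf H2]; first by rewrite mulr_gt0.
set J := (\int[leb2]_(w in _) _)%E.
have J0 : (0 <= J)%E by apply: integral_ge0 => w _; rewrite lee_fin powR_ge0.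
set G0 := modulus (df (x0 +i* y0)).
have [G00|G0n] := eqVneq G0 0.
  by rewrite G00 powR0 ?gt_eqF// mulr0 mule_ge0// lee_fin mulr_ge0 ?(ltW K0).
have {G0n}G00 : 0 < G0 by rewrite lt_def G0n modulus_ge0.
pose dd (x y : R) : R := h - Num.max `|x - x0| `|y - y0|.
(* A near-maximizer [w] of [V] satisfies [|df| <= k |df w|] on the square of half
   the distance from [w] to the boundary, which turns the inequality for the
   exponent 1 into the one for [p]. *)
pose V (w : R * R) := dd w.1 w.2 ^+ 2 * modulus (df (w.1 +i* w.2)) `^ p.
have ddP x y : `|x - x0| <= h -> `|y - y0| <= h -> 0 <= dd x y <= h.
  move=> hx hy; rewrite subr_ge0 ge_max hx hy /= lerBlDr lerDl.
  by rewrite le_max normr_ge0.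
have [L L0 HL] : exists2 L : R, 0 <= L & forall x y, `|x - x0| <= h ->
    `|y - y0| <= h -> modulus (df (x +i* y)) <= L.
  apply: (deriv_bounded (ltW h0) h0 hf).
  by have -> : h + h = 2 * h by ring.
pose E : set R := [set V w | w in [set w : R * R | `|w.1 - x0| <= h /\ `|w.2 - y0| <= h]].
have E0 : E (h ^+ 2 * G0 `^ p).
  exists (x0, y0) => /=; first by rewrite !subrr normr0 ltW.
  by rewrite /V /dd /= !subrr normr0 maxxx subr0.
have hE : has_sup E.
  split; first by eexists; exact: E0.
  exists (h ^+ 2 * L `^ p) => _ [[x y] /= [hx hy] <-].
  have /andP[d1 d2] := ddP _ _ hx hy.
  rewrite /V /= ler_pM ?powR_ge0 ?exprn_ge0//.
    by rewrite lerXn2r ?nnegrE// ltW.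
  by rewrite ge0_ler_powR ?nnegrE ?modulus_ge0 ?(ltW p0)//; exact: HL.
set S0 := sup E.
have S0h : h ^+ 2 * G0 `^ p <= S0 by apply: ub_le_sup => //; exact: hE.2.
have S00 : 0 < S0 by apply: lt_le_trans S0h; rewrite mulr_gt0 ?powR_gt0 ?exprn_gt0.
have [_ [[x1 y1] /= [hx1 hy1] <-] V1] : exists2 e, E e & S0 - S0 / 2 < e.
  by apply: sup_adherent => //; rewrite divr_gt0.
have {}V1 : S0 < 2 * V (x1, y1) by lra.
set G := modulus (df (x1 +i* y1)) in V1 *.
set d := dd x1 y1.
have VE : V (x1, y1) = d ^+ 2 * G `^ p by [].
have V0 : 0 < V (x1, y1) by lra.
have d0 : 0 < d.
  have /andP[] := ddP _ _ hx1 hy1; rewrite -/d le_eqVlt => /orP[/eqP dz|//] _.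
  by move: V0; rewrite VE -dz expr0n mul0r ltxx.
have Gp0 : 0 < G.
  rewrite lt_def modulus_ge0 andbT; apply/eqP => Gz.
  by move: V0; rewrite VE Gz powR0 ?gt_eqF// mulr0 ltxx.
have dx1 : d <= h - `|x1 - x0| by rewrite /d /dd lerB// le_max lexx.
have dy1 : d <= h - `|y1 - y0| by rewrite /d /dd lerB// le_max lexx orbT.
pose r := d / 2; have r0 : 0 < r by rewrite divr_gt0.
have dr : d = 2 * r by rewrite /r; field.
have H1 : sq_in_disk x1 y1 (2 * r) by apply: sq_in_diskS H2; lra.
have sub x y : `|x - x1| <= r -> `|y - y1| <= r ->
    [/\ `|x - x0| <= h, `|y - y0| <= h & r <= dd x y].
  move=> hx hy.
  have i1 : `|x - x0| <= r + `|x1 - x0|.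
    by rewrite -(subrK x1 x) -addrA (le_trans (ler_normD _ _))// lerD2r.
  have i2 : `|y - y0| <= r + `|y1 - y0|.
    by rewrite -(subrK y1 y) -addrA (le_trans (ler_normD _ _))// lerD2r.
  split; [lra|lra|]; rewrite /dd lerBrDr -lerBrDl ge_max; lra.
have small x y : `|x - x1| <= r -> `|y - y1| <= r ->
    modulus (df (x +i* y)) <= k * G.
  move=> hx hy; have [i1 i2 i3] := sub _ _ hx hy.
  have k0 : 0 <= k by exact: powR_ge0.
  apply: (ler_powR_inv p0); rewrite ?modulus_ge0 ?mulr_ge0 ?(ltW Gp0)//.
  rewrite powRM ?(ltW Gp0)// kp.
  have VS : V (x, y) <= S0 by apply: ub_le_sup; [exact: hE.2|exists (x, y)].
  have : r ^+ 2 * modulus (df (x +i* y)) `^ p <= r ^+ 2 * (8 * G `^ p).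
    apply: le_trans (_ : V (x, y) <= _).
      by rewrite /V /= ler_wpM2r ?powR_ge0// lerXn2r ?nnegrE ?(ltW r0)//
        (le_trans (ltW r0)).
    apply: le_trans VS _; move: V1; rewrite VE dr; set q := G `^ p.
    by rewrite exprMn; lra.
  by rewrite ler_pM2l// exprn_gt0.
have sm := deriv_submean1 r0 hf H1.
set J1 := (\int[leb2]_(w in sq x1 y1 r) (modulus (df (cplx w)) `^ p)%:E)%E.
have J1J : (J1 <= J)%E.
  apply: ge0_le_integralW => // [w /sqP[/sub i1 /i1[i2 i3 _]]|w _|w _];
    rewrite ?lee_fin ?powR_ge0//.
  exact/sqP.
have m1 : measurable_fun (sq x1 y1 r) (fun w => modulus (df (cplx w))).
  apply: measurable_funS (deriv_measurable hf); first exact: measurable_disk.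
  by apply: sq_disk; apply: sq_in_diskS H1; rewrite subrr normr0; lra.
have C0 : 0 <= K * G `^ (1 - p) by rewrite mulr_ge0 ?powR_ge0 ?(ltW K0).
have mp : measurable_fun (sq x1 y1 r) (fun w => (modulus (df (cplx w)) `^ p)%:E).
  by apply/measurable_EFinP; apply: (measurableT_comp (measurable_powR p)).
have up : (\int[leb2]_(w in sq x1 y1 r) (modulus (df (cplx w)))%:E <=
    (G / 32 * (4 * r ^+ 2))%:E + (K * G `^ (1 - p))%:E * J1)%E.
  have msq : measurable (sq x1 y1 r) by exact: measurable_sq.
  have eZ : ((K * G `^ (1 - p))%:E * J1)%E = (\int[leb2]_(w in sq x1 y1 r)
      ((K * G `^ (1 - p))%:E * (modulus (df (cplx w)) `^ p)%:E))%E.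
    by rewrite ge0_integralZl// => w _; rewrite lee_fin powR_ge0.
  rewrite eZ EFinM -(measure_sq x1 y1 (ltW r0)) -integral_cst//=.
  rewrite -ge0_integralD//; first last.
  - exact: measurable_funeM.
  - by move=> w _; rewrite -EFinM lee_fin mulr_ge0 ?powR_ge0.
  - by move=> w _; rewrite lee_fin divr_ge0 ?(ltW Gp0).
  apply: ge0_le_integralW => // [w _|w _|w /sqP[i1 i2]].
  - by rewrite lee_fin modulus_ge0.
  - by rewrite -EFinM -EFinD lee_fin addr_ge0 ?mulr_ge0 ?powR_ge0 ?divr_ge0 ?(ltW Gp0) ?(ltW K0).
  - by rewrite -EFinM -EFinD lee_fin; apply: power_split => //; [exact: modulus_ge0|exact: small].
have J10 : (0 <= J1)%E by apply: integral_ge0 => w _; rewrite lee_fin powR_ge0.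
move: J1J J10 (le_trans sm up); rewrite -/G => {up}.
move: (J1) => [j||] //; last first.
  rewrite leye_eq => /eqP -> _ _.
  by rewrite gt0_muley ?leey// lte_fin mulr_gt0.
move=> jJ; rewrite lee_fin => j0; rewrite -EFinM -EFinD lee_fin => hj.
apply: le_trans (lee_wpmul2l _ jJ); last by rewrite lee_fin mulr_ge0 ?(ltW K0).
rewrite -EFinM lee_fin (le_trans S0h)// (le_trans (ltW V1))// VE dr.
have GG : G = G `^ (1 - p) * G `^ p.
  by rewrite -powRD ?subrK ?powRr1 ?(ltW Gp0)// gt_eqF ?implybT.
have Gq0 : 0 < G `^ (1 - p) by rewrite powR_gt0.
have : r ^+ 2 * G / 8 <= K * G `^ (1 - p) * j by lra.
rewrite {1}GG; move: Gq0; set A := G `^ (1 - p); set B := G `^ p => A0.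
have -> : r ^+ 2 * (A * B) / 8 = A * (r ^+ 2 * B / 8) by ring.
have -> : K * A * j = A * (K * j) by ring.
rewrite ler_pM2l// => hK.
have -> : 2 * ((2 * r) ^+ 2 * B) = 64 * (r ^+ 2 * B / 8) by field.
by rewrite -[leRHS]mulrA ler_pM2l.
Qed.

End submean_power.

(** * Chaining along radii *)

Section numeric.
Context {R : realType}.

(** The terms decay geometrically on both sides of the index at which q^i y crosses 1, so the bound
    depends neither on y nor on n. This is how a sum over scales stays uniform in the scale where it
    is concentrated. *)
Lemma min_geometric (q : R) : 1 < q -> exists2 c : R, 0 < c &
  forall (y : R) n, 0 < y ->
  \sum_(i < n) Num.min (q ^+ i * y) (q ^+ i * y)^-1 <= c.
Proof.
move=> q1; have q0 : 0 < q by lra.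
have q10 : 0 < q - 1 by lra.
pose D := 1 + (1 + q) / (q - 1).
(* A potential: [min y y^-1 + Psi (q * y) <= Psi y]. *)
pose Psi (y : R) := if 1 <= y then q / ((q - 1) * y) else D - y / (q - 1).
have Dge : q / (q - 1) <= D.
  have -> : D = q / (q - 1) + (1 + 1 / (q - 1)) by rewrite /D; ring.
  by rewrite lerDl addr_ge0// divr_ge0// ltW.
suff main n : forall y : R, 0 < y ->
    \sum_(i < n) Num.min (q ^+ i * y) (q ^+ i * y)^-1 <= Psi y.
  exists D => [|y n y0].
    by rewrite (lt_le_trans _ Dge)// divr_gt0.
  apply: le_trans (main n y y0) _; rewrite /Psi; case: ifPn => y1.
    rewrite (le_trans _ Dge)// ler_pM2l// lef_pV2 ?posrE ?mulr_gt0//.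
    by rewrite ler_peMr// ltW.
  by rewrite gerBl divr_ge0// ltW.
have Psi0 (y : R) : 0 < y -> 0 <= Psi y.
  move=> y0; rewrite /Psi; case: ifPn => y1.
    by rewrite divr_ge0 ?mulr_ge0 ?ltW.
  rewrite subr_ge0 (le_trans _ Dge)// ler_wpM2r ?invr_ge0 ?(ltW q10)//.
  by rewrite -ltNge in y1; lra.
elim: n => [|n IH] y y0; first by rewrite big_ord0 Psi0.
rewrite big_ord_recl expr0 mul1r.
have -> : \sum_(i < n) Num.min (q ^+ lift ord0 i * y) (q ^+ lift ord0 i * y)^-1 =
    \sum_(i < n) Num.min (q ^+ i * (q * y)) (q ^+ i * (q * y))^-1.
  by apply: eq_bigr => i _; rewrite /= /bump /= add1n exprSr mulrA.
have qy : 0 < q * y by rewrite mulr_gt0.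
apply: le_trans (lerD (lexx _) (IH _ qy)) _.
rewrite /Psi; have [y1|y1] := leP 1 y.
  rewrite ifT; last by nra.
  have h : Num.min y y^-1 <= y^-1 by rewrite ge_min lexx orbT.
  rewrite (le_trans (lerD h (lexx _)))//.
  rewrite le_eqVlt; apply/orP; left; apply/eqP.
  by field; rewrite !gt_eqF.
have h : Num.min y y^-1 <= y by rewrite ge_min lexx.
rewrite (le_trans (lerD h (lexx _)))//.
case: ifPn => qy1; last first.
  rewrite le_eqVlt; apply/orP; left; apply/eqP.
  by field; rewrite gt_eqF.
have -> : q / ((q - 1) * (q * y)) = (q * y)^-1 * (q / (q - 1)).
  by field; rewrite !gt_eqF.
have i1 : (q * y)^-1 <= 1 by rewrite invf_le1.
have i2 : (q * y)^-1 * (q / (q - 1)) <= q / (q - 1).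
  by rewrite ler_piMl// divr_ge0 ?(ltW q0) ?(ltW q10).
rewrite (le_trans (lerD (lexx _) i2))//.
have i3 : y / (q - 1) <= 1 / (q - 1).
  by rewrite ler_wpM2r ?invr_ge0 ?(ltW q10)// ltW.
have -> : D = 1 + q / (q - 1) + 1 / (q - 1) by rewrite /D; ring.
lra.
Qed.

Lemma powRD_le (a b p : R) : 0 <= a -> 0 <= b -> 0 < p -> p <= 1 ->
  (a + b) `^ p <= a `^ p + b `^ p.
Proof.
move=> a0 b0 p0 p1.
have [->|an] := eqVneq a 0; first by rewrite add0r powR0 ?add0r// gt_eqF.
have [->|bn] := eqVneq b 0; first by rewrite addr0 powR0 ?addr0// gt_eqF.
have ap : 0 < a by rewrite lt_def an.
have bp : 0 < b by rewrite lt_def bn.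
have ab : 0 < a + b by rewrite addr_gt0.
have H (x : R) : 0 < x -> x <= a + b -> x / (a + b) * (a + b) `^ p <= x `^ p.
  move=> x0 xab.
  have -> : x `^ p = (x / (a + b)) `^ p * (a + b) `^ p.
    by rewrite -powRM ?divfK ?gt_eqF ?divr_ge0 ?ltW.
  rewrite ler_wpM2r ?powR_ge0// ger1_powR//.
  by rewrite divr_gt0//= ler_pdivrMr// mul1r.
have -> : (a + b) `^ p = a / (a + b) * (a + b) `^ p + b / (a + b) * (a + b) `^ p.
  by rewrite -!mulrDl divff ?mul1r// gt_eqF.
by apply: lerD; apply: H => //; rewrite ?lerDl ?lerDr.
Qed.

(** Comparison with a telescoping sum: each term is below a difference of values of x^(1-q)/(q-1),
    by ln ((j+1)/j) >= 1/(j+1) and exp x >= 1 + x. *)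
Lemma riemann_sum_bounded (q : R) : 1 < q -> forall n,
  \sum_(i < n) (i.+1%:R : R) `^ (- q) <= 1 + (q - 1)^-1.
Proof.
move=> q1 n; have q10 : 0 < q - 1 by lra.
have step (j : nat) : (0 < j)%N -> (j.+1%:R : R) `^ (- q) <=
    (q - 1)^-1 * (j%:R `^ (1 - q) - j.+1%:R `^ (1 - q)).
  move=> j0; have jp : 0 < j%:R :> R by rewrite ltr0n.
  have jp1 : 0 < j.+1%:R :> R by rewrite ltr0n.
  rewrite mulrC ler_pdivlMr//.
  have E : j%:R `^ (1 - q) = (j.+1%:R / j%:R) `^ (q - 1) * j.+1%:R `^ (1 - q) :> R.
    have h : (j.+1%:R / j%:R : R) `^ (1 - q) * j%:R `^ (1 - q) = j.+1%:R `^ (1 - q).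
      by rewrite -powRM ?divfK ?gt_eqF ?divr_ge0 ?ltW.
    rewrite -h -[q - 1]opprB powRN mulKf//; apply: lt0r_neq0.
    by rewrite powR_gt0 // divr_gt0.
  have E2 : (j.+1%:R : R) `^ (- q) = j.+1%:R^-1 * j.+1%:R `^ (1 - q).
    rewrite -[X in X * _]powR_inv1 ?ltW// -powRD; last by rewrite (gt_eqF jp1) implybT.
    by congr (_ `^ _); ring.
  rewrite E E2; set A := j.+1%:R `^ (1 - q); set B := _ `^ (q - 1).
  have -> : j.+1%:R^-1 * A * (q - 1) = (q - 1) / j.+1%:R * A by ring.
  have -> : B * A - A = (B - 1) * A by ring.
  rewrite ler_wpM2r ?powR_ge0//.
  have r0 : 0 < j.+1%:R / j%:R :> R by rewrite divr_gt0.
  have lnge : j.+1%:R^-1 <= ln (j.+1%:R / j%:R : R).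
    have := @le_ln1Dx R (- j.+1%:R^-1).
    rewrite ltrN2 invf_lt1// ltr1n ltnS j0 => /(_ isT).
    have -> : 1 - j.+1%:R^-1 = (j.+1%:R / j%:R : R)^-1.
      by rewrite invf_div -natr1; field; rewrite natr1 gt_eqF.
    by rewrite lnV ?posrE// lerN2.
  rewrite /B /powR (gt_eqF r0); apply: le_trans (lerB (expR_ge1Dx _) (lexx 1)).
  by rewrite addrAC subrr add0r ler_wpM2l// ltW.
case: n => [|n]; first by rewrite big_ord0 addr_ge0 ?invr_ge0 ?(ltW q10).
suff : \sum_(i < n.+1) (i.+1%:R : R) `^ (- q) <=
    1 + (q - 1)^-1 * (1 - n.+1%:R `^ (1 - q)).
  have i0 : 0 <= (q - 1)^-1 by rewrite invr_ge0 ltW.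
  move=> h; apply: (le_trans h); rewrite lerD2l ler_piMr//.
elim: n => [|n IH].
  by rewrite big_ord1 !powR1 subrr mulr0 addr0.
rewrite big_ord_recr /=; apply: le_trans (lerD IH (step n.+1 isT)) _.
by rewrite le_eqVlt; apply/orP; left; apply/eqP; ring.
Qed.

(** For p <= 1 this is subadditivity of the power. For p > 1 it is Hoelder's inequality between
    (i+1) b_i and 1/(i+1), whose q-th powers are summable for the conjugate q > 1. The loss (i+1)^p
    is what the logarithm later pays for. *)
Lemma sum_powR_le (p : R) : 0 < p -> exists2 c : R, 0 < c &
  forall (b : nat -> R) n, (forall i, 0 <= b i) ->
  (\sum_(i < n) b i) `^ p <= c * \sum_(i < n) i.+1%:R `^ p * b i `^ p.
Proof.
move=> p0; have [p1|p1] := leP p 1.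
  exists 1 => // b n b0; rewrite mul1r.
  elim: n => [|n IH]; first by rewrite !big_ord0 powR0 ?gt_eqF.
  rewrite !big_ord_recr /= (le_trans (powRD_le _ _ _ _))// ?sumr_ge0//.
  rewrite lerD// ler_peMl ?powR_ge0//.
  by rewrite -[leLHS](powRr0 n.+1%:R) ler_powR ?ler1n// ltW.
pose q := p / (p - 1); have p10 : 0 < p - 1 by lra.
have q1 : 1 < q by rewrite ltr_pdivlMr//; lra.
have q0 : 0 < q by lra.
have pq : p^-1 + q^-1 = 1 by rewrite /q invf_div; field; rewrite gt_eqF.
pose Z := 1 + (q - 1)^-1.
have Z0 : 0 < Z by rewrite ltr_wpDr// invr_ge0; lra.
have Z1 : 0 <= 1 + Z by rewrite addr_ge0// ltW.
exists ((1 + Z) `^ p) => [|b n b0]; first by apply: powR_gt0; rewrite addr_gt0.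
have E : \sum_(i < n) i.+1%:R `^ p * b i `^ p = \sum_(i < n) (i.+1%:R * b i) `^ p.
  by apply: eq_bigr => i _; rewrite powRM.
rewrite E; set S := \sum_(i < n) _ `^ p.
have S0 : 0 <= S by apply: sumr_ge0 => i _; exact: powR_ge0.
pose Y := S `^ p^-1.
have YS : Y `^ p = S by rewrite /Y -powRrM mulVf ?gt_eqF// powRr1.
have Y0 : 0 <= Y by exact: powR_ge0.
suff : \sum_(i < n) b i <= (1 + Z) * Y.
  rewrite -YS -powRM// => h.
  by rewrite ge0_ler_powR ?nnegrE ?(ltW p0) ?sumr_ge0 ?mulr_ge0.
have [Yz|Yn] := eqVneq Y 0.
  have Sz : S = 0 by rewrite -YS Yz powR0 ?gt_eqF.
  have bz (i : 'I_n) : b i = 0.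
    have : (i.+1%:R * b i) `^ p <= S.
      by rewrite /S (bigD1 i)//= lerDl sumr_ge0// => j _; exact: powR_ge0.
    rewrite Sz => h.
    have /powR_eq0_eq0 /eqP : (i.+1%:R * b i) `^ p = 0.
      by apply/eqP; rewrite eq_le h powR_ge0.
    by rewrite mulf_eq0 pnatr_eq0 /= => /eqP.
  by rewrite Yz mulr0 big1.
have {}Y0 : 0 < Y by rewrite lt_def Yn.
(* After division by the p-norm [Y], Young's inequality for each term gives at most 1/p + Z/q. *)
rewrite -ler_pdivrMr// mulr_suml.
apply: le_trans (_ : \sum_(i < n) ((i.+1%:R * b i) `^ p / S / p +
   (i.+1%:R : R) `^ (- q) / q) <= _).
  apply: ler_sum => i _.
  have yb : 0 <= i.+1%:R * b i / Y by rewrite divr_ge0 ?mulr_ge0 ?(ltW Y0).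
  have := conjugate_powR yb (_ : 0 <= (i.+1%:R)^-1) p0 q0 pq.
  rewrite invr_ge0 ler0n => /(_ isT).
  have -> : i.+1%:R * b i / Y / i.+1%:R = b i / Y.
    have : i.+1%:R != 0 :> R by rewrite pnatr_eq0.
    by move: (i.+1%:R : R) => m m0; field; rewrite Yn m0.
  have -> : (i.+1%:R * b i / Y) `^ p = (i.+1%:R * b i) `^ p / S.
    rewrite -YS powRM ?mulr_ge0 ?invr_ge0 ?(ltW Y0)//; congr (_ * _).
    by rewrite -[Y^-1]powR_inv1 ?(ltW Y0)// -powRrM mulrC powRrM powR_inv1// powR_ge0.
  by rewrite -[(i.+1%:R)^-1]powR_inv1// -powRrM mulN1r.
rewrite big_split /= -!mulr_suml -/S.
have Sn : S != 0 by rewrite -YS gt_eqF// powR_gt0.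
rewrite divff// mul1r lerD//.
  by rewrite invf_le1// ltW.
rewrite ler_pdivrMr// (le_trans (riemann_sum_bounded q1 n))//.
by rewrite ler_peMr ?ltW// ltW.
Qed.

Lemma powR_add3 (p a b c : R) : 0 < p -> 0 <= a -> 0 <= b -> 0 <= c ->
  (a + b + c) `^ p <= 3 `^ p * (a `^ p + b `^ p + c `^ p).
Proof.
move=> p0 a0 b0 c0; pose m := Num.max a (Num.max b c).
have m0 : 0 <= m by rewrite le_max a0.
have ma : a <= m by rewrite le_max lexx.
have mb : b <= m by rewrite !le_max lexx orbT.
have mc : c <= m by rewrite !le_max lexx !orbT.
apply: le_trans (_ : (3 * m) `^ p <= _).
  by rewrite ge0_ler_powR ?nnegrE ?(ltW p0) ?addr_ge0 ?mulr_ge0//; lra.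
rewrite powRM// ler_wpM2l ?powR_ge0//.
have : [\/ m = a, m = b | m = c].
  rewrite /m; case: (leP a (Num.max b c)) => _; last by constructor 1.
  by case: (leP b c) => _; [constructor 3|constructor 2].
have := powR_ge0 a p; have := powR_ge0 b p; have := powR_ge0 c p.
by move=> h1 h2 h3 [] ->; lra.
Qed.

End numeric.

Arguments modulus {R} z : simpl never.

(** * Energy of the pieces of a radius *)

Section energy.
Context {R : realType}.
Local Notation leb := (@lebesgue_measure R).
Local Notation leb2 := (leb \x leb)%E.
Implicit Types (f df : R[i] -> R[i]) (w : plane R) (z zeta u : R[i]).

(** The density of tau with respect to [leb2], up to the factor pi that normalizes [area]. *)
Definition dens (p : R) df w : R :=
  modulus (df (cplx w)) `^ p * (1 - modulus (cplx w) ^+ 2) `^ (p - 2).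

Lemma dens_ge0 p df w : 0 <= dens p df w.
Proof. by rewrite mulr_ge0 ?powR_ge0. Qed.

Lemma measurable_dens p f df : holo f df -> measurable_fun (@disk R) (dens p df).
Proof.
move=> hf; apply: measurable_funM.
  by apply: (measurableT_comp (measurable_powR p)); exact: deriv_measurable hf.
apply: (measurableT_comp (measurable_powR (p - 2))).
apply: measurable_funB => //; apply: measurable_funX.
by apply: measurable_funTS; exact: measurable_modulus.
Qed.

(* The part of the ring [1 - |w| ~ 2^-k] which is close to [z]; it is empty
   unless [z] lies beyond the circle of radius [1 - 2^-k]. *)
Definition ring_near (k : nat) z : set (plane R) := [set w |
  [/\ 2 ^- k / 4 <= 1 - modulus (cplx w), 1 - modulus (cplx w) <= 2 * 2 ^- k,
      modulus (z - cplx w) < 2 * 2 ^- k & 1 - modulus z < 2 ^- k]].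

Lemma pow2V_gt0 k : 0 < 2 ^- k :> R.
Proof. by rewrite invr_gt0 exprn_gt0. Qed.

Lemma ring_near_disk k z : ring_near k z `<=` @disk R.
Proof.
move=> w [h _ _ _]; rewrite /disk /unit_disk /=.
have := pow2V_gt0 k; lra.
Qed.

Lemma measurable_dist z (r : R) : measurable [set w : plane R | modulus (z - cplx w) < r].
Proof.
apply: box_open_measurable => w /= wr.
exists ((r - modulus (z - cplx w)) / 2) => [|w' h1 h2].
  by rewrite divr_gt0// subr_gt0.
have tri (a b : R[i]) : modulus (z - b) <= modulus (z - a) + modulus (b - a).
  rewrite (modulusB b a); apply: le_trans (modulusD _ _).
  by rewrite addrA subrK.
apply: le_lt_trans (tri (cplx w) _) _; rewrite -ltrBrDl.
exact: cplx_box.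
Qed.

Lemma measurable_modulus_itv (i : interval R) :
  measurable [set w : plane R | modulus (cplx w) \in i].
Proof.
have := @measurable_modulus R measurableT _ (measurable_itv i).
by rewrite setTI.
Qed.

Lemma measurable_ring_near k z : measurable (ring_near k z).
Proof.
have [zk|zk] := boolP (1 - modulus z < 2 ^- k); last first.
  rewrite (_ : ring_near k z = set0)//; apply/seteqP; split => w // [_ _ _ h].
  by rewrite h in zk.
rewrite (_ : ring_near k z =
  [set w | modulus (cplx w) \in `[1 - 2 * 2 ^- k, 1 - 2 ^- k / 4]] `&`
  [set w | modulus (z - cplx w) < 2 * 2 ^- k]).
  by apply: measurableI; [exact: measurable_modulus_itv|exact: measurable_dist].
apply/seteqP; split => w /=; rewrite in_itv /=.
  by move=> [h1 h2 h3 _]; split => //; lra.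
by move=> [/andP[h1 h2] h3]; split => //; lra.
Qed.

Lemma powR_quarter (y m : R) : 4^-1 <= y <= 4 -> 4 `^ (- `|m|) <= y `^ m.
Proof.
move=> /andP[y1 y4]; have y0 : 0 < y by apply: lt_le_trans y1; rewrite invr_gt0.
have [m0|m0] := ger0P m.
  have -> : 4 `^ (- m) = 4^-1 `^ m :> R.
    by rewrite -powR_inv1// -powRrM mulN1r.
  by rewrite ge0_ler_powR ?nnegrE ?invr_ge0 ?(ltW y0).
rewrite opprK; have -> : y `^ m = (y `^ (- m))^-1 by rewrite powRN invrK.
have -> : 4 `^ m = (4 `^ (- m))^-1 :> R by rewrite powRN invrK.
rewrite lef_pV2 ?posrE ?powR_gt0// ge0_ler_powR ?nnegrE ?oppr_ge0 ?(ltW m0) ?(ltW y0)//.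
Qed.

Lemma one_sub_sqr_bounds (t e : R) : 0 <= t -> t <= 1 -> e / 4 <= 1 - t -> 1 - t <= 2 * e ->
  e / 4 <= 1 - t ^+ 2 /\ 1 - t ^+ 2 <= 4 * e.
Proof. by move=> t0 t1 h1 h2; rewrite expr2; split; nra. Qed.

(** At each point of the segment the submean inequality on a square of side comparable to 2^-k
    bounds |df|^p by 2^(kp) tau of the ring, and the segment has length at most 2^-k. The ring is
    centred at the end [r] of the chain, not at r2, so that one point [z] governs all steps. *)
Lemma chain_step (p : R) : 0 < p -> exists2 c : R, 0 < c &
  forall f df k u (r1 r2 r : R), holo f df -> modulus u = 1 ->
  1 - 2 ^- k <= r1 -> r1 <= r2 -> r2 <= 1 - 2 ^- k / 2 -> r2 <= r ->
  1 - 2 ^- k < r -> r < 1 ->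
  ((modulus (f (r2%:C * u) - f (r1%:C * u)) `^ p)%:E <=
   c%:E * \int[leb2]_(w in ring_near k (r%:C * u)%R) (dens p df w)%:E)%E.
Proof.
move=> p0; have [c0 c00 Hc] := @deriv_submean_power R p p0.
pose A : R := 4 `^ `|p - 2|.
have A0 : 0 < A by rewrite powR_gt0.
(* 256 = 16^2 comes from h = e/16, and [A] from comparing (1-|w|^2)^(p-2) with e^(p-2) when the
   ratio of the bases is between 1/4 and 4. *)
pose q : R := 256; have q0 : 0 < q by rewrite ltr0n.
exists (q * c0 * A) => [|f df k u r1 r2 r hf u1 r1k r12 r2k r2r rk rlt1].
  by rewrite mulr_gt0// mulr_gt0.
set C' := q * c0 * A; have C0 : 0 < C' by rewrite mulr_gt0// mulr_gt0.
set e : R := 2 ^- k in r1k r2k rk *.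
have e0 : 0 < e by exact: pow2V_gt0.
have e1 : e <= 1 by rewrite invf_le1 ?exprn_gt0// exprn_ege1// ler1n.
set S := ring_near k _; set J := (\int[leb2]_(w in S) _)%E.
have J0 : (0 <= J)%E by apply: integral_ge0 => w _; rewrite lee_fin dens_ge0.
have mS : measurable S by exact: measurable_ring_near.
have mD : measurable_fun S (fun w => (dens p df w)%:E).
  apply/measurable_EFinP; apply: measurable_funS (measurable_dens p hf).
    exact: measurable_disk.
  exact: ring_near_disk.
have modu (t : R) : 0 <= t -> modulus (t%:C * u) = t.
  by move=> t0; rewrite modulusM modulusC u1 mulr1 ger0_norm.
(* The doubled square stays within 4h = e/4 of a point at distance at least e/2 from the circle, and
   the square itself keeps 1 - |w| >= e/4, as [ring_near] demands. *)
pose h := e / 16; have h0 : 0 < h by rewrite divr_gt0.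
have near_c t x y m : r1 <= t <= r2 -> `|x - Re (t%:C * u)| <= m ->
    `|y - Im (t%:C * u)| <= m -> modulus ((x +i* y) - t%:C * u) <= 2 * m.
  move=> tr hx hy; rewrite (le_trans (modulus_le_ReIm _))//.
  have -> : Re ((x +i* y) - t%:C * u) = x - Re (t%:C * u) by case: (_ * u).
  have -> : Im ((x +i* y) - t%:C * u) = y - Im (t%:C * u) by case: (_ * u).
  lra.
have in_disk t : r1 <= t <= r2 -> sq_in_disk (Re (t%:C * u)) (Im (t%:C * u)) (2 * h).
  move=> tr x y hx hy; have := near_c _ _ _ _ tr hx hy.
  have t0 : 0 <= t by move: tr; lra.
  have := modulusD ((x +i* y) - t%:C * u) (t%:C * u); rewrite subrK modu//.
  by rewrite /h; lra.
have in_S t : r1 <= t <= r2 -> sq (Re (t%:C * u)) (Im (t%:C * u)) h `<=` S.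
  move=> tr w /sqP[hx hy]; have hw := near_c _ _ _ _ tr hx hy.
  have t0 : 0 <= t by move: tr; lra.
  have r0 : 0 <= r by lra.
  have wE : w.1 +i* w.2 = cplx w by [].
  have := modulus_dist (w.1 +i* w.2) (t%:C * u); rewrite modu// ler_norml => /andP[d1 d2].
  have d3 : modulus (r%:C * u - (w.1 +i* w.2)) <= (r - t) + 2 * h.
    have -> : r%:C * u - (w.1 +i* w.2) = (r - t)%:C * u - ((w.1 +i* w.2) - t%:C * u).
      by rewrite rmorphB; ring.
    by rewrite (le_trans (modulusBD _ _))// lerD// modu//; lra.
  move: hw d1 d2 d3; rewrite wE /S /ring_near /= modu// -/e /h => hw d1 d2 d3.
  by split; lra.
have weight w : S w -> modulus (df (cplx w)) `^ p <= A * e `^ (2 - p) * dens p df w.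
  move=> Sw; have [s1 s2 _ _] := Sw; have wd := ring_near_disk Sw.
  have [b1 b2] := one_sub_sqr_bounds (modulus_ge0 _) (ltW wd) s1 s2.
  set x := 1 - modulus (cplx w) ^+ 2 in b1 b2; rewrite -/e in b1 b2.
  have xe : 4^-1 <= x / e <= 4.
    by apply/andP; split; [rewrite ler_pdivlMr//; lra|rewrite ler_pdivrMr].
  have := powR_quarter (p - 2) xe; rewrite powRN -/A.
  rewrite -div1r ler_pdivrMr// => hA.
  rewrite /dens -/x; set D := modulus _ `^ p.
  have -> : A * e `^ (2 - p) * (D * x `^ (p - 2)) = D * ((x / e) `^ (p - 2) * A).
    have x0 : 0 <= x by apply: le_trans b1; rewrite divr_ge0 ?(ltW e0).
    rewrite powRM ?invr_ge0 ?(ltW e0)// -[e^-1]powR_inv1 ?(ltW e0)// -powRrM.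
    have -> : -1 * (p - 2) = 2 - p by ring.
    ring.
  by rewrite ler_peMr ?powR_ge0.
have dfb t : r1 <= t <= r2 ->
    ((modulus (df (t%:C * u)) `^ p)%:E <= (C' * e `^ (- p))%:E * J)%E.
  move=> tr.
  have := Hc f df _ _ h h0 hf (in_disk _ tr).
  have -> : Re (t%:C * u) +i* Im (t%:C * u) = t%:C * u by case: (_ * u).
  move=> H1.
  have H2 : (\int[leb2]_(w in sq (Re (t%:C * u)%R) (Im (t%:C * u)%R) h)
     (modulus (df (cplx w)) `^ p)%:E <= (A * e `^ (2 - p))%:E * J)%E.
    rewrite -ge0_integralZl//; last first.
      by rewrite lee_fin mulr_ge0 ?powR_ge0 ?(ltW A0).
      by move=> w _; rewrite lee_fin dens_ge0.
    apply: ge0_le_integralW => [|w _|w _|w].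
    - exact: in_S.
    - by rewrite lee_fin powR_ge0.
    - by rewrite -EFinM lee_fin mulr_ge0 ?dens_ge0 ?mulr_ge0 ?powR_ge0 ?(ltW A0).
    - by move=> /(in_S _ tr) Sw; rewrite -EFinM lee_fin; exact: weight.
  have H3 : ((h ^+ 2 * modulus (df (t%:C * u)) `^ p)%:E <=
      (c0 * (A * e `^ (2 - p)))%:E * J)%E.
    apply: le_trans H1 _; rewrite EFinM -muleA lee_wpmul2l// lee_fin ltW//.
  have hE : C' * e `^ (- p) = (h ^+ 2)^-1 * (c0 * (A * e `^ (2 - p))).
    have -> : e `^ (2 - p) = e ^+ 2 * e `^ (- p).
      rewrite -powR_mulrn ?(ltW e0)// -powRD//.
      by rewrite (gt_eqF e0) implybT.
    by rewrite /C' /h /q; field; rewrite gt_eqF.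
  rewrite hE EFinM -muleA.
  apply: le_trans (_ : ((h ^+ 2)^-1%:E * (h ^+ 2 * modulus (df (t%:C * u)) `^ p)%:E <= _)%E).
    by rewrite -EFinM lee_fin mulKf// gt_eqF// exprn_gt0.
  by apply: lee_wpmul2l => //; rewrite lee_fin invr_ge0 exprn_ge0// ltW.
have [Joo|Jfin] := eqVneq J +oo%E.
  by rewrite Joo gt0_muley ?leey ?lte_fin.
have {Jfin} : exists2 j : R, 0 <= j & J = j%:E.
  move: J0 Jfin; case: J {dfb} => [j||] // j0 _; by exists j.
move=> [j j0 JE]; rewrite JE in dfb *.
pose L := (C' * j) `^ p^-1 / e.
have CJ : ((C' * j) `^ p^-1) `^ p = C' * j.
  have pn0 : p != 0 by rewrite gt_eqF.
  rewrite -powRrM (mulVf pn0) powRr1//.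
  exact: mulr_ge0 (ltW C0) j0.
have eV : (e^-1) `^ p = e `^ (- p).
  by rewrite -[e^-1]powR_inv1 ?(ltW e0)// -powRrM mulN1r.
have lip : modulus (f (r2%:C * u) - f (r1%:C * u)) <= L * modulus (r2%:C * u - r1%:C * u).
  apply: segment_lipschitz => t /andP[t0 t1].
  have -> : r1%:C * u + t%:C * (r2%:C * u - r1%:C * u) = (r1 + t * (r2 - r1))%:C * u.
    by rewrite rmorphD rmorphM rmorphB; ring.
  set t' := r1 + t * (r2 - r1).
  have tr : r1 <= t' <= r2 by rewrite /t'; nra.
  exists (df (t'%:C * u)); first by apply: hf; rewrite modu; [lra|lra].
  have := dfb _ tr; rewrite -EFinM lee_fin => hb.
  apply: (ler_powR_inv p0); [exact: modulus_ge0|by rewrite divr_ge0 ?powR_ge0 ?ltW|].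
  have -> : L `^ p = C' * j * e `^ (- p).
    by rewrite /L powRM ?invr_ge0 ?powR_ge0 ?(ltW e0)// CJ eV.
  by rewrite mulrAC.
rewrite -EFinM lee_fin.
rewrite -[leRHS]CJ.
rewrite ge0_ler_powR ?nnegrE ?modulus_ge0 ?powR_ge0 ?(ltW p0)//.
apply: le_trans lip _.
have -> : r2%:C * u - r1%:C * u = (r2 - r1)%:C * u by rewrite rmorphB; ring.
rewrite modu; last lra.
rewrite /L -mulrA ler_piMr ?powR_ge0// mulrC ler_pdivrMr//; lra.
Qed.

End energy.

Section energy_bounds.
Context {R : realType}.
Local Notation leb := (@lebesgue_measure R).
Local Notation leb2 := (leb \x leb)%E.
Implicit Types (f df : R[i] -> R[i]) (w : plane R) (z zeta u a : R[i]).

Lemma mobius_identity a z : 1 - a^*%C * z != 0 ->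
  1 - modulus (mobius a z) ^+ 2 =
  (1 - modulus a ^+ 2) * (1 - modulus z ^+ 2) / modulus (1 - a^*%C * z) ^+ 2.
Proof.
move=> nz; have m0 : modulus (1 - a^*%C * z) ^+ 2 != 0.
  by rewrite expf_neq0// modulus_eq0.
rewrite /mobius modulusM modulusV exprMn exprVn.
apply: (mulIf m0); rewrite mulrBl mul1r !divfK//.
rewrite !sqr_modulus; case: a {nz m0} => a1 a2; case: z => z1 z2 /=; ring.
Qed.

Lemma mobius_cdiff a z : modulus a < 1 -> modulus z < 1 ->
  exists l, cdiff (mobius a) z l.
Proof.
move=> a1 z1.
have nz : 1 - a^*%C * z != 0 by rewrite modulus_lt1_neq0 ?modulus_conj// ltW.
have d1 : cdiff (fun w : R[i] => a + (-1) * w) z (0 + (-1 * 1 + 0 * z)).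
  apply: cdiffD; first exact: cdiff_cst.
  by apply: cdiffM; [exact: cdiff_cst|exact: cdiff_id].
have d2 : cdiff (fun w : R[i] => 1 + (- a^*%C) * w) z (0 + (- a^*%C * 1 + 0 * z)).
  apply: cdiffD; first exact: cdiff_cst.
  by apply: cdiffM; [exact: cdiff_cst|exact: cdiff_id].
have nz' : 1 + (- a^*%C) * z != 0 by rewrite mulNr.
have H := cdiffM d1 (@cdiffV _ (fun w : R[i] => 1 + (- a^*%C) * w) z _ nz' d2).
rewrite (_ : mobius a = (fun w : R[i] => (a + (-1) * w) * (1 + (- a^*%C) * w)^-1)); last first.
  by apply/funext => w; rewrite /mobius mulN1r mulNr.
by eexists; exact: H.
Qed.

Lemma measurable_disk_weight (s : R) :
  measurable_fun (@disk R) (fun w => (1 - modulus (cplx w) ^+ 2) `^ s).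
Proof.
apply: (measurableT_comp (measurable_powR s)).
apply: measurable_funB => //; apply: measurable_funX.
by apply: measurable_funTS; exact: measurable_modulus.
Qed.

Lemma measurable_mobius_weight a (s : R) : modulus a < 1 ->
  measurable_fun (@disk R) (fun w => (1 - modulus (mobius a (cplx w)) ^+ 2) `^ s).
Proof.
move=> a1; apply: (measurableT_comp (measurable_powR s)).
apply: measurable_funB => //; apply: measurable_funX.
have [] // := @modulus_continuous_measurable _ (@disk R) (mobius a).
  exact: measurable_disk.
move=> w w1; have [l dl] := mobius_cdiff a1 w1.
exact: cdiff_continuous dl.
Qed.

(** [L] stands for the p-th power of the seminorm with q = p - 2; the link is [F_seminorm_le]. *)
Definition energy_le (p s : R) df (L : R) := forall a, modulus a < 1 ->
  (\int[area]_(w in @disk R)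
     (dens p df w * (1 - modulus (mobius a (cplx w)) ^+ 2) `^ s)%:E <= L%:E)%E.

Lemma one_sub_sqr_modulus_gt0 w : disk w -> 0 < 1 - modulus (cplx w) ^+ 2.
Proof.
rewrite /disk /unit_disk /= => w1; have := modulus_ge0 (cplx w).
by rewrite expr2; nra.
Qed.

Definition near_pt zeta (r : R) : set (plane R) :=
  [set w | modulus (zeta - cplx w) < r].

(** The supremum is tested at a = (1 - e) zeta with e = 2^-k. There |1 - conj(a) w| <= 33 e and 1 -
    |a|^2 >= e, so by [mobius_identity] 1 - |phi_a(w)|^2 >= (1 - |w|^2) / (1089 e), where 1089 =
    33^2. The factor pi undoes the normalization of [area]. *)
Lemma energy_ball (p s : R) f df (L : R) zeta k : 0 < s -> holo f df ->
  energy_le p s df L -> modulus zeta = 1 ->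
  (\int[leb2]_(w in @disk R `&` near_pt zeta (32 * 2 ^- k)%R)
     (dens p df w * (1 - modulus (cplx w) ^+ 2) `^ s)%:E <=
   (pi * 1089 `^ s * (2 ^- k) `^ s * L)%:E)%E.
Proof.
move=> s0 hf HL z1; set e : R := 2 ^- k.
have e0 : 0 < e by exact: pow2V_gt0.
have e1 : e <= 1 by rewrite invf_le1 ?exprn_gt0// exprn_ege1// ler1n.
pose a : R[i] := (1 - e)%:C * zeta.
have ma : modulus a = 1 - e by rewrite modulusM modulusC z1 mulr1 ger0_norm ?subr_ge0.
have a1 : modulus a < 1 by rewrite ma; lra.
have dm : measurable (@disk R) by exact: measurable_disk.
pose g w := dens p df w * (1 - modulus (mobius a (cplx w)) ^+ 2) `^ s.
have g0 w : 0 <= g w by rewrite mulr_ge0 ?dens_ge0 ?powR_ge0.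
have mg : measurable_fun (@disk R) g.
  by apply: measurable_funM; [exact: measurable_dens hf|exact: measurable_mobius_weight].
have mgE : measurable_fun (@disk R) (fun w => (g w)%:E) by exact/measurable_EFinP.
have := HL a a1; rewrite ge0_integral_mscale//=.
have pi0 : 0 < pi :> R by exact: pi_gt0.
set J := (\int[leb2]_(w in _) (g w)%:E)%E => H1.
have H2 : (J <= (pi * L)%:E)%E.
  rewrite -[J]mul1e -(divff (lt0r_neq0 pi0)) EFinM -muleA.
  by rewrite EFinM lee_wpmul2l// lee_fin ltW.
have c0 : 0 <= 1089 `^ s * e `^ s by rewrite mulr_ge0 ?powR_ge0.
have -> : (pi * 1089 `^ s * e `^ s * L)%:E = ((1089 `^ s * e `^ s)%:E * (pi * L)%:E)%E.
  by rewrite -EFinM; congr (_%:E); ring.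
apply: le_trans (lee_wpmul2l _ H2); last by rewrite lee_fin.
rewrite /J -ge0_integralZl//; last by move=> w _; rewrite lee_fin.
apply: ge0_le_integralW => [w []//|w _|w _|w [wd /= wz]].
- by rewrite lee_fin mulr_ge0 ?dens_ge0 ?powR_ge0.
- by rewrite -EFinM lee_fin mulr_ge0.
rewrite -EFinM lee_fin mulrCA ler_wpM2l ?dens_ge0//.
have nz : 1 - a^*%C * (cplx w : R[i]) != 0.
  by apply: modulus_lt1_neq0; rewrite ?modulus_conj ?(ltW a1).
rewrite mobius_identity// ma.
set x := 1 - modulus (cplx w) ^+ 2; have x0 : 0 < x by exact: one_sub_sqr_modulus_gt0.
have zz := conj_unit z1.
have dist : modulus (1 - a^*%C * (cplx w : R[i])) <= 33 * e.
  have -> : 1 - a^*%C * (cplx w : R[i]) =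
     zeta^*%C * (zeta - (cplx w : R[i])) + e%:C * zeta^*%C * (cplx w : R[i]).
    have -> : a^*%C = (1 - e%:C) * zeta^*%C.
      rewrite /a; case: (zeta) => b1 b2; apply/eqP; rewrite eq_complex /=.
      by apply/andP; split; apply/eqP; ring.
    by rewrite mulrBr zz; ring.
  rewrite (le_trans (modulusD _ _))// !modulusM modulus_conj z1 modulusC gtr0_norm//.
  have w1 : modulus (cplx w) < 1 by [].
  rewrite mul1r mulr1; have := ler_wpM2l (ltW e0) (ltW w1).
  have wz' : modulus (zeta - (cplx w : R[i])) < 32 * e := wz.
  by move: wz'; lra.
have M0 : 0 < modulus (1 - a^*%C * (cplx w : R[i])) by rewrite modulus_gt0.
have [K KE K0] : exists2 K : R, K = 1089 & 0 < K by exists 1089; rewrite ?ltr0n.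
rewrite -KE; set m := modulus _ in dist M0 *.
have m2 : m ^+ 2 <= K * e ^+ 2.
  have -> : K * e ^+ 2 = (33 * e) ^+ 2 by rewrite KE; ring.
  by rewrite lerXn2r ?nnegrE ?(ltW M0) ?mulr_ge0 ?(ltW e0).
have y0 : 0 <= (1 - (1 - e) ^+ 2) * x / m ^+ 2.
  by rewrite !mulr_ge0 ?invr_ge0 ?exprn_ge0 ?(ltW M0) ?(ltW x0)// expr2; nra.
have Ke0 : 0 <= K * e by exact: mulr_ge0 (ltW K0) (ltW e0).
have -> : K `^ s * e `^ s = (K * e) `^ s by rewrite powRM// ltW.
rewrite -powRM//; apply: ge0_ler_powR; rewrite ?nnegrE ?(ltW s0) ?(ltW x0)//.
  exact: mulr_ge0.
rewrite !mulrA ler_pdivlMr ?exprn_gt0// mulrC; apply: ler_wpM2r; first exact: ltW.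
apply: le_trans m2 _; rewrite -[leRHS]mulrA ler_wpM2l ?(ltW K0)// !expr2; nra.
by move=> w _; rewrite lee_fin; exact: g0.
Qed.

End energy_bounds.

Section pointwise.
Context {R : realType}.
Local Notation leb := (@lebesgue_measure R).
Local Notation leb2 := (leb \x leb)%E.
Implicit Types (f df : R[i] -> R[i]) (w : plane R) (z zeta u a : R[i]).

Lemma polar z : exists2 u, modulus u = 1 & z = (modulus z)%:C * u.
Proof.
have [->|z0] := eqVneq z 0; first by exists 1; rewrite ?modulus1 ?modulus0 ?mul0r.
have m0 : modulus z != 0 by rewrite modulus_eq0.
have mC : (modulus z)%:C != 0 :> R[i].
  by rewrite eq_complex /= negb_and m0.
exists (z / (modulus z)%:C); last by rewrite mulrC divfK.
by rewrite modulusM modulusV modulusC ger0_norm ?modulus_ge0// divff.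
Qed.

Lemma measurable_near_pt zeta (r : R) : measurable (near_pt zeta r).
Proof. exact: measurable_dist. Qed.

Lemma energy_le_ge0 (p s L : R) df : energy_le p s df L -> 0 <= L.
Proof.
move=> /(_ 0); rewrite modulus0 ltr01 => /(_ isT); rewrite -lee_fin; apply: le_trans.
by apply: integral_ge0 => w _; rewrite lee_fin mulr_ge0 ?dens_ge0 ?powR_ge0.
Qed.

Lemma near_pt_trans zeta z w (r1 r2 : R) :
  modulus (zeta - z) <= r1 -> modulus (z - cplx w) < r2 -> near_pt zeta (r1 + r2) w.
Proof.
move=> h1 h2; rewrite /near_pt /=.
have -> : zeta - (cplx w : R[i]) = (zeta - z) + (z - (cplx w : R[i])) by rewrite subrKA.
by rewrite (le_lt_trans (modulusD _ _))// ler_ltD.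
Qed.

(** On the ring (1-|w|^2)^s is comparable to (2^-k)^s, which is also the bound of [energy_ball]; the
    quotient no longer depends on k. This controls each single increment along a radius. *)
Lemma ring_energy (p s : R) : 0 < s -> exists2 c : R, 0 < c &
  forall f df L k z, holo f df -> energy_le p s df L -> modulus z < 1 ->
  (\int[leb2]_(w in ring_near k z) (dens p df w)%:E <= (c * L)%:E)%E.
Proof.
move=> s0; have [K KE K0] : exists2 K : R, K = 1089 & 0 < K by exists 1089; rewrite ?ltr0n.
have pi0 : 0 < pi :> R by exact: pi_gt0.
exists (4 `^ s * (pi * K `^ s)) => [|f df L k z hf HL z1].
  by rewrite !mulr_gt0 ?powR_gt0.
have [u u1 zE] := polar z.
set e : R := 2 ^- k; have e0 : 0 < e by exact: pow2V_gt0.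
have Ve : (e `^ s)^-1 * e `^ s = 1 by rewrite mulVf// gt_eqF// powR_gt0.
have L0 := energy_le_ge0 HL.
have H := energy_ball k s0 hf HL u1; rewrite -/e -KE in H.
have -> : (4 `^ s * (pi * K `^ s) * L)%:E =
    ((4 `^ s * (e `^ s)^-1)%:E * (pi * K `^ s * e `^ s * L)%:E)%E.
  rewrite -EFinM; congr (_%:E).
  rewrite -[LHS]mulr1 -Ve; ring.
have c0 : 0 <= 4 `^ s * (e `^ s)^-1 by rewrite mulr_ge0 ?invr_ge0 ?powR_ge0.
apply: le_trans (lee_wpmul2l _ H); last by rewrite lee_fin.
pose g w := (dens p df w * (1 - modulus (cplx w) ^+ 2) `^ s)%:E.
rewrite -/g; have g0 w : (0 <= g w)%E.
  by rewrite /g lee_fin mulr_ge0 ?dens_ge0 ?powR_ge0.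
have mS : measurable (@disk R `&` near_pt u (32 * e)).
  by apply: measurableI; [exact: measurable_disk|exact: measurable_near_pt].
have mg : measurable_fun (@disk R `&` near_pt u (32 * e)) g.
  apply/measurable_EFinP; apply: measurable_funS (@measurable_disk R) _ _; first by move=> w [].
  apply: measurable_funM; first exact: measurable_dens hf.
  exact: measurable_disk_weight.
rewrite -ge0_integralZl//.
apply: ge0_le_integralW => [w Sw|w _|w _|w Sw].
- have [_ _ d1 d2] := Sw; split; first exact: ring_near_disk Sw.
  have := @near_pt_trans u z w e (2 * e) _ d1; rewrite /near_pt /= => h.
  have uz : modulus (u - z) <= e.
    have -> : u - z = (1 - modulus z)%:C * u by rewrite {1}zE rmorphB rmorph1 mulrBl mul1r.
    by rewrite modulusM modulusC u1 mulr1 ger0_norm ?subr_ge0 ltW.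
  by apply: lt_le_trans (h uz) _; move: (ltW e0); rewrite -/e; lra.
- by rewrite lee_fin dens_ge0.
- by apply: mule_ge0 (g0 w); rewrite lee_fin.
have [s1 s2 _ _] := Sw; have wd := ring_near_disk Sw.
have [b1 b2] := one_sub_sqr_bounds (modulus_ge0 _) (ltW wd) s1 s2.
rewrite /g -EFinM lee_fin; set x := 1 - modulus (cplx w) ^+ 2 in b1 b2 *.
rewrite mulrCA ler_peMr ?dens_ge0//.
have x0 : 0 <= x by exact: ltW (one_sub_sqr_modulus_gt0 wd).
have -> : 4 `^ s / e `^ s * x `^ s = (4 * x / e) `^ s.
  rewrite !powRM ?invr_ge0 ?(ltW e0) ?mulr_ge0// -[e^-1]powR_inv1 ?(ltW e0)//.
  by rewrite -powRrM mulN1r powRN; ring.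
have one_s : 1 = 1 `^ s :> R by rewrite powR1.
rewrite [leLHS]one_s ge0_ler_powR ?nnegrE ?(ltW s0) ?divr_ge0 ?mulr_ge0 ?(ltW e0)//.
have {}b1 : e <= x * 4 by rewrite -ler_pdivrMr.
  by rewrite ler_pdivlMr// mul1r mulrC.
by move=> w _; exact: g0.
Qed.

Lemma pow2V_small (d : R) : 0 < d -> exists N, 2 ^- N < d.
Proof.
move=> d0; exists (Num.bound d^-1); have dV : 0 <= d^-1 by rewrite invr_ge0 ltW.
rewrite -[ltRHS]invrK ltf_pV2 ?posrE ?exprn_gt0 ?invr_gt0//.
apply: lt_le_trans (archi_boundP dV) _.
have -> : 2 ^+ Num.bound d^-1 = (2 ^ Num.bound d^-1)%N%:R :> R by rewrite natrX.
by rewrite ler_nat; apply: ltnW; exact: ltn_expl.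
Qed.

Lemma pow2VS k : 2 ^- k.+1 = 2 ^- k / 2 :> R.
Proof. by rewrite exprSr invfM. Qed.

(** The first k0 increments are each bounded by a multiple of L^(1/p) through [ring_energy], so that
    no weight is lost on them beyond (k0+1)^p. Only the increments beyond k0 go through
    [sum_powR_le] and keep their own rings. *)
Lemma pointwise_bound (p s : R) : 0 < p -> 0 < s -> exists2 c : R, 0 < c &
  forall f df L k0 z, holo f df -> energy_le p s df L -> modulus z < 1 ->
  ((modulus (f z) `^ p)%:E <= c%:E * ((modulus (f 0) `^ p + k0.+1%:R `^ p * L)%:E +
    \sum_(0 <= j <oo) ((j.+1%:R `^ p)%:E *
       \int[leb2]_(w in ring_near (k0 + j) z) (dens p df w)%:E)))%E.
Proof.
move=> p0 s0; have [c1 c10 Hstep] := @chain_step R p p0.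
have [c2 c20 Hring] := ring_energy p s0.
have [c3 c30 Hsum] := @sum_powR_le R p p0.
pose M := Num.max 1 (Num.max (c1 * c2) (c3 * c1)).
have M1 : 1 <= M by rewrite le_max lexx.
have M2 : c1 * c2 <= M by rewrite !le_max lexx orbT.
have M3 : c3 * c1 <= M by rewrite !le_max lexx !orbT.
have M0 : 0 < M by lra.
exists (3 `^ p * M) => [|f df L k0 z hf HL z1]; first by rewrite mulr_gt0 ?powR_gt0.
have [u u1 zE] := polar z; set r := modulus z in z1 zE.
have L0 := energy_le_ge0 HL.
have r0 : 0 <= r by exact: modulus_ge0.
(* The dyadic points are stopped at [z]; the increments after that are 0. *)
pose rho k := Num.min r (1 - 2 ^- k).
pose b k := modulus (f ((rho k.+1)%:C * u) - f ((rho k)%:C * u)).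
pose T k := (\int[leb2]_(w in ring_near k z) (dens p df w)%:E)%E.
have T0 k : (0 <= T k)%E by apply: integral_ge0 => w _; rewrite lee_fin dens_ge0.
have b0 k : 0 <= b k by exact: modulus_ge0.
have step k : ((b k `^ p)%:E <= c1%:E * T k)%E.
  have [rk|rk] := ltP (1 - 2 ^- k) r; last first.
    have e1 : rho k = r by apply/min_idPl.
    have e2 : rho k.+1 = r.
      apply/min_idPl; rewrite pow2VS; have := @pow2V_gt0 R k; lra.
    rewrite /b e1 e2 subrr modulus0 powR0 ?gt_eqF// mule_ge0// lee_fin ltW//.
  have e1 : rho k = 1 - 2 ^- k by apply/min_idPr; exact: ltW.
  rewrite /T zE; apply: (Hstep f df k u _ _ r hf u1) => //.
  - by rewrite e1.
  - rewrite e1 /rho le_min (ltW rk) pow2VS; have := @pow2V_gt0 R k; lra.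
  - by rewrite /rho -pow2VS ge_min lexx orbT.
  - by rewrite /rho ge_min lexx.
have tele m n : modulus (f ((rho (m + n)%N)%:C * u) - f ((rho m)%:C * u)) <=
    \sum_(i < n) b (m + i)%N.
  elim: n => [|n IH]; first by rewrite addn0 subrr modulus0 big_ord0.
  rewrite big_ord_recr /= addnS.
  have tri (x y v : R[i]) : modulus (x - v) <= modulus (y - v) + modulus (x - y).
    have -> : x - v = (y - v) + (x - y) by ring.
    exact: modulusD.
  by apply: le_trans (tri _ (f ((rho (m + n)%N)%:C * u)) _) _; rewrite lerD.
(* The chain reaches [z] after finitely many steps, so a finite sum precedes the series. *)
have [N hN] := @pow2V_small (1 - r) ltac:(by rewrite subr_gt0).
have rhoN n : (N <= n)%N -> rho n = r.
  move=> Nn; apply/min_idPl; suff : 2 ^- n <= 2 ^- N :> R by lra.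
  by rewrite lef_pV2 ?posrE ?exprn_gt0// ler_weXn2l// ler1n.
have rho0 : rho 0%N = 0 by rewrite /rho expr0 invr1 subrr; apply/min_idPr.
have fz : modulus (f z) <= modulus (f 0) + \sum_(i < k0) b i + \sum_(i < N) b (k0 + i)%N.
  have h1 := tele 0%N k0; have h2 := tele k0 N.
  rewrite add0n rho0 mul0r in h1; rewrite (rhoN _ (leq_addl _ _)) -zE in h2.
  have -> : f z = f 0 + (f ((rho k0)%:C * u) - f 0) + (f z - f ((rho k0)%:C * u)) by ring.
  by do 2! [apply: le_trans (modulusD _ _) _; rewrite lerD//].
have bL k : b k <= (M * L) `^ p^-1.
  have [->|rz] := eqVneq (b k) 0; first by rewrite powR_ge0.
  apply: (ler_powR_inv p0); rewrite ?powR_ge0// -powRrM mulVf ?gt_eqF// powRr1; last first.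
    by rewrite mulr_ge0// ltW.
  rewrite -lee_fin; apply: le_trans (step k) _.
  apply: le_trans (lee_wpmul2l _ (Hring f df L k z hf HL z1)) _; first by rewrite lee_fin ltW.
  by rewrite -EFinM lee_fin mulrA ler_wpM2r.
set A := modulus (f 0) in fz *; set B := \sum_(i < k0) _ in fz; set D := \sum_(i < N) _ in fz.
have A0 : 0 <= A by exact: modulus_ge0.
have B0 : 0 <= B by apply: sumr_ge0 => i _.
have D0 : 0 <= D by apply: sumr_ge0 => i _.
have H1 : modulus (f z) `^ p <= 3 `^ p * (A `^ p + B `^ p + D `^ p).
  apply: le_trans (powR_add3 p0 A0 B0 D0).
  by rewrite ge0_ler_powR ?nnegrE ?modulus_ge0 ?addr_ge0 ?(ltW p0).
have H2 : B `^ p <= M * (k0.+1%:R `^ p * L).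
  have -> : M * (k0.+1%:R `^ p * L) = (k0.+1%:R * (M * L) `^ p^-1) `^ p.
    rewrite powRM ?powR_ge0// -[((M * L) `^ _) `^ _]powRrM mulVf ?gt_eqF// powRr1.
      by ring.
    by rewrite mulr_ge0// ltW.
  rewrite ge0_ler_powR ?nnegrE ?mulr_ge0 ?powR_ge0 ?(ltW p0)//.
  apply: le_trans (_ : \sum_(i < k0) (M * L) `^ p^-1 <= _); first exact: ler_sum.
  by rewrite sumr_const card_ord -[leLHS]mulr_natl ler_wpM2r ?powR_ge0// ler_nat.
set S := (\sum_(0 <= j <oo) _)%E.
have H3 : ((D `^ p)%:E <= M%:E * S)%E.
  have := Hsum (fun i => b (k0 + i)%N) N (fun i => b0 _); rewrite -lee_fin => h.
  apply: le_trans h _.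
  have h4 : (\sum_(i < N) ((i.+1%:R `^ p)%:E * T (k0 + i)%N) <= S)%E.
    rewrite /S -(big_mkord xpredT (fun i => ((i.+1%:R `^ p)%:E * T (k0 + i)%N)%E)).
    apply: nneseries_lim_ge => i _ _; rewrite mule_ge0// lee_fin powR_ge0//.
  apply: le_trans (lee_wpmul2l _ h4); last by rewrite lee_fin ltW.
  rewrite EFinM -sumEFin.
  apply: le_trans (_ : (c3%:E * (c1%:E * \sum_(i < N) ((i.+1%:R `^ p)%:E * T (k0 + i)%N)) <= _)%E).
    rewrite lee_wpmul2l ?lee_fin ?(ltW c30)//.
    rewrite ge0_sume_distrr; last by move=> i _; rewrite mule_ge0// lee_fin powR_ge0.
    apply: lee_sum => i _; rewrite EFinM muleCA lee_wpmul2l// lee_fin powR_ge0//.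
  rewrite muleA -EFinM lee_wpmul2r ?lee_fin//.
  by apply: sume_ge0 => i _; rewrite mule_ge0// lee_fin powR_ge0.
rewrite EFinM -muleA.
apply: le_trans (_ : ((3 `^ p * (A `^ p + B `^ p + D `^ p))%:E <= _)%E).
  by rewrite lee_fin.
rewrite EFinM lee_wpmul2l ?lee_fin ?powR_ge0//.
rewrite EFinD ge0_muleDr; last 2 first.
- by rewrite lee_fin addr_ge0 ?mulr_ge0 ?powR_ge0.
- by apply: nneseries_ge0 => i _ _; apply: mule_ge0 (T0 _); rewrite lee_fin powR_ge0.
apply: leeD => //; rewrite -EFinM lee_fin mulrDr lerD//.
by rewrite ler_peMl ?powR_ge0.
Qed.

End pointwise.

(** * The embedding *)

(** Passes between [mu] on a set of finite mass and a finite measure on the whole space, the form in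
    which Tonelli's theorem can be applied although [mu] need not be sigma-finite. *)
Lemma integral_mfrestr d (T : measurableType d) (R : realType)
    (mu : {measure set T -> \bar R}) (D : set T) (mD : measurable D)
    (fin : (mu D < +oo)%E) (f : T -> \bar R) :
  measurable_fun setT f -> (forall x, (0 <= f x)%E) ->
  (\int[mfrestr mD fin]_x f x = \int[mu]_(x in D) f x)%E.
Proof.
move=> mf f0; set nu := mfrestr mD fin.
have mC : measurable (~` D) by exact: measurableC.
rewrite -(setUv D) ge0_integral_setU//=; last 2 first.
- by rewrite setUv.
- by rewrite disj_set2E setICr.
rewrite [X in (_ + X)%E](_ : _ = 0%E) ?adde0.
  apply: eq_measure_integral => A mA AD.
  by rewrite /nu /= /mfrestr /mrestr setIidl.
apply: null_set_integral => //.
- exact: measurable_funTS.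
- by rewrite /nu /= /mfrestr /mrestr setICl measure0.
Qed.

Section ring_relation.
Context {R : realType}.

Lemma measurable_ring_rel k :
  measurable [set zw : plane R * plane R | ring_near k (cplx zw.1) zw.2].
Proof.
have m1 : measurable_fun setT (fun zw : plane R * plane R => modulus (cplx zw.1)).
  by apply: (measurableT_comp measurable_modulus); exact: measurable_fst.
have m2 : measurable_fun setT (fun zw : plane R * plane R => modulus (cplx zw.2)).
  by apply: (measurableT_comp measurable_modulus); exact: measurable_snd.
have m3 : measurable_fun setT (fun zw : plane R * plane R =>
    modulus (cplx (zw.1.1 - zw.2.1, zw.1.2 - zw.2.2))).
  apply: (measurableT_comp measurable_modulus); apply: measurable_fun_pair.
    by apply: measurable_funB; [exact: (measurableT_comp measurable_fst measurable_fst)|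
      exact: (measurableT_comp measurable_fst measurable_snd)].
  by apply: measurable_funB; [exact: (measurableT_comp measurable_snd measurable_fst)|
    exact: (measurableT_comp measurable_snd measurable_snd)].
rewrite (_ : [set zw | _] =
  (setT `&` (fun zw : plane R * plane R => modulus (cplx zw.1)) @^-1` `]1 - 2 ^- k, +oo[) `&`
  (setT `&` (fun zw : plane R * plane R => modulus (cplx zw.2)) @^-1` `[1 - 2 * 2 ^- k, 1 - 2 ^- k / 4]) `&`
  (setT `&` (fun zw : plane R * plane R =>
    modulus (cplx (zw.1.1 - zw.2.1, zw.1.2 - zw.2.2))) @^-1` `]-oo, 2 * 2 ^- k[)).
  apply: measurableI; [apply: measurableI|].
  - by apply: m1.
  - by apply: m2.
  - by apply: m3.
apply/seteqP; split => -[z w]; rewrite /= !in_itv /= ?andbT.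
  by move=> [h1 h2 h3 h4]; do ?split => //; lra.
by move=> [[[_ h1] [_ h2]] [_ h3]]; split => //; lra.
Qed.

(** Only the scales with 2^-k comparable to [x] contribute. On them the minimum of (2^k x)^s and its
    inverse is at least 4^-s, so [min_geometric] counts them. *)
Lemma ring_sum_bounded (s : R) : 0 < s -> exists2 c : R, 0 < c &
  forall (x : R) k0 n, 0 < x ->
  \sum_(j < n) (if 2 ^- (k0 + j) / 4 <= x <= 2 * 2 ^- (k0 + j)
                then (2 ^- (k0 + j)) `^ s else 0) <= c * x `^ s.
Proof.
move=> s0; have q1 : 1 < 2 `^ s :> R.
  have one_s : 1 = 1 `^ s :> R by rewrite powR1.
  by rewrite [ltLHS]one_s gt0_ltr_powR ?nnegrE// ltr1n.
have [c c0 Hc] := min_geometric q1.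
exists (4 `^ s * 4 `^ s * c) => [|x k0 n x0].
  by rewrite !mulr_gt0 ?powR_gt0.
pose y := (2 `^ s) ^+ k0 * x `^ s.
have y0 : 0 < y by rewrite mulr_gt0 ?exprn_gt0 ?powR_gt0.
apply: le_trans (_ : \sum_(j < n) 4 `^ s * 4 `^ s * x `^ s *
    Num.min ((2 `^ s) ^+ j * y) ((2 `^ s) ^+ j * y)^-1 <= _); last first.
  rewrite -mulr_sumr mulrAC ler_wpM2r ?powR_ge0//.
  by rewrite ler_wpM2l ?mulr_ge0 ?powR_ge0//; exact: Hc.
apply: ler_sum => j _.
have -> : (2 `^ s) ^+ j * y = (2 ^+ (k0 + j) * x) `^ s.
  have e m : (2 `^ s) ^+ m = (2 ^+ m) `^ s :> R.
    by rewrite -powR_mulrn ?powR_ge0// -powRrM mulrC powRrM powR_mulrn.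
  by rewrite /y powRM ?exprn_ge0 ?(ltW x0)// -e exprD; ring.
set k := (k0 + j)%N; set e : R := 2 ^- k.
have e0 : 0 < e by exact: pow2V_gt0.
have -> : 2 ^+ k = e^-1 :> R by rewrite /e invrK.
have t0 : 0 < e^-1 * x by rewrite mulr_gt0 ?invr_gt0.
have m0 : 0 <= Num.min ((e^-1 * x) `^ s) ((e^-1 * x) `^ s)^-1.
  by rewrite le_min invr_ge0 powR_ge0.
case: ifPn => [/andP[h1 h2]|_]; last by rewrite !mulr_ge0 ?powR_ge0.
have hm : 1 <= 4 `^ s * Num.min ((e^-1 * x) `^ s) ((e^-1 * x) `^ s)^-1.
  have mono (a b : R) : 0 < a -> a <= b -> a `^ s <= b `^ s.
    by move=> a0 ab; rewrite ge0_ler_powR ?nnegrE ?(ltW s0)//; lra.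
  rewrite minr_pMr ?powR_ge0// le_min; apply/andP; split.
    rewrite -powRM ?(ltW t0)//; have -> : 1 = 1 `^ s :> R by rewrite powR1.
    by apply: mono; rewrite ?powR1// mulrCA ler_pdivlMl//; lra.
  rewrite ler_pdivlMr ?powR_gt0// mul1r; apply: mono => //.
  by rewrite ler_pdivrMl//; lra.
have hx : e `^ s <= 4 `^ s * x `^ s.
  by rewrite -powRM ?(ltW x0)// ge0_ler_powR ?nnegrE ?(ltW s0) ?(ltW e0) ?mulr_ge0 ?(ltW x0)//; lra.
apply: le_trans hx _; rewrite -[leLHS]mulr1 [leRHS](_ : _ = 4 `^ s * x `^ s *
   (4 `^ s * Num.min ((e^-1 * x) `^ s) ((e^-1 * x) `^ s)^-1)); last by ring.
by rewrite ler_wpM2l// mulr_ge0 ?powR_ge0.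
Qed.

End ring_relation.

Section embedding.
Context {R : realType}.
Local Notation leb := (@lebesgue_measure R).
Local Notation leb2 := (leb \x leb)%E.
Implicit Types (f df : R[i] -> R[i]) (w : plane R).

(** A Carleson box never contains the origin, so the logarithmic condition says nothing about the
    mass of [mu] there. *)
Definition pdisk : set (plane R) := [set w | 0 < modulus (cplx w) < 1].

Lemma pdisk_disk : pdisk `<=` @disk R.
Proof. by move=> w /= /andP[]. Qed.

Lemma measurable_pdisk : measurable pdisk.
Proof.
rewrite (_ : pdisk = [set w : plane R | modulus (cplx w) \in `]0, 1[]).
  exact: measurable_modulus_itv.
by apply/seteqP; split => w /=; rewrite in_itv.
Qed.

Lemma disk_finite (A : set (plane R)) : A `<=` @disk R -> measurable A -> (leb2 A < +oo)%E.
Proof.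
move=> AD mA; apply: (@le_lt_trans _ _ (leb2 (sq 0 0 1))).
  apply: le_measure; rewrite ?inE//; first exact: measurable_sq.
  move=> w /AD; rewrite /disk /unit_disk /= => w1; apply/sqP; rewrite !subr0; split.
    exact: le_trans (Re_le_modulus _) (ltW w1).
  exact: le_trans (Im_le_modulus _) (ltW w1).
by rewrite measure_sq// ltry.
Qed.

(** Both measures are made finite, [mu] by restriction to [B] and the area by restriction to [V].
    Since [V] contains every ring seen from [B], all inner integrals may be taken over this one
    set. *)
Lemma fubini_ring (mu : {measure set (plane R) -> \bar R}) (B V : set (plane R))
    (g : plane R -> R) k :
  measurable B -> (mu B < +oo)%E -> measurable V -> (leb2 V < +oo)%E ->
  measurable_fun V g -> (forall w, 0 <= g w) ->
  (forall z : plane R, B z -> ring_near k (cplx z) `<=` V) ->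
  measurable_fun B (fun z => \int[leb2]_(w in ring_near k (cplx z)) (g w)%:E)%E /\
  (\int[mu]_(z in B) \int[leb2]_(w in ring_near k (cplx z)) (g w)%:E =
   \int[leb2]_(w in V) ((g w)%:E * mu [set z | B z /\ ring_near k (cplx z) w]))%E.
Proof.
move=> mB finB mV finV mg g0 BV.
set nu := mfrestr mB finB; set lam := mfrestr mV finV.
pose h := (g \_ V : plane R -> R).
have mh : measurable_fun setT h by exact/(measurable_restrictT g mV).
have h0 w : 0 <= h w by rewrite /h patchE; case: ifP.
pose S := [set zw : plane R * plane R | ring_near k (cplx zw.1) zw.2].
have mS : measurable S by exact: measurable_ring_rel.
pose G (zw : plane R * plane R) := (\1_S zw * h zw.2)%:E.
have G0 zw : (0 <= G zw)%E by rewrite lee_fin mulr_ge0// indicE.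
have mG : measurable_fun setT G.
  apply/measurable_EFinP; apply: measurable_funM; first exact: measurable_indic.
  exact: (measurableT_comp mh measurable_snd).
have mSw w : measurable [set z | S (z, w)] by
  rewrite (_ : [set z | _] = ysection S w); [exact: measurable_ysection|
  apply/seteqP; split => z; rewrite /ysection /= inE].
have := @fubini_tonelli _ _ _ _ _ nu lam G mG G0.
have -> : (\int[nu]_z \int[lam]_w G (z, w) = \int[mu]_(z in B) \int[lam]_w G (z, w))%E.
  apply: integral_mfrestr; first exact: (@measurable_fun_fubini_tonelli_F _ _ _ _ _ lam G).
  by move=> x; apply: integral_ge0.
have -> : (\int[lam]_w \int[nu]_z G (z, w) = \int[leb2]_(w in V) \int[nu]_z G (z, w))%E.
  apply: integral_mfrestr; first exact: (@measurable_fun_fubini_tonelli_G _ _ _ _ _ nu G).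
  by move=> x; apply: integral_ge0.
have E z : z \in B -> (\int[leb2]_(w in ring_near k (cplx z)) (g w)%:E = \int[lam]_w G (z, w))%E.
  rewrite inE => Bz.
  have -> : (\int[lam]_w G (z, w) = \int[leb2]_(w in V) G (z, w))%E.
    apply: integral_mfrestr => //; exact: (measurableT_comp mG (measurable_pair1 z)).
  rewrite [LHS]integral_mkcond [RHS]integral_mkcond.
  apply: eq_integral => w _; rewrite !patchE /G indicE.
  have [Vw|Vw] := boolP (w \in V).
    rewrite /h patchE Vw; have [Sw|Sw] := boolP (w \in ring_near k (cplx z)).
      by rewrite mem_set ?mul1r//; move: Sw; rewrite inE.
    rewrite memNset ?mul0r// => Sw'; move/negP: Sw; apply.
    by rewrite inE.
  rewrite ifF//; apply/negbTE/negP; rewrite inE => Sw.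
  by move/negP: Vw; apply; rewrite inE; exact: BV Bz _ Sw.
move=> H; split.
  apply: (eq_measurable_fun (fun z => \int[lam]_w G (z, w))%E) => [z Bz|].
    exact/esym/E.
  by apply: measurable_funTS; exact: (@measurable_fun_fubini_tonelli_F _ _ _ _ _ lam G).
transitivity (\int[mu]_(z in B) \int[lam]_w G (z, w))%E; first exact: eq_integral.
rewrite H; apply: eq_integral => w; rewrite inE => Vw.
have mI : measurable_fun setT (fun z : plane R => (\1_[set z | S (z, w)] z : R)%:E).
  by apply/measurable_EFinP; exact: measurable_indic.
have -> : (\int[nu]_z G (z, w) = (h w)%:E * nu [set z | S (z, w)])%E.
  transitivity (\int[nu]_z ((h w)%:E * (\1_[set z | S (z, w)] z)%:E))%E.
    by apply: eq_integral => z _; rewrite /G -EFinM mulrC !indicE.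
  by rewrite ge0_integralZl ?lee_fin// integral_indic// setIT.
rewrite /nu /= /mfrestr /mrestr /h patchE mem_set//.
by congr (_ * mu _)%E; apply/seteqP; split => z /= [].
Qed.

Lemma measurable_shell (a b : R) :
  measurable [set w : plane R | a <= 1 - modulus (cplx w) <= b].
Proof.
rewrite (_ : [set w | _] = [set w : plane R | modulus (cplx w) \in `[1 - b, 1 - a]]).
  exact: measurable_modulus_itv.
apply/seteqP; split => w; rewrite /= in_itv /= => /andP[h1 h2]; apply/andP; split; lra.
Qed.

(** The logarithmic Carleson condition with dyadic balls in place of boxes; k+1 plays the role of
    log (2/|I|). The radius 16 leaves room for [box_near], whose constant is 9. *)
Definition pdisk_bound (mu : {measure set (plane R) -> \bar R}) (p s K : R) :=
  forall zeta k, modulus zeta = 1 ->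
  (mu (pdisk `&` near_pt zeta (16 * 2 ^- k)%R) <= (K * (2 ^- k) `^ s * k.+1%:R `^ (- p))%:E)%E.

Lemma embedding (p s : R) : 0 < p -> 0 < s -> exists2 c : R, 0 < c &
  forall (mu : {measure set (plane R) -> \bar R}) K f df L zeta k0, 0 <= K ->
  pdisk_bound mu p s K -> holo f df -> energy_le p s df L -> modulus zeta = 1 ->
  (\int[mu]_(z in pdisk `&` near_pt zeta (16 * 2 ^- k0)%R) (modulus (f (cplx z)) `^ p)%:E <=
   (c * K * (2 ^- k0) `^ s * (modulus (f 0) `^ p + L))%:E)%E.
Proof.
move=> p0 s0; have [c1 c10 Hpt] := pointwise_bound p0 s0.
have [c2 c20 Hsum] := ring_sum_bounded s0.
have [Q QE Q0] : exists2 Q : R, Q = 1089 & 0 < Q by exists 1089; rewrite ?ltr0n.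
have pi0 : 0 < pi :> R by exact: pi_gt0.
pose c := 1 + c2 * (pi * Q `^ s).
exists (c1 * c) => [|mu K f df L zeta k0 K0 HK hf HL z1].
  by rewrite mulr_gt0// addr_gt0// !mulr_gt0// powR_gt0.
have L0 := energy_le_ge0 HL.
set e : R := 2 ^- k0; have e0 : 0 < e by exact: pow2V_gt0.
set B := pdisk `&` _; pose V := @disk R `&` near_pt zeta (32 * e).
have mB : measurable B.
  by apply: measurableI; [exact: measurable_pdisk|exact: measurable_near_pt].
have mV : measurable V.
  by apply: measurableI; [exact: measurable_disk|exact: measurable_near_pt].
have finV : (leb2 V < +oo)%E by apply: disk_finite => // w [].
have muB : (mu B <= (K * e `^ s * k0.+1%:R `^ (- p))%:E)%E by exact: HK.
have finB : (mu B < +oo)%E by apply: le_lt_trans muB _; rewrite ltry.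
have md : measurable_fun V (dens p df).
  apply: measurable_funS (@measurable_disk R) _ _; first by move=> w [].
  exact: measurable_dens hf.
have BV k (z : plane R) : (k0 <= k)%N -> B z -> ring_near k (cplx z) `<=` V.
  move=> kk [zd zn] w Sw; split; first exact: ring_near_disk Sw.
  have [_ _ d1 _] := Sw; have zn' : modulus (zeta - (cplx z : R[i])) < 16 * e := zn.
  have h := near_pt_trans (ltW zn') d1.
  apply: lt_le_trans h _.
  have : 2 ^- k <= e by rewrite lef_pV2 ?posrE ?exprn_gt0// ler_weXn2l// ler1n.
  by move: (ltW e0); lra.
pose T j (z : plane R) := (\int[leb2]_(w in ring_near (k0 + j) (cplx z)) (dens p df w)%:E)%E.
have T0 j z : (0 <= T j z)%E by apply: integral_ge0 => w _; rewrite lee_fin dens_ge0.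
have FT j := @fubini_ring mu B V (dens p df) (k0 + j) mB finB mV finV md
   (dens_ge0 p df) (fun z => BV (k0 + j)%N z (leq_addr _ _)).
pose a j : R := j.+1%:R `^ p.
have a0 j : (0 <= (a j)%:E)%E by rewrite lee_fin powR_ge0.
pose A := modulus (f 0) `^ p + k0.+1%:R `^ p * L.
have A0 : 0 <= A by rewrite addr_ge0 ?mulr_ge0 ?powR_ge0.
have aT0 j z : (0 <= (a j)%:E * T j z)%E by rewrite mule_ge0.
have maT j : measurable_fun B (fun z => (a j)%:E * T j z)%E.
  by apply: measurable_funeM; have [] := FT j.
have step1 : (\int[mu]_(z in B) (modulus (f (cplx z)) `^ p)%:E <=
   c1%:E * (A%:E * mu B + \sum_(0 <= j <oo) ((a j)%:E * \int[mu]_(z in B) T j z)))%E.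
  apply: (@le_trans _ _ (\int[mu]_(z in B)
     (c1%:E * (A%:E + \sum_(0 <= j <oo) ((a j)%:E * T j z)))))%E.
    apply: ge0_le_integralW => // z Bz.
    - by rewrite lee_fin powR_ge0.
    - by rewrite mule_ge0 ?lee_fin ?(ltW c10)// adde_ge0 ?lee_fin// nneseries_ge0.
    - by apply: (Hpt f df L k0 (cplx z) hf HL); case: Bz => /pdisk_disk.
  have mS : measurable_fun B (fun z => \sum_(0 <= j <oo) ((a j)%:E * T j z))%E.
    exact: ge0_emeasurable_sum.
  have S0 z : (0 <= \sum_(0 <= j <oo) ((a j)%:E * T j z))%E by exact: nneseries_ge0.
  rewrite ge0_integralZl//; last 3 first.
  - by apply: emeasurable_funD => //; exact: measurable_cst.
  - by move=> z _; rewrite adde_ge0// lee_fin.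
  - by rewrite lee_fin ltW.
  rewrite ge0_integralD//.
  rewrite integral_cst// integral_nneseries//.
  rewrite (eq_eseriesr (g := fun j => ((a j)%:E * \int[mu]_(z in B) T j z)%E))//.
  by move=> j _; rewrite ge0_integralZl//; have [] := FT j.
pose W k : set (plane R) := [set w | 2 ^- k / 4 <= 1 - modulus (cplx w) <= 2 * 2 ^- k].
have mW k : measurable (W k) by exact: measurable_shell.
pose g j w : R := K * (dens p df w * ((2 ^- (k0 + j)) `^ s * \1_(W (k0 + j)%N) w)).
have ind0 k w : 0 <= (2 ^- k) `^ s * \1_(W k) w by rewrite mulr_ge0 ?powR_ge0// indicE.
have g0 j w : (0 <= (g j w)%:E)%E.
  by rewrite lee_fin; apply: mulr_ge0 => //; apply: mulr_ge0 (ind0 _ _); exact: dens_ge0.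
have mchi k : measurable_fun V (fun w => (2 ^- k) `^ s * \1_(W k) w).
  by apply: measurable_funM => //; exact: measurable_indic.
have mg j : measurable_fun V (fun w => (g j w)%:E).
  apply/measurable_EFinP; apply: measurable_funM => //.
  by apply: measurable_funM; [exact: md|exact: mchi].
(* A point [z] whose k-th ring contains [w] is within 4 * 2^-k of the radial projection [om] of [w]
   on the circle, so the slice has a dyadic ball at [om] as a cover. Outside [W k] the slice is
   empty. *)
have slice k w : (mu [set z | B z /\ ring_near k (cplx z) w] <=
    (K * ((2 ^- k) `^ s * \1_(W k) w) * k.+1%:R `^ (- p))%:E)%E.
  have mS : measurable [set z | B z /\ ring_near k (cplx z) w].
    rewrite (_ : [set z | _] = B `&`
      ysection [set zw : plane R * plane R | ring_near k (cplx zw.1) zw.2] w).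
      by apply: measurableI => //; apply: measurable_ysection; exact: measurable_ring_rel.
    by apply/seteqP; split => z; rewrite /ysection /= inE.
  have [Ww|Ww] := boolP (w \in W k); last first.
    rewrite (_ : [set z | _] = set0) ?measure0 ?lee_fin ?mulr_ge0 ?powR_ge0 ?indicE//.
    apply/seteqP; split => z // [_ [h1 h2 _ _]]; move/negP: Ww; apply.
    by rewrite inE /W /=; apply/andP.
  have [om om1 omE] := polar (cplx w : R[i]).
  apply: le_trans (_ : (mu (pdisk `&` near_pt om (16 * 2 ^- k)%R) <= _)%E); last first.
    by rewrite indicE Ww mulr1; exact: HK.
  apply: le_measure; rewrite ?inE//.
    by apply: measurableI; [exact: measurable_pdisk|exact: measurable_near_pt].
  move=> z [[zd _] [h1 h2 h3 _]]; split => //.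
  have w1 : modulus (om - (cplx w : R[i])) <= 2 * 2 ^- k.
    have -> : om - (cplx w : R[i]) = (1 - modulus (cplx w))%:C * om.
      by rewrite {1}omE rmorphB rmorph1 mulrBl mul1r.
    rewrite modulusM modulusC om1 mulr1 ger0_norm//.
    by have := @pow2V_gt0 R k; lra.
  rewrite modulusB in h3.
  apply: lt_le_trans (near_pt_trans w1 h3) _.
  by have := @pow2V_gt0 R k; lra.
(* The weight (j+1)^p is absorbed by (k0+j+1)^-p. *)
have step2 j : ((a j)%:E * \int[mu]_(z in B) T j z <= \int[leb2]_(w in V) (g j w)%:E)%E.
  have [_ ->] := FT j; set k := (k0 + j)%N.
  pose kp : R := k.+1%:R `^ (- p).
  have kp0 : 0 <= kp by exact: powR_ge0.
  apply: (@le_trans _ _ ((a j)%:E * \int[leb2]_(w in V) (kp%:E * (g j w)%:E)))%E.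
    apply: lee_wpmul2l => //; apply: ge0_le_integralW => // w Vw.
    - by rewrite mule_ge0 ?lee_fin ?dens_ge0.
    - by apply: mule_ge0 (g0 _ _); rewrite lee_fin.
    apply: le_trans (lee_wpmul2l _ (slice k w)) _; first by rewrite lee_fin dens_ge0.
    by rewrite -!EFinM lee_fin /g -/k -/kp le_eqVlt; apply/orP; left; apply/eqP; ring.
  rewrite ge0_integralZl// ?lee_fin// muleA -EFinM.
  rewrite -[leRHS]mul1e; apply: lee_wpmul2r; first exact: integral_ge0.
  have k1 : 0 < k.+1%:R `^ p :> R by rewrite powR_gt0// ltr0n.
  rewrite lee_fin /a /kp powRN ler_pdivrMr// mul1r ge0_ler_powR ?nnegrE ?(ltW p0)//.
  by rewrite ler_nat ltnS leq_addl.
pose d w := (dens p df w * (1 - modulus (cplx w) ^+ 2) `^ s)%:E.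
have d0 w : (0 <= d w)%E by rewrite lee_fin mulr_ge0 ?dens_ge0 ?powR_ge0.
have mdd : measurable_fun V d.
  apply/measurable_EFinP; apply: measurable_funM => //.
  apply: measurable_funS (@measurable_disk R) _ _; first by move=> w [].
  exact: measurable_disk_weight.
(* At a fixed [w] the factors (2^-k)^s of the few rings that contain it add up to a multiple of
   (1-|w|)^s, the weight that [energy_ball] integrates. *)
have step3 : (\sum_(0 <= j <oo) ((a j)%:E * \int[mu]_(z in B) T j z) <=
    (K * c2)%:E * \int[leb2]_(w in V) d w)%E.
  apply: (@le_trans _ _ (\sum_(0 <= j <oo) \int[leb2]_(w in V) (g j w)%:E))%E.
    apply: lee_nneseries => [j _ _|j _]; last exact: step2.
    by rewrite mule_ge0// integral_ge0.
  rewrite -integral_nneseries// -ge0_integralZl//; last by rewrite lee_fin mulr_ge0// ltW.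
  apply: ge0_le_integralW => // w Vw.
  - exact: nneseries_ge0.
  - by rewrite mule_ge0// lee_fin mulr_ge0// ltW.
  have [wd _] := Vw; have w1 : modulus (cplx w) < 1 by [].
  apply: lime_le; first exact: is_cvg_nneseries.
  apply: nearW => n /=; rewrite sumEFin lee_fin.
  have -> : \sum_(0 <= j < n) g j w = K * (dens p df w *
      \sum_(0 <= j < n) ((2 ^- (k0 + j)) `^ s * \1_(W (k0 + j)%N) w)).
    by rewrite 2!mulr_sumr.
  rewrite -[leRHS]mulrA ler_wpM2l// mulrCA ler_wpM2l ?dens_ge0//.
  have x0 : 0 < 1 - modulus (cplx w) by rewrite subr_gt0.
  have h := Hsum _ k0 n x0.
  rewrite big_mkord; apply: (@le_trans _ _ (c2 * (1 - modulus (cplx w)) `^ s)).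
    apply: le_trans h; rewrite le_eqVlt; apply/orP; left; apply/eqP.
    apply: eq_bigr => j _; rewrite indicE; case: ifPn => hj.
      by rewrite mem_set// mulr1.
    by rewrite memNset ?mulr0//= => hj'; rewrite hj' in hj.
  rewrite ler_wpM2l ?(ltW c20)// ge0_ler_powR ?nnegrE ?(ltW s0) ?(ltW x0)//.
    exact: ltW (one_sub_sqr_modulus_gt0 wd).
  by rewrite lerB// expr2 ler_piMr ?modulus_ge0// ltW.
have EB := energy_ball k0 s0 hf HL z1; rewrite -/e -/V -QE in EB.
apply: le_trans step1 _.
(* The mass of [B] carries (k0+1)^-p, which cancels the weight of [L] in [A]. *)
have hA : (A%:E * mu B <= (K * e `^ s * (modulus (f 0) `^ p + L))%:E)%E.
  apply: le_trans (lee_wpmul2l _ muB) _; first by rewrite lee_fin.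
  rewrite -EFinM lee_fin mulrCA ler_wpM2l ?mulr_ge0 ?powR_ge0// /A mulrDl.
  have k1 : 0 < k0.+1%:R `^ p :> R by rewrite powR_gt0// ltr0n.
  rewrite powRN; apply: lerD; last by rewrite mulrAC divff ?gt_eqF// mul1r.
  rewrite ler_pdivrMr// ler_peMr ?powR_ge0//.
  have one_p : 1 = 1 `^ p :> R by rewrite powR1.
  by rewrite [leLHS]one_p ge0_ler_powR ?nnegrE ?(ltW p0)// ler1n.
have hS : (\sum_(0 <= j <oo) ((a j)%:E * \int[mu]_(z in B) T j z) <=
    (K * e `^ s * (c2 * (pi * Q `^ s) * L))%:E)%E.
  apply: le_trans step3 _; apply: le_trans (lee_wpmul2l _ EB) _.
    by rewrite lee_fin mulr_ge0// ltW.
  by rewrite -EFinM lee_fin le_eqVlt; apply/orP; left; apply/eqP; ring.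
apply: le_trans (lee_wpmul2l _ (leeD hA hS)) _; first by rewrite lee_fin ltW.
rewrite -EFinD -EFinM lee_fin -mulrDr.
rewrite (_ : c1 * c * K * e `^ s * (modulus (f 0) `^ p + L) =
  c1 * (K * e `^ s * (c * (modulus (f 0) `^ p + L)))); last by ring.
rewrite ler_wpM2l ?(ltW c10)// ler_wpM2l ?mulr_ge0 ?powR_ge0// /c.
rewrite [leRHS]mulrDl mul1r lerD//.
rewrite ler_wpM2l ?mulr_ge0 ?powR_ge0 ?(ltW c20) ?(ltW pi0)// lerDr powR_ge0//.
Qed.

End embedding.

(** * Arcs and Carleson boxes *)

Section circle.
Context {R : realType}.
Implicit Types (t x y h : R) (I : circle_arc R) (w : plane R) (z zeta u : R[i]).

Local Notation cp := (@circle_pt R : R -> R[i]).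

Lemma pi_lt4 : pi < 4 :> R.
Proof. have := @pihalf_lt2 R; lra. Qed.

Lemma sin_lipschitz x y : `|sin x - sin y| <= `|x - y|.
Proof.
wlog yx : x y / y <= x => [H|].
  have [|/ltW xy] := leP y x; first exact: H.
  by rewrite distrC [leRHS]distrC; exact: H.
have [|c _ ->] := @MVT_segment R sin cos y x yx.
  by apply: continuous_subspaceT; exact: continuous_sin.
by rewrite normrM ler_piMl ?cos_max.
Qed.

Lemma cos_lipschitz x y : `|cos x - cos y| <= `|x - y|.
Proof.
rewrite -!sinDpihalf (le_trans (sin_lipschitz _ _))//.
by rewrite opprD addrACA subrr addr0.
Qed.

Lemma ler_cos x y : 0 <= x -> x <= y -> y <= pi -> cos y <= cos x.
Proof.
move=> x0 xy yp; have [->//|/eqP xny] := eqVneq x y.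
by apply: ltW; rewrite ltr_cos ?in_itv /=; lra.
Qed.

(** The mean value theorem gives sin y >= cos 1 * y on [0, 1]; beyond 1, sin is still at least sin 1
    >= cos 1 and y < 2. *)
Lemma sin_ge_linear y : 0 <= y <= pi / 2 -> cos 1 / 2 * y <= sin y.
Proof.
move=> /andP[y0 yp]; have c1 := @cos1_gt0 R; have := @pihalf_lt2 R => p2.
have p1 := @pihalf_ge1 R; have ppi := @pi_gt0 R.
have small x : 0 <= x <= 1 -> cos 1 * x <= sin x.
  move=> /andP[x0 x1]; have [|c cx] := @MVT_segment R sin cos 0 x x0.
    by apply: continuous_subspaceT; exact: continuous_sin.
  rewrite sin0 !subr0 => ->; rewrite ler_wpM2r//.
  move: cx; rewrite in_itv /= => /andP[c0 cx].
  by apply: ler_cos => //; lra.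
have [y1|y1] := leP y 1.
  by apply: le_trans (small y _); [rewrite -mulrA mulrCA ler_piMl ?mulr_ge0// ?(ltW c1)//; lra|lra].
have : sin 1 <= sin y.
  by apply: ltW; rewrite ltr_sin ?in_itv /=; lra.
have := small 1 ltac:(by rewrite ler01 lexx); nra.
Qed.

Lemma circle_ptD t1 t2 : cp (t1 + t2) = cp t1 * cp t2.
Proof.
rewrite /circle_pt mulrDr cosD sinD; apply/eqP; rewrite eq_complex /=.
by apply/andP; split; apply/eqP; ring.
Qed.

Lemma modulus_circle_pt t : modulus (cp t) = 1.
Proof.
by apply/eqP; rewrite -sqrp_eq1 ?modulus_ge0// sqr_modulus /= cos2Dsin2.
Qed.

Lemma circle_ptN t : cp (- t) = (cp t)^*%C.
Proof. by rewrite /circle_pt mulrN cosN sinN. Qed.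

(** Two coordinates, each 2 pi-Lipschitz, and pi < 4. *)
Lemma circle_pt_dist t1 t2 : modulus (cp t1 - cp t2) <= 16 * `|t1 - t2|.
Proof.
rewrite (le_trans (modulus_le_ReIm _))//= (le_trans (lerD (cos_lipschitz _ _) (sin_lipschitz _ _)))//.
rewrite -mulrBr normrM ger0_norm ?mulr_ge0 ?pi_ge0//.
have := pi_lt4; have := normr_ge0 (t1 - t2); nra.
Qed.

(** After a rotation the chord is exactly 2 sin (pi |x|), with pi |x| <= pi/2. *)
Lemma circle_pt_dist_ge t1 t2 : `|t1 - t2| <= 2^-1 ->
  2 * cos 1 * `|t1 - t2| <= modulus (cp t1 - cp t2).
Proof.
set x := t1 - t2 => xh; have c1 := @cos1_gt0 R; have pi2 := @pi_ge2 R.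
have -> : modulus (cp t1 - cp t2) = modulus (cp x - 1).
  rewrite -[RHS]mulr1 -(modulus_circle_pt t2) -modulusM mulrBl mul1r -circle_ptD.
  by rewrite /x subrK.
have y0 : 0 <= pi * `|x| <= pi / 2.
  by rewrite mulr_ge0 ?pi_ge0//= ler_pM2l ?pi_gt0.
have sy := sin_ge_linear y0; set y := pi * `|x| in sy y0.
have s0 : 0 <= sin y by apply: le_trans sy; rewrite !mulr_ge0 ?pi_ge0// ltW.
have -> : modulus (cp x - 1) = 2 * sin y.
  apply/eqP; rewrite -(eqrXn2 (ltn0Sn 1)) ?modulus_ge0 ?mulr_ge0//; apply/eqP.
  rewrite sqr_modulus /=.
  have -> : cos (2 * pi * x) = cos (y *+ 2).
    rewrite -cos_norm normrM ger0_norm ?mulr_ge0 ?pi_ge0// /y mulr2n; congr cos; ring.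
  have h := cos2Dsin2 (2 * pi * x).
  have {h} : sin (2 * pi * x) ^+ 2 = 1 - cos (y *+ 2) ^+ 2.
    rewrite sin2cos2; congr (1 - _ ^+ 2).
    by rewrite -cos_norm normrM ger0_norm ?mulr_ge0 ?pi_ge0// /y mulr2n; congr cos; ring.
  rewrite cos_mulr2n subr0 => ->; rewrite cos2sin2; ring.
have : 2 * cos 1 * `|x| <= cos 1 * y.
  by rewrite [_ * cos 1]mulrC -mulrA ler_wpM2l ?(ltW c1)// ler_wpM2r.
lra.
Qed.

(** The parameter is taken within half a turn of [t0], where chord and arc are comparable by
    [circle_pt_dist_ge]. *)
Lemma circle_pt_surj z t0 : modulus z = 1 ->
  exists2 t, `|t - t0| <= 2^-1 & z = cp t.
Proof.
move=> z1; have ppi := @pi_gt0 R.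
suff [t t2 tE] : exists2 t, `|t| <= 2^-1 & z * cp (- t0) = cp t.
  exists (t + t0); first by rewrite addrK.
  by rewrite circle_ptD -tE -mulrA -circle_ptD addNr /circle_pt mulr0 cos0 sin0 mulr1.
have := modulusM z (cp (- t0)); rewrite z1 modulus_circle_pt mulr1.
move: (z * _) => [x y] m1; have m2 : x ^+ 2 + y ^+ 2 = 1.
  by have := sqr_modulus (x +i* y); rewrite m1 expr1n.
have xb : -1 <= x <= 1 by apply/andP; split; nra.
have a0 := acos_ge0 xb; have api := acos_lepi xb.
have hc : cos (acos x) = x by rewrite acosK// in_itv.
have hs : sin (acos x) = `|y|.
  rewrite sin_acos// (_ : 1 - x ^+ 2 = y ^+ 2) ?sqrtr_sqr//; lra.
have e (v : R) : 2 * pi * (v / (2 * pi)) = v.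
  by rewrite mulrC divfK// mulf_neq0 ?(lt0r_neq0 ppi).
have half (v : R) : `|v| <= pi -> `|v / (2 * pi)| <= 2^-1.
  by move=> hv; rewrite normrM normfV (gtr0_norm (mulr_gt0 _ ppi))// ler_pdivrMr ?mulr_gt0//; lra.
have [y0|y0] := leP 0 y.
  exists (acos x / (2 * pi)); first by apply: half; rewrite ger0_norm.
  by rewrite /circle_pt e hc hs ger0_norm.
exists ((- acos x) / (2 * pi)); first by apply: half; rewrite normrN ger0_norm.
by rewrite /circle_pt e cosN sinN hc hs ltr0_norm// opprK.
Qed.

End circle.

Section boxes.
Context {R : realType}.
Implicit Types (t x y h : R) (I : circle_arc R) (w : plane R) (z zeta u : R[i]).

Local Notation cp := (@circle_pt R : R -> R[i]).

Definition arc_mid I : R[i] := cp (arc_start I + arc_len I / 2).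

Lemma unit_polar z u : z != 0 -> u = z / (modulus z)%:C ->
  modulus u = 1 /\ z = (modulus z)%:C * u.
Proof.
move=> z0 ->; have m0 : modulus z != 0 by rewrite modulus_eq0.
have mC : (modulus z)%:C != 0 :> R[i] by rewrite eq_complex /= negb_and m0.
split; last by rewrite mulrC divfK.
by rewrite modulusM modulusV modulusC ger0_norm ?modulus_ge0// divff.
Qed.

Lemma pdisk_neq0 w : pdisk w -> cplx w != 0 :> R[i].
Proof. by rewrite /pdisk /= => /andP[w0 _]; rewrite -modulus_eq0 gt_eqF. Qed.

Lemma box_pdisk I : carleson_box I `<=` @pdisk R.
Proof.
move=> w [/andP[h1 h2] _]; apply/andP; split => //.
by apply: le_lt_trans h1; rewrite subr_ge0 arc_len_le1.
Qed.

Lemma radial_dist z u : z = (modulus z)%:C * u -> modulus u = 1 -> modulus z <= 1 ->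
  modulus (u - z) = 1 - modulus z.
Proof.
move=> zE u1 z1; have -> : u - z = (1 - modulus z)%:C * u.
  by rewrite {1}zE rmorphB rmorph1 mulrBl mul1r.
by rewrite modulusM modulusC u1 mulr1 ger0_norm ?subr_ge0.
Qed.

(** Half of the arc costs 16 * |I|/2 along the circle, and the radial distance is less than |I|. *)
Lemma box_near I w : carleson_box I w -> near_pt (arc_mid I) (9 * arc_len I) w.
Proof.
move=> bw; have wp := box_pdisk bw; have w0 := pdisk_neq0 wp.
have [/andP[h1 h2] [t tI tE]] := bw.
have [u1 zE] := unit_polar w0 tE.
have d1 := radial_dist zE u1 (ltW h2).
have L0 := arc_len_gt0 I.
have d2 : modulus (arc_mid I - cp t) <= 8 * arc_len I.
  apply: le_trans (circle_pt_dist _ _) _.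
  suff : `|arc_start I + arc_len I / 2 - t| <= arc_len I / 2 by lra.
  move: tI; rewrite /arc_param /= in_itv /= => /andP[/lteifW t1 /lteifW t2].
  by rewrite ler_norml; apply/andP; split; lra.
have tri (a b c : R[i]) : modulus (a - c) <= modulus (a - b) + modulus (b - c).
  by rewrite -(subrKA b) modulusD.
rewrite /near_pt /=; apply: le_lt_trans (tri _ (cp t) _) _.
rewrite d1; move: h1 d2; lra.
Qed.

(** The number [m] satisfies 32 * 2^-m < cos 1, so that a chord of length at most 32 * 2^-k subtends
    at most half of an arc of length 2^-(k-m). The subtraction is truncated: for k <= m the arc is
    the full circle. *)
Lemma near_box : exists m, forall zeta k, modulus zeta = 1 -> exists I : circle_arc R,
  [/\ arc_len I = 2 ^- (k - m), arc_mid I = zeta &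
      @pdisk R `&` near_pt zeta (16 * 2 ^- k) `<=` carleson_box I].
Proof.
have c1 := @cos1_gt0 R; have c1le := @cos_le1 R 1.
have [m hm] := @pow2V_small R (cos 1 / 32) ltac:(by rewrite divr_gt0).
exists m => zeta k z1; have [t0 _ ->] := circle_pt_surj 0 z1.
have [l lE] : exists l : R, l = 2 ^- (k - m) by eexists.
have L0 : 0 < l by rewrite lE; exact: pow2V_gt0.
have L1 : l <= 1 by rewrite lE invf_le1 ?exprn_gt0// exprn_ege1// ler1n.
exists (@CircleArc _ (t0 - l / 2) l true true L0 L1); split => //.
  by rewrite /arc_mid /= subrK.
move=> w [wp wn]; have w0 := pdisk_neq0 wp.
have [u1 zE] := unit_polar w0 erefl; set u := cplx w / _ in u1 zE.
have /andP[w0' w1] := wp.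
have d1 := radial_dist zE u1 (ltW w1).
have [t tt0 tE] := circle_pt_surj t0 u1.
have wn' : modulus (cp t0 - (cplx w : R[i])) < 16 * 2 ^- k := wn.
have tri (a b c : R[i]) : modulus (a - c) <= modulus (a - b) + modulus (c - b).
  by rewrite (modulusB c) -(subrKA b) modulusD.
have w1' : 1 - modulus (cplx w) <= modulus (cp t0 - (cplx w : R[i])).
  have := modulus_dist (cp t0) (cplx w); rewrite modulus_circle_pt.
  by apply: le_trans; exact: ler_norm.
have tb := circle_pt_dist_ge tt0.
have h3 : modulus (cp t - cp t0) <= 32 * 2 ^- k.
  rewrite -tE; apply: le_trans (tri _ (cplx w : R[i]) _) _.
  rewrite d1; move: w1' wn'; lra.
have e0 : 0 < 2 ^- k :> R by exact: pow2V_gt0.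
(* With l = 1 the angular condition is met by any parameter within half a turn, and the radial one
   is |w| > 0. *)
have [km|km] := leqP k m.
  have l1 : l = 1.
    by rewrite lE (_ : (k - m)%N = 0%N) ?expr0 ?invr1//; apply/eqP; rewrite subn_eq0.
  split => /=; first by rewrite l1 subrr; apply/andP.
  exists t; last by rewrite -tE.
  rewrite /arc_param /= in_itv /= l1.
  by move: tt0; rewrite ler_norml => /andP[]; lra.
have kE : 2 ^- k = l * 2 ^- m :> R.
  by rewrite lE -invfM -exprD subnK// ltnW.
split => /=.
  apply/andP; split => //; suff : 16 * 2 ^- k <= l :> R by move: w1' wn'; lra.
  by rewrite kE; nra.
exists t; last by rewrite -tE.
suff : `|t - t0| <= l / 2.
  by rewrite /arc_param /= in_itv /= ler_norml => /andP[h4 h5]; apply/andP; split; lra.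
rewrite -(ler_pM2l (_ : 0 < 2 * cos 1)) ?mulr_gt0//.
apply: le_trans tb _; apply: le_trans h3 _; rewrite kE; nra.
Qed.

(** Describes the arc without parameters, as needed for the measurability of the box: its interior
    is a cap around the midpoint, and each endpoint is added when it belongs to the arc. For length
    1 the cap omits only the point opposite to the midpoint. *)
Lemma arc_setE I u : modulus u = 1 -> arc_set I u <->
  [\/ cos (pi * arc_len I) < Re (u * (arc_mid I)^*%C),
      arc_lclosed I /\ u = cp (arc_start I) |
      arc_rclosed I /\ u = cp (arc_start I + arc_len I)].
Proof.
move=> u1; have L0 := arc_len_gt0 I; have L1 := arc_len_le1 I.
have ppi := @pi_gt0 R; set L := arc_len I in L0 L1 *.
have cE : (arc_mid I)^*%C = cp (- (arc_start I + L / 2)) by rewrite circle_ptN.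
have ReE t : Re (cp (t - (arc_start I + L / 2))) = cos (2 * pi * `|t - (arc_start I + L / 2)|).
  rewrite /= -cos_norm normrM (ger0_norm (_ : 0 <= 2 * pi))//.
  by rewrite mulr_ge0 ?pi_ge0.
split=> [[t tI <-]|[h|[cl ->]|[cr ->]]].
- have tI' : t \in arc_param I := tI.
  rewrite /arc_param in_itv /= -/L in tI'; have /andP[t1 t2] := tI'.
  have [ts|/eqP ts] := eqVneq t (arc_start I).
    by constructor 2; split; [move: t1; rewrite ts lteifxx|rewrite ts].
  have [te|/eqP te] := eqVneq t (arc_start I + L).
    constructor 3; split; [move: t2; rewrite te lteifxx|by rewrite te].
    by rewrite negbK.
  have t1' : arc_start I < t by rewrite lt_neqAle (lteifW t1) andbT eq_sym; apply/eqP.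
  have t2' : t < arc_start I + L by rewrite lt_neqAle (lteifW t2) andbT; apply/eqP.
  constructor 1; rewrite cE -circle_ptD ReE.
  have tn : 2 * `|t - (arc_start I + L / 2)| < L.
    rewrite -ltr_pdivlMl// ltr_norml; apply/andP; split; lra.
  set d := `|_| in tn *; have d0 : 0 <= d by exact: normr_ge0.
  rewrite ltr_cos ?in_itv /=.
  - by rewrite mulrAC [ltLHS]mulrC ltr_pM2l.
  - by apply/andP; split; nra.
  - by apply/andP; split; nra.
- have m1 : modulus (u * (arc_mid I)^*%C) = 1.
    by rewrite modulusM u1 modulus_conj modulus_circle_pt mulr1.
  have [tau t2 tE] := circle_pt_surj 0 m1; rewrite subr0 in t2.
  have uE : u = cp (tau + (arc_start I + L / 2)).
    rewrite circle_ptD -tE -mulrA cE -circle_ptD addNr.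
    by rewrite /circle_pt mulr0 cos0 sin0 mulr1.
  exists (tau + (arc_start I + L / 2)) => //.
  have tn : 2 * `|tau| < L.
    rewrite ltNge; apply/negP => tL.
    have hc : cos (2 * pi * `|tau|) <= cos (pi * L).
      by apply: ler_cos; nra.
    have := ReE (tau + (arc_start I + L / 2)); rewrite addrK -tE => h'.
    by rewrite h' in h; move: hc; rewrite leNgt h.
  move: tn; rewrite -ltr_pdivlMl// ltr_norml => /andP[h1 h2].
  rewrite /arc_param /= in_itv /=; apply/andP; split; apply: lteifS.
    by rewrite -/L; lra.
  by rewrite -/L; lra.
- exists (arc_start I) => //; rewrite /arc_param /= in_itv /= cl /= lexx /= -/L.
  by apply: lteifS; rewrite ltrDl.
- exists (arc_start I + L) => //; rewrite /arc_param /= in_itv /= cr /= -/L lexx andbT.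
  by apply: lteifS; rewrite ltrDl.
Qed.

Lemma measurable_linear_gt (a c : R) (b : R) :
  measurable [set w : plane R | c * modulus (cplx w) < w.1 * a + w.2 * b].
Proof.
pose F (w : plane R) := (w.1 * a + w.2 * b) - c * modulus (cplx w).
have mF : measurable_fun setT F.
  apply: measurable_funB.
    by apply: measurable_funD; apply: measurable_funM.
  by apply: measurable_funM => //; exact: measurable_modulus.
have := mF measurableT `]0, +oo[%classic (measurable_itv _).
rewrite setTI; congr measurable; apply/seteqP; split => w /=;
  by rewrite in_itv /= andbT /F subr_gt0.
Qed.

(** Multiplying the conditions of [arc_setE] by |w| removes the division and leaves inequalities
    between |w| and linear forms. *)
Lemma measurable_box I : measurable (carleson_box I).
Proof.
pose O u c : set (plane R) := [set w | c * modulus (cplx w) < w.1 * Re u + w.2 * Im u].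
have mO u c : measurable (O u c) by exact: measurable_linear_gt.
(* For a unit vector [u] this is the equality case of the Cauchy-Schwarz inequality, that is, w/|w|
   = u. *)
pose P u : set (plane R) := [set w | w.1 * Re u + w.2 * Im u >= modulus (cplx w)].
have mP u : measurable (P u).
  rewrite (_ : P u = ~` [set w : plane R | -1 * modulus (cplx w) < w.1 * (- Re u) + w.2 * (- Im u)]).
    by apply: measurableC; exact: measurable_linear_gt.
  by apply/seteqP; split => w; rewrite /P /= => h; [apply/negP|move/negP: h]; rewrite -leNgt; lra.
have ReM u v : Re (u * v^*%C) = Re u * Re v + Im u * Im v.
  by case: u v => [a b] [c d] /=; ring.
have OE u c w : pdisk w -> O u c w <-> c < Re ((cplx w / (modulus (cplx w))%:C : R[i]) * u^*%C).
  move=> /andP[w0 _].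
  have -> : Re ((cplx w / (modulus (cplx w))%:C : R[i]) * u^*%C) =
      (w.1 * Re u + w.2 * Im u) / modulus (cplx w).
    have -> : (modulus (cplx w))%:C^-1 = ((modulus (cplx w))^-1)%:C :> R[i] by rewrite fmorphV.
    by rewrite ReM /cplx /=; ring.
  by rewrite ltr_pdivlMr.
have PE u w : pdisk w -> modulus u = 1 -> P u w <-> (cplx w / (modulus (cplx w))%:C : R[i]) = u.
  move=> wp u1; have /andP[w0 _] := wp; have wn := pdisk_neq0 wp.
  have [v1 zE] := unit_polar wn erefl; set v := _ / _ in v1 zE *.
  have key : P u w <-> 1 <= Re (v * u^*%C).
    have -> : Re (v * u^*%C) = (w.1 * Re u + w.2 * Im u) / modulus (cplx w).
      have -> : v = cplx w * ((modulus (cplx w))^-1)%:C by rewrite fmorphV.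
      by rewrite ReM /cplx /=; ring.
    by rewrite ler_pdivlMr// mul1r.
  rewrite key; split=> [h|->]; last first.
    by rewrite ReM -!expr2 -sqr_modulus u1 expr1n.
  apply/eqP; rewrite -subr_eq0 -modulus_eq0 -sqrf_eq0 eq_le sqr_ge0 andbT sqr_modulus.
  have := sqr_modulus u; have := sqr_modulus v; rewrite u1 v1 ReM in h *.
  by move: h; case: (u) => a b; case: (v) => c d /=; rewrite !expr2; lra.
have sub : carleson_box I =
  [set w : plane R | modulus (cplx w) \in `]1 - arc_len I, 1[] `&`
  (O (arc_mid I) (cos (pi * arc_len I)) `|`
   ((if arc_lclosed I then P (cp (arc_start I)) else set0) `|`
    (if arc_rclosed I then P (cp (arc_start I + arc_len I)) else set0))).
  have L1 := arc_len_le1 I.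
  apply/seteqP; split => w.
    move=> bw; have wp := box_pdisk bw; have w0 := pdisk_neq0 wp.
    have [v1 zE] := unit_polar w0 erefl; have [b1 b2] := bw.
    split; first by rewrite /= in_itv.
    have /(arc_setE I v1)[h|[cl h]|[cr h]] := b2.
    - by left; apply/OE.
    - by right; left; rewrite cl; apply/PE; rewrite ?modulus_circle_pt.
    - by right; right; rewrite cr; apply/PE; rewrite ?modulus_circle_pt.
  move=> [] /=; rewrite in_itv /= => /andP[h1 h2] H.
  have wp : pdisk w by apply/andP; split => //; lra.
  have w0 := pdisk_neq0 wp; have [v1 zE] := unit_polar w0 erefl.
  split; first by apply/andP.
  apply/(arc_setE I v1); case: H => [/OE h|[|]].
  - by constructor 1; exact: h.
  - case: ifP => // cl /PE h; constructor 2; split => //.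
    by apply: h => //; rewrite modulus_circle_pt.
  - case: ifP => // cr /PE h; constructor 3; split => //.
    by apply: h => //; rewrite modulus_circle_pt.
rewrite sub; apply: measurableI; first exact: measurable_modulus_itv.
by apply: measurableU => //; apply: measurableU; case: ifP.
Qed.

End boxes.

(** * From boxes to dyadic balls and back *)

Section box_embedding.
Context {R : realType}.
Implicit Types (I : circle_arc R) (w : plane R) (z zeta u : R[i]) (f df : R[i] -> R[i]).
Implicit Types (mu : {measure set (plane R) -> \bar R}).

Lemma ln2_gt0 : 0 < ln 2 :> R.
Proof. by rewrite ln_gt0// ltr1n. Qed.

Lemma ln_arc_gt0 I : 0 < ln (2 / arc_len I).
Proof.
rewrite ln_gt0// ltr_pdivlMr ?arc_len_gt0// mul1r.
by apply: le_lt_trans (arc_len_le1 I) _; rewrite ltr1n.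
Qed.

Lemma ratio_box (p s : R) mu I (K : R) :
  (log_carleson_ratio p s mu I <= K%:E)%E <->
  (mu (carleson_box I) <= (K * arc_len I `^ s * ln (2 / arc_len I) `^ (- p))%:E)%E.
Proof.
have l0 : 0 < arc_len I `^ s by rewrite powR_gt0 ?arc_len_gt0.
have l1 : 0 < ln (2 / arc_len I) `^ p by rewrite powR_gt0 ?ln_arc_gt0.
rewrite /log_carleson_ratio powRN.
set a := _ `^ s in l0 *; set b := _ `^ p in l1 *.
have ab : 0 < a^-1 * b by rewrite mulr_gt0 ?invr_gt0.
rewrite -(lee_pdivlMl _ _ ab) -EFinM invfM invrK.
by rewrite (_ : a / b * K = K * a / b)//; ring.
Qed.

(** Replacing the scale k by k - m, as [near_box] does, costs 2^(ms) in the power and a factor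
    depending only on m in the logarithm. *)
Lemma pdisk_bound_of_boxes (p s : R) : 0 < p -> 0 < s -> exists2 c : R, 0 < c &
  forall mu K, 0 <= K -> (forall I, (log_carleson_ratio p s mu I <= K%:E)%E) ->
  pdisk_bound mu p s (c * K).
Proof.
move=> p0 s0; have [m Hm] := @near_box R.
pose q : R := 2 ^+ m; have q0 : 0 < q by rewrite exprn_gt0.
have ln2 := ln2_gt0.
(* Chosen because (k - m) + 1 >= (k + 1)/(m + 1), also for the truncated subtraction. *)
pose d : R := ln 2 / m.+1%:R; have d0 : 0 < d by rewrite divr_gt0.
exists (q `^ s * d `^ (- p)) => [|mu K K0 HK zeta k z1]; first by rewrite mulr_gt0 ?powR_gt0.
have [I [IL Imid sub]] := Hm zeta k z1.
apply: le_trans (le_measure _ _ _ sub) _; rewrite ?inE.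
- by apply: measurableI; [exact: measurable_pdisk|exact: measurable_near_pt].
- exact: measurable_box.
apply: le_trans ((ratio_box p s mu I K).1 (HK I)) _; rewrite lee_fin.
have h1 : arc_len I `^ s <= q `^ s * (2 ^- k) `^ s.
  have e0 := @pow2V_gt0 R k.
  rewrite -powRM ?(ltW q0) ?(ltW e0)//; apply: ge0_ler_powR; rewrite ?nnegrE ?(ltW s0) ?(ltW (arc_len_gt0 I))//.
    by rewrite mulr_ge0// ltW.
  rewrite IL; have [km|km] := leqP m k.
    by rewrite -{2}(subnK km) exprD invfM mulrCA divff ?gt_eqF// mulr1.
  rewrite (_ : (k - m)%N = 0%N); last by apply/eqP; rewrite subn_eq0 ltnW.
  rewrite expr0 invr1 ler_pdivlMr ?exprn_gt0// mul1r.
  by rewrite ler_weXn2l ?ler1n// ltnW.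
have lnI : ln (2 / arc_len I) = (k - m).+1%:R * ln 2.
  by rewrite IL invrK -exprS lnXn// mulr_natl.
have h2 : ln (2 / arc_len I) `^ (- p) <= d `^ (- p) * k.+1%:R `^ (- p).
  have dk : d * k.+1%:R <= ln (2 / arc_len I).
    have -> : d * k.+1%:R = (k.+1%:R / m.+1%:R) * ln 2 by rewrite /d; ring.
    rewrite lnI ler_wpM2r ?(ltW ln2)// ler_pdivrMr ?ltr0n// -natrM ler_nat.
    have [km|/ltnW km] := leqP m k.
      by rewrite -{1}(subnK km); nia.
    by rewrite (_ : (k - m)%N = 0%N) ?mul1n ?ltnS//; apply/eqP; rewrite subn_eq0.
  have dk0 : 0 < d * k.+1%:R by rewrite mulr_gt0 ?ltr0n.
  rewrite -powRM ?(ltW d0)// !powRN lef_pV2 ?posrE ?powR_gt0 ?ln_arc_gt0//.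
  by apply: ge0_ler_powR; rewrite ?nnegrE ?(ltW p0) ?(ltW dk0) ?(ltW (ln_arc_gt0 _)).
have p1 : 0 <= ln (2 / arc_len I) `^ (- p) by exact: powR_ge0.
have -> : q `^ s * d `^ (- p) * K * (2 ^- k) `^ s * k.+1%:R `^ (- p) =
  K * ((q `^ s * (2 ^- k) `^ s) * (d `^ (- p) * k.+1%:R `^ (- p))) by ring.
by rewrite -mulrA ler_wpM2l// ler_pM// powR_ge0.
Qed.

Lemma dyadic_scale (l : R) : 0 < l -> l <= 1 -> exists2 k, 2 ^- k / 2 < l & l <= 2 ^- k.
Proof.
move=> l0 l1; have [N hN] := pow2V_small l0.
have [|k hk kmin] := @ex_minnP (fun k => 2 ^- k < l); first by exists N.
case: k => [|k] in hk kmin *.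
  by exists 0%N; rewrite expr0 invr1 // in hk *; lra.
exists k; first by rewrite -pow2VS.
by rewrite leNgt; apply/negP => /kmin; rewrite ltnn.
Qed.

Lemma box_embedding (p s : R) : 0 < p -> 0 < s -> exists2 c : R, 0 < c &
  forall mu K f df L I, 0 <= K -> (forall I, (log_carleson_ratio p s mu I <= K%:E)%E) ->
  holo f df -> energy_le p s df L ->
  (((arc_len I `^ s)^-1)%:E * \int[mu]_(w in carleson_box I) (modulus (f (cplx w)) `^ p)%:E <=
   (c * K * (modulus (f 0) `^ p + L))%:E)%E.
Proof.
move=> p0 s0; have [c1 c10 H1] := pdisk_bound_of_boxes p0 s0.
have [c2 c20 H2] := embedding p0 s0.
exists (c2 * c1 * 2 `^ s) => [|mu K f df L I K0 HK hf HL]; first by rewrite !mulr_gt0 ?powR_gt0.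
set l := arc_len I; have l0 : 0 < l := arc_len_gt0 I; have l1 : l <= 1 := arc_len_le1 I.
have ls : 0 < l `^ s by rewrite powR_gt0.
have [k lk1 lk2] := dyadic_scale l0 l1.
have z1 : modulus (arc_mid I) = 1 by exact: modulus_circle_pt.
have sub : carleson_box I `<=` @pdisk R `&` near_pt (arc_mid I) (16 * 2 ^- k).
  move=> w bw; split; first exact: box_pdisk bw.
  by apply: lt_le_trans (box_near bw) _; rewrite -/l; lra.
have := H2 mu (c1 * K) f df L _ k (mulr_ge0 (ltW c10) K0) (H1 mu K K0 HK) hf HL z1.
set X := _ + L; have X0 : 0 <= X by rewrite addr_ge0 ?powR_ge0// (energy_le_ge0 HL).
move=> H3; have {}H3 : (\int[mu]_(w in carleson_box I) (modulus (f (cplx w)) `^ p)%:E <=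
    (c2 * (c1 * K) * (2 ^- k) `^ s * X)%:E)%E.
  apply: le_trans H3; apply: ge0_le_integralW => // w _; by rewrite lee_fin powR_ge0.
apply: le_trans (lee_wpmul2l _ H3) _; first by rewrite lee_fin invr_ge0 ltW.
rewrite -EFinM lee_fin ler_pdivrMl//.
have h : (2 ^- k) `^ s <= 2 `^ s * l `^ s.
  rewrite -powRM ?(ltW l0)//; have e0 := @pow2V_gt0 R k.
  by apply: ge0_ler_powR; rewrite ?nnegrE ?(ltW s0) ?mulr_ge0 ?(ltW l0) ?(ltW e0)//; lra.
have -> : l `^ s * (c2 * c1 * 2 `^ s * K * X) = c2 * (c1 * K) * (2 `^ s * l `^ s) * X by ring.
rewrite ler_wpM2r// ler_wpM2l// !mulr_ge0// ltW//.
Qed.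

End box_embedding.

(** * Test functions *)

Section dyadic.
Context {R : realType}.
Local Notation leb := (@lebesgue_measure R).
Local Notation leb2 := (leb \x leb)%E.
Implicit Types (w : plane R).

(** The layers [A j] may overlap: it is enough that each point lies in one layer whose constant
    dominates [g] there, since [g] is then below the sum over all layers. *)
Lemma dyadic_integral d (T : measurableType d) (m : {measure set T -> \bar R})
    (D : set T) (A : nat -> set T) (g h : T -> R) (c e : nat -> R) (M : R) :
  measurable D -> (forall j, measurable (A j)) -> (forall j, A j `<=` D) ->
  measurable_fun D h -> (forall z, D z -> 0 <= h z) -> (forall j, 0 <= c j) ->
  (forall z, D z -> 0 <= g z /\ exists2 j, A j z & g z <= c j * h z) ->
  (forall j, \int[m]_(z in A j) (h z)%:E <= (e j)%:E)%E ->
  (forall n, \sum_(j < n) c j * e j <= M) ->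
  (\int[m]_(z in D) (g z)%:E <= M%:E)%E.
Proof.
move=> mD mA AD mh h0 c0 Hg He HM.
have F0 j z : D z -> (0 <= (c j * (h z * \1_(A j) z))%:E)%E.
  by move=> Dz; rewrite lee_fin !mulr_ge0 ?h0// indicE.
have mF j : measurable_fun D (fun z => (c j * (h z * \1_(A j) z))%:E).
  apply/measurable_EFinP; apply: measurable_funM; first exact: measurable_cst.
  by apply: measurable_funM => //; exact: measurable_indic.
apply: (@le_trans _ _ (\int[m]_(z in D) \sum_(0 <= j <oo) (c j * (h z * \1_(A j) z))%:E))%E.
  apply: ge0_le_integralW => // z Dz.
  - by rewrite lee_fin; have [] := Hg z Dz.
  - by apply: nneseries_ge0 => j _ _; exact: F0.
  have [_ [j Aj gj]] := Hg z Dz.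
  apply: (@le_trans _ _ (\sum_(0 <= i < j.+1) (c i * (h z * \1_(A i) z))%:E)%E); last first.
    by apply: nneseries_lim_ge => i _ _; exact: F0.
  rewrite big_nat_recr//= [X in (_ <= X)%E]addeC.
  rewrite indicE mem_set// mulr1; apply: (@le_trans _ _ (c j * h z)%:E); first by rewrite lee_fin.
  by apply: leeDl; apply: sume_ge0 => i _; exact: F0.
rewrite integral_nneseries//.
apply: lime_le; first by apply: is_cvg_nneseries => j _ _; apply: integral_ge0 => z; exact: F0.
apply: nearW => n /=; rewrite big_mkord.
apply: (@le_trans _ _ (\sum_(j < n) (c j * e j)%:E)%E); last by rewrite sumEFin lee_fin.
apply: lee_sum => j _.
have -> : (\int[m]_(z in D) (c j * (h z * \1_(A j) z))%:E =
    (c j)%:E * \int[m]_(z in D) (h z * \1_(A j) z)%:E)%E.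
  rewrite -ge0_integralZl// ?lee_fin//.
  - by apply/measurable_EFinP; apply: measurable_funM => //; exact: measurable_indic.
  - by move=> z Dz; rewrite lee_fin mulr_ge0 ?h0// indicE.
have -> : (\int[m]_(z in D) (h z * \1_(A j) z)%:E = \int[m]_(z in A j) (h z)%:E)%E.
  rewrite [LHS]integral_mkcond [RHS]integral_mkcond; apply: eq_integral => z _.
  rewrite !patchE indicE; have [Az|Az] := boolP (z \in A j); last first.
    by rewrite mulr0; case: ifP.
  by rewrite mulr1 mem_set//; apply: (AD j); rewrite inE in Az.
by rewrite EFinM lee_wpmul2l ?lee_fin.
Qed.

(** Where |x| <= |y| a vertical line crosses the circle transversally. For t <= 1/2 all |y| are at
    least 1/2 and their squares differ by at most t, so the |y| differ by at most t: two intervals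
    of length 2t. For larger t the length 2 of the diameter suffices. *)
Lemma slice_measure (x t : R) (S : set R) : 0 < t -> measurable S ->
  (forall y, S y -> [/\ x ^+ 2 + y ^+ 2 <= 1, 1 - (x ^+ 2 + y ^+ 2) <= t & `|x| <= `|y|]) ->
  (leb S <= (4 * t)%:E)%E.
Proof.
move=> t0 mS HS.
have le_itv (a b : R) : a <= b -> (leb `[a, b]%classic = (b - a)%:E)%E.
  move=> ab; rewrite lebesgue_measure_itv /= lte_fin.
  case: ltP => // ba; have -> : a = b by apply/eqP; rewrite eq_le ab ba.
  by rewrite subrr.
have [t2|t2] := leP t 2^-1; last first.
  apply: (@le_trans _ _ (leb `[-1, 1]%classic)).
    apply: le_measure; rewrite ?inE//=.
    move=> y /HS[h1 _ _]; rewrite /= in_itv /=; have := sqr_ge0 x.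
    by move=> ?; apply/andP; split; nra.
  rewrite le_itv ?lee_fin; lra.
have [->|/set0P[y0 Sy0]] := eqVneq S set0; first by rewrite measure0 lee_fin mulr_ge0 ?(ltW t0).
have half y : S y -> 2^-1 <= `|y|.
  move=> /HS[_ h2 h3]; have : x ^+ 2 <= y ^+ 2.
    by rewrite -(ger0_norm (sqr_ge0 x)) -(ger0_norm (sqr_ge0 y)) !normrX lerXn2r ?nnegrE.
  move=> h4; have := normr_ge0 y; have : `|y| ^+ 2 = y ^+ 2 by rewrite real_normK// num_real.
  by rewrite !expr2 in h2 h4 *; nra.
pose I1 : set R := `[`|y0| - t, `|y0| + t]%classic.
pose I2 : set R := `[- `|y0| - t, - `|y0| + t]%classic.
apply: (@le_trans _ _ (leb (I1 `|` I2))).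
  apply: le_measure; rewrite ?inE//=.
    by apply: measurableU; exact: measurable_itv.
  move=> y Sy; have [h1 h2 h3] := HS _ Sy; have [k1 k2 k3] := HS _ Sy0.
  have hy := half _ Sy; have hy0 := half _ Sy0.
  have e1 : `|y| ^+ 2 = y ^+ 2 by rewrite real_normK// num_real.
  have e2 : `|y0| ^+ 2 = y0 ^+ 2 by rewrite real_normK// num_real.
  have b1 : `|y| <= `|y0| + t.
    by rewrite leNgt; apply/negP => H; move: e1 e2 h1 h2 k1 k2; rewrite !expr2; nra.
  have b2 : `|y0| - t <= `|y|.
    by rewrite leNgt; apply/negP => H; move: e1 e2 h1 h2 k1 k2; rewrite !expr2; nra.
  have [yp|yn] := leP 0 y.
    by left; rewrite /I1 /= in_itv /=; move: b1 b2; rewrite (ger0_norm yp) => -> ->.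
  by right; rewrite /I2 /= in_itv /=; move: b1 b2; rewrite (ltr0_norm yn) => ? ?; apply/andP; split; lra.
apply: (@le_trans _ _ (leb I1 + leb I2)%E).
  by apply: measureU2; exact: measurable_itv.
rewrite /I1 /I2 le_itv; last by lra.
rewrite le_itv; last by lra.
rewrite -EFinD lee_fin; lra.
Qed.

Lemma measurable_near_recip (u : R[i]) (r : R) : measurable [set w : plane R | modulus (1 - u * (cplx w : R[i])) < r].
Proof.
have [-> |u0] := eqVneq u 0.
  have [r1|r1] := boolP (1 < r).
    rewrite (_ : [set w | _] = setT)//; apply/seteqP; split => w //= _.
    by rewrite mul0r subr0 modulus1.
  rewrite (_ : [set w | _] = set0)//; apply/seteqP; split => w //=.
  by rewrite mul0r subr0 modulus1 (negbTE r1).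
rewrite (_ : [set w | _] = near_pt u^-1 (r / modulus u)); first exact: measurable_near_pt.
have m0 : 0 < modulus u by rewrite modulus_gt0.
apply/seteqP; split => w; rewrite /near_pt /= => h.
  rewrite ltr_pdivlMr// -modulusM mulrBl mulVf// [_ * u]mulrC//.
have -> : 1 - u * (cplx w : R[i]) = (u^-1 - (cplx w : R[i])) * u.
  by rewrite mulrBl mulVf// [_ * u]mulrC.
by rewrite modulusM -ltr_pdivlMr.
Qed.

(** If |u| >= 1/2, divide by u. Otherwise |1 - u z| >= 1/2 forces r > 1/2, and 4r exceeds the
    diameter of the disk. *)
Lemma near_recip_width (u z z' : R[i]) (r : R) : modulus u <= 1 -> modulus z < 1 -> modulus z' < 1 ->
  modulus (1 - u * z) < r -> modulus (1 - u * z') < r -> modulus (z - z') <= 4 * r.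
Proof.
move=> u1 z1 z1' h h'.
have tri (a b : R[i]) : modulus (a - b) <= modulus (1 - a) + modulus (1 - b).
  have -> : a - b = (1 - b) - (1 - a) by ring.
  by rewrite (le_trans (modulusBD _ _))// addrC.
have [ul|ul] := leP 2^-1 (modulus u).
  have := tri (u * z) (u * z'); rewrite -mulrBr modulusM.
  have := modulus_ge0 (z - z'); nra.
have hz : modulus (z - z') <= 2 by apply: le_trans (modulusBD _ _) _; lra.
have : 1 - modulus u * modulus z <= modulus (1 - u * z).
  have := modulus_dist 1 (u * z); rewrite modulus1 modulusM.
  by apply: le_trans; exact: ler_norm.
have := modulus_ge0 u; have := modulus_ge0 z; nra.
Qed.

(** The disk is cut into the sectors |x| <= |y| and |y| <= |x|. In each the slices in the
    transversal direction have length at most 4t, over a range of length 8r. *)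
Lemma area_near (u : R[i]) (r t : R) : modulus u <= 1 -> 0 < r -> 0 < t ->
  (leb2 [set w | [/\ disk w, (modulus (1 - u * (cplx w : R[i])) < r)%R &
      (1 - modulus (cplx w) ^+ 2 <= t)%R]] <= (64 * r * t)%:E)%E.
Proof.
move=> u1 r0 t0; set S := [set w | _].
have mS : measurable S.
  rewrite (_ : S = @disk R `&` [set w : plane R | modulus (1 - u * (cplx w : R[i])) < r] `&`
     (setT `&` (fun w : plane R => 1 - modulus (cplx w) ^+ 2) @^-1` `]-oo, t])).
    apply: measurableI; first by apply: measurableI; [exact: measurable_disk|exact: measurable_near_recip].
    have mf : measurable_fun setT (fun w : plane R => 1 - modulus (cplx w) ^+ 2).
      by apply: measurable_funB => //; apply: measurable_funX; exact: measurable_modulus.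
    exact: mf.
  apply/seteqP; split => w /=; rewrite in_itv /=; first by move=> [? ? ?].
  by move=> [[? ?] [_ ?]].
have [->|/set0P[w0 Sw0]] := eqVneq S set0.
  by rewrite measure0 lee_fin !mulr_ge0// ltW.
have sqE w : modulus (cplx w) ^+ 2 = w.1 ^+ 2 + w.2 ^+ 2 by rewrite sqr_modulus.
pose S1 : set (plane R) := S `&` [set w | `|w.1| <= `|w.2|].
pose S2 : set (plane R) := S `&` [set w | `|w.2| <= `|w.1|].
have mle (f g : plane R -> R) : measurable_fun setT f -> measurable_fun setT g ->
    measurable [set w | `|f w| <= `|g w|].
  move=> mf mg; have mh : measurable_fun setT (fun w => `|g w| - `|f w|).
    by apply: measurable_funB; apply: measurableT_comp.
  have := mh measurableT `[0, +oo[%classic (measurable_itv _); rewrite setTI.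
  congr measurable; apply/seteqP; split => w /=; by rewrite in_itv /= andbT subr_ge0.
have mS1 : measurable S1.
  by apply: measurableI => //; apply: mle; [exact: measurable_fst|exact: measurable_snd].
have mS2 : measurable S2.
  by apply: measurableI => //; apply: mle; [exact: measurable_snd|exact: measurable_fst].
have inR w : S w -> `|w.1 - w0.1| <= 4 * r /\ `|w.2 - w0.2| <= 4 * r.
  move=> [d1 d2 _]; have [e1 e2 _] := Sw0.
  have h := near_recip_width u1 d1 e1 d2 e2.
  split; apply: le_trans h.
    exact: (Re_le_modulus ((cplx w : R[i]) - cplx w0)).
  exact: (Im_le_modulus ((cplx w : R[i]) - cplx w0)).
have strip (c : R) (F : R -> \bar R) : measurable_fun setT F -> (forall x, 0 <= F x)%E ->
    (forall x, F x <= (4 * t)%:E)%E -> (forall x, ~~ (`|x - c| <= 4 * r) -> F x = 0%E) ->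
    (\int[leb]_x F x <= (32 * r * t)%:E)%E.
  move=> mF F0 F1 F2.
  pose J : set R := `[c - 4 * r, c + 4 * r]%classic.
  apply: (@le_trans _ _ (\int[leb]_(x in J) (4 * t)%:E)%E); last first.
    have JE : leb J = (8 * r)%:E.
      rewrite /J lebesgue_measure_itv /= lte_fin ifT; last by lra.
      by rewrite -EFinB; congr (_%:E); ring.
    rewrite integral_cst; last exact: measurable_itv.
    rewrite [X in (_ * X)%E]JE -EFinM lee_fin le_eqVlt; apply/orP; left; apply/eqP; ring.
  rewrite [X in (_ <= X)%E]integral_mkcond; apply: ge0_le_integralW => // x _.
    by rewrite patchE; case: ifP => // _; rewrite lee_fin mulr_ge0 ?ltW.
  rewrite patchE; case: ifPn => // hx.
  by rewrite F2//; apply: contra hx; rewrite inE /J /= in_itv /= ler_distl.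
have b1 : (leb2 S1 <= (32 * r * t)%:E)%E.
  apply: (strip w0.1 (fun x => leb (xsection S1 x))).
  - exact: measurable_fun_xsection.
  - by move=> x; exact: measure_ge0.
  - move=> x; apply: (@slice_measure x); [by []|exact: measurable_xsection|].
    move=> y; rewrite /xsection /= inE => -[[d1 _ d3] d4].
    by rewrite sqE in d3; split => //; have := modulus_ge0 (cplx (x, y)); rewrite -[_ + _](sqE (x, y)) => ?; rewrite -(expr1n _ 2) lerXn2r ?nnegrE// ltW.
  - move=> x hx; rewrite (_ : xsection S1 x = set0) ?measure0//.
    apply/seteqP; split => y //; rewrite /xsection /= inE => -[/inR[h _] _].
    by rewrite h in hx.
have b2 : (leb2 S2 <= (32 * r * t)%:E)%E.
  (* The product measure integrates x-sections; uniqueness gives the formula with y-sections, which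
     the other sector requires. *)
  have -> : leb2 S2 = (\int[leb]_y leb (ysection S2 y))%E.
    by apply: (@product_measure_unique _ _ _ _ _ leb leb (leb \x^ leb)%E) => //= A B mA mB;
      rewrite product_measure2E.
  apply: (strip w0.2 (fun y => leb (ysection S2 y))).
  - exact: measurable_fun_ysection.
  - by move=> x; exact: measure_ge0.
  - move=> y; apply: (@slice_measure y); [by []|exact: measurable_ysection|].
    move=> x; rewrite /ysection /= inE => -[[d1 _ d3] d4].
    by rewrite sqE in d3; rewrite [_ ^+ 2 + _]addrC; split => //; have := modulus_ge0 (cplx (x, y)); rewrite -[_ + _](sqE (x, y)) => ?; rewrite -(expr1n _ 2) lerXn2r ?nnegrE// ltW.
  - move=> y hx; rewrite (_ : ysection S2 y = set0) ?measure0//.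
    apply/seteqP; split => x //; rewrite /ysection /= inE => -[/inR[_ h] _].
    by rewrite h in hx.
apply: (@le_trans _ _ (leb2 (S1 `|` S2))).
  apply: le_measure; rewrite ?inE//; first exact: measurableU.
  move=> w Sw; have [h|/ltW h] := leP `|w.1| `|w.2|; by [left|right].
apply: le_trans (measureU2 _ mS1 mS2) _; apply: le_trans (leeD b1 b2) _.
by rewrite -EFinD lee_fin le_eqVlt; apply/orP; left; apply/eqP; ring.
Qed.

End dyadic.

Section kernel.
Context {R : realType}.
Local Notation leb := (@lebesgue_measure R).
Local Notation leb2 := (leb \x leb)%E.
Implicit Types (w : plane R).

Lemma geometric_sum_le (q : R) n : 0 < q -> q < 1 -> \sum_(j < n) q ^+ j <= (1 - q)^-1.
Proof.
move=> q0 q1; have d0 : 0 < 1 - q by rewrite subr_gt0.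
rewrite -[leRHS]mul1r ler_pdivlMr// mulrC.
have -> : (1 - q) * \sum_(j < n) q ^+ j = 1 - q ^+ n.
  by rewrite -[RHS]opprB subrX1 -mulNr opprB.
by rewrite lerBlDr lerDl exprn_ge0// ltW.
Qed.

Lemma one_sub_le_near (u z : R[i]) : modulus u <= 1 -> modulus z <= 1 ->
  1 - modulus z <= modulus (1 - u * z).
Proof.
move=> u1 z1; have := modulus_dist 1 (u * z); rewrite modulus1 modulusM.
move/(le_trans (ler_norm _)); apply: le_trans.
by rewrite lerB// ler_piMl ?modulus_ge0.
Qed.

Lemma one_sub_le_near_sym (u z : R[i]) : modulus u <= 1 -> modulus z <= 1 ->
  1 - modulus u <= modulus (1 - u * z).
Proof. by move=> u1 z1; rewrite mulrC; exact: one_sub_le_near. Qed.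

Lemma weight_ball (sg : R) : -1 < sg -> exists2 c : R, 0 < c &
  forall (u : R[i]) (r : R), modulus u <= 1 -> 0 < r ->
  (\int[leb2]_(w in @disk R `&` [set w | modulus (1 - u * (cplx w : R[i])) < r]%R)
     ((1 - modulus (cplx w) ^+ 2) `^ sg)%:E <= (c * r `^ (sg + 2))%:E)%E.
Proof.
move=> sg1; pose q : R := 2 `^ (- (sg + 1)).
have q0 : 0 < q by rewrite powR_gt0.
have q1 : q < 1.
  rewrite /q powRN invf_lt1 ?powR_gt0//.
  have one_s : 1 = 1 `^ (sg + 1) :> R by rewrite powR1.
  by rewrite [ltLHS]one_s gt0_ltr_powR ?nnegrE ?ltr1n//; lra.
pose Q : R := 4 `^ `|sg|; have Q0 : 0 < Q by rewrite powR_gt0.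
pose c : R := 64 * Q * 2 `^ (sg + 1) / (1 - q).
have c0 : 0 < c by rewrite !mulr_gt0 ?invr_gt0 ?subr_gt0 ?powR_gt0.
exists c => // u r u1 r0.
pose t j : R := 2 * r * 2 ^- j.
have t0 j : 0 < t j by rewrite !mulr_gt0// pow2V_gt0.
set D := @disk R `&` _.
have mD : measurable D.
  by apply: measurableI; [exact: measurable_disk|exact: measurable_near_recip].
have mf : measurable_fun setT (fun w : plane R => 1 - modulus (cplx w) ^+ 2).
  by apply: measurable_funB => //; apply: measurable_funX; exact: measurable_modulus.
pose A j := D `&` [set w : plane R | 1 - modulus (cplx w) ^+ 2 <= t j].
have mA j : measurable (A j).
  apply: measurableI => //.
  have := mf measurableT `]-oo, t j]%classic (measurable_itv _); rewrite setTI.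
  by congr measurable; apply/seteqP; split => w /=; rewrite in_itv.
apply: (@dyadic_integral _ _ _ leb2 D A _ (fun=> 1) (fun j => Q * t j `^ sg)
    (fun j => 64 * r * t j)) => //.
- by move=> j w [].
- by move=> j; rewrite mulr_ge0 ?powR_ge0 ?(ltW Q0).
- move=> w [wd wn]; split; first exact: powR_ge0.
  have x0 := one_sub_sqr_modulus_gt0 wd; set x := 1 - _ in x0 *.
  have w1 : modulus (cplx w) < 1 := wd.
  have x2 : x <= 2 * r.
    have := one_sub_le_near u1 (ltW w1); have := modulus_ge0 (cplx w : R[i]).
    by move: wn; rewrite /x /= expr2; nra.
  have y0 : 0 < x / (2 * r) by rewrite divr_gt0// mulr_gt0.
  have y1 : x / (2 * r) <= 1 by rewrite ler_pdivrMr ?mul1r// mulr_gt0.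
  have [j j1 j2] := dyadic_scale y0 y1; have e0 := @pow2V_gt0 R j.
  have xt1 : x <= t j by move: j2; rewrite ler_pdivrMr ?mulr_gt0// mulrC.
  have xt2 : t j / 4 <= x.
    apply: ltW; move: j1; rewrite ltr_pdivlMr ?mulr_gt0//; apply: le_lt_trans.
    by rewrite /t; nra.
  exists j => //; rewrite mulr1.
  have xy : 4^-1 <= x / t j <= 4.
    by apply/andP; split; [rewrite ler_pdivlMr//; lra|rewrite ler_pdivrMr//; lra].
  have := powR_quarter (- sg) xy; rewrite normrN powRN -/Q powRN.
  have yt0 : 0 < x / t j by exact: divr_gt0 x0 (t0 j).
  rewrite lef_pV2 ?posrE ?powR_gt0// => h.
  have xE : x = x / t j * t j by rewrite divfK// gt_eqF.
  by rewrite xE (powRM sg (ltW yt0) (ltW (t0 j))) ler_wpM2r ?powR_ge0.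
- move=> j; rewrite integral_cst// mul1e.
  rewrite (_ : A j = [set w | [/\ disk w, modulus (1 - u * (cplx w : R[i])) < r &
    1 - modulus (cplx w) ^+ 2 <= t j]]); first exact: area_near.
  by apply/seteqP; split => w; [move=> [[? ?] ?]|move=> [? ? ?]].
- move=> n; apply: (@le_trans _ _ (64 * Q * r * (2 * r) `^ (sg + 1) * \sum_(j < n) q ^+ j)).
    rewrite mulr_sumr; apply: ler_sum => j _.
    have -> : Q * t j `^ sg * (64 * r * t j) = 64 * Q * r * t j `^ (sg + 1).
      rewrite powRD ?powRr1 ?(ltW (t0 j))//; first by ring.
      by rewrite (gt_eqF (t0 j)) implybT.
    rewrite -[leRHS]mulrA ler_wpM2l ?mulr_ge0 ?(ltW Q0) ?(ltW r0)//.
    rewrite /t powRM ?mulr_ge0 ?(ltW r0) ?(ltW (pow2V_gt0 _ _))// ler_wpM2l ?powR_ge0//.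
    rewrite /q -powR_mulrn ?powR_ge0// -powRrM -[2 ^- j]powR_invn// -powRrM.
    by rewrite mulrC mulrN mulNr.
  have -> : c * r `^ (sg + 2) = 64 * Q * r * (2 * r) `^ (sg + 1) * (1 - q)^-1.
    rewrite powRM ?(ltW r0)// (_ : sg + 2 = sg + 1 + 1); last by ring.
    rewrite (@powRD _ r (sg + 1) 1) ?powRr1 ?(ltW r0)//; first by rewrite /c; ring.
    by rewrite (gt_eqF r0) implybT.
  rewrite ler_wpM2l ?geometric_sum_le//.
  by rewrite !mulr_ge0 ?powR_ge0 ?(ltW Q0) ?(ltW r0).
Qed.

(** Here be = 1 - |a|^2. For t = |1 - conj(a) w| the first entry of the minimum is (be/t^2)^s, the
    part of the Moebius weight free of |w|; the second is its value at t = be/2, a lower bound for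
    such t. *)
Definition cutoff (p s be t : R) : R :=
  t `^ (- p) * Num.min (be `^ s * t `^ (- (2 * s))) (4 `^ s * be `^ (- s)).

Lemma cutoff_ge0 p s be t : 0 <= cutoff p s be t.
Proof. by rewrite mulr_ge0 ?powR_ge0// le_min !mulr_ge0 ?powR_ge0. Qed.

Lemma powRN_le (p x y : R) : 0 <= p -> 0 < x -> x <= y -> y `^ (- p) <= x `^ (- p).
Proof.
move=> p0 x0 xy; have y0 : 0 < y by exact: lt_le_trans xy.
rewrite !powRN lef_pV2 ?posrE ?powR_gt0//.
by apply: ge0_ler_powR; rewrite ?nnegrE ?(ltW x0) ?(ltW y0).
Qed.

Lemma cutoff_le p s be x y : 0 <= p -> 0 <= s -> 0 < x -> x <= y ->
  cutoff p s be y <= cutoff p s be x.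
Proof.
move=> p0 s0 x0 xy; apply: ler_pM.
- exact: powR_ge0.
- by rewrite le_min !mulr_ge0 ?powR_ge0.
- exact: powRN_le.
rewrite le_min !ge_min lexx orbT andbT ler_wpM2l ?powR_ge0//.
by apply: powRN_le; rewrite ?mulr_ge0.
Qed.

Lemma measurable_cutoff_near p s be (u : R[i]) :
  measurable_fun setT (fun w : plane R => cutoff p s be (modulus (1 - u * (cplx w : R[i])))).
Proof.
have m1 : measurable_fun setT (fun w : plane R => modulus (1 - u * (cplx w : R[i]))).
  have [] // := @modulus_continuous_measurable _ setT (fun z => 1 - u * z).
  move=> w _; apply: (@cdiff_continuous _ _ _ (0 - (u * 1 + 0 * cplx w))).
  have d : cdiff (fun z : R[i] => 1 + (- u) * z) (cplx w) (0 + (- u * 1 + 0 * cplx w)).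
    apply: cdiffD; first exact: cdiff_cst.
    by apply: cdiffM; [exact: cdiff_cst|exact: cdiff_id].
  rewrite (_ : (fun z => _) = (fun z : R[i] => 1 + (- u) * z)); last first.
    by apply/funext => z; rewrite mulNr.
  by rewrite (_ : 0 - _ = 0 + (- u * 1 + 0 * cplx w)) //; ring.
apply: measurable_funM; first by apply: (measurableT_comp (measurable_powR _)).
apply: measurable_minr; last exact: measurable_cst.
apply: measurable_funM; first exact: measurable_cst.
by apply: (measurableT_comp (measurable_powR _)).
Qed.

(** On the layer |1 - u w| ~ e = 2^-j, [weight_ball] with exponent p-2+s gives e^(p+s); s + p > 1 is
    its hypothesis. Multiplied by the cutoff this becomes the minimum of (be/e)^s and (e/be)^s up to
    constants, whose sum over j is bounded uniformly in be by [min_geometric]. *)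
Lemma kernel_integral (p s : R) : 0 < p -> 0 < s -> 1 < s + p -> exists2 c : R, 0 < c &
  forall (u : R[i]) (be : R), modulus u <= 1 -> 0 < be ->
  (\int[leb2]_(w in @disk R) ((1 - modulus (cplx w) ^+ 2) `^ (p - 2 + s) *
     cutoff p s be (modulus (1 - u * (cplx w : R[i]))))%:E <= c%:E)%E.
Proof.
move=> p0 s0 ps1; have sg1 : -1 < p - 2 + s by lra.
have [c0 c00 Hc0] := weight_ball sg1.
have q1 : 1 < 2 `^ s :> R.
  have one_s : 1 = 1 `^ s :> R by rewrite powR1.
  by rewrite [ltLHS]one_s gt0_ltr_powR ?nnegrE// ltr1n.
have [c1 c10 Hc1] := min_geometric q1.
pose P : R := 4 `^ (p + s); have P0 : 0 < P by rewrite powR_gt0.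
pose S : R := 4 `^ s; have S0 : 0 < S by rewrite powR_gt0.
have S1 : 1 <= S.
  have one_s : 1 = 1 `^ s :> R by rewrite powR1.
  by rewrite [leLHS]one_s /S ge0_ler_powR ?nnegrE ?(ltW s0)// ler1n.
exists (c0 * P * S * c1) => [|u be u1 be0]; first by rewrite !mulr_gt0.
pose t j : R := 2 ^- j; have t0 j : 0 < t j by exact: pow2V_gt0.
pose A j := @disk R `&` [set w | modulus (1 - u * (cplx w : R[i])) < 4 * t j].
apply: (@dyadic_integral _ _ _ leb2 (@disk R) A _
  (fun w => (1 - modulus (cplx w) ^+ 2) `^ (p - 2 + s)) (fun j => cutoff p s be (t j))
  (fun j => c0 * (4 * t j) `^ (p + s))).
- exact: measurable_disk.
- by move=> j; apply: measurableI; [exact: measurable_disk|exact: measurable_near_recip].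
- by move=> j w [].
- exact: measurable_disk_weight.
- by move=> w _; exact: powR_ge0.
- by move=> j; exact: cutoff_ge0.
- move=> w wd; split; first by rewrite mulr_ge0 ?powR_ge0 ?cutoff_ge0.
  have w1 : modulus (cplx w) < 1 := wd.
  set x := modulus (1 - _); have x0 : 0 < x.
    by apply: lt_le_trans (one_sub_le_near u1 (ltW w1)); rewrite subr_gt0.
  have x2 : x <= 2.
    rewrite /x (le_trans (modulusBD _ _))// modulus1 modulusM.
    have := modulus_ge0 u; have := modulus_ge0 (cplx w : R[i]); nra.
  have y0 : 0 < x / 2 by rewrite divr_gt0.
  have y1 : x / 2 <= 1 by lra.
  have [j j1 j2] := dyadic_scale y0 y1; have e0 := t0 j.
  exists j; first by split => //; rewrite /= -/x /t; move: j2 e0; rewrite /t; lra.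
  rewrite mulrC ler_wpM2r ?powR_ge0//; apply: cutoff_le; rewrite ?(ltW p0) ?(ltW s0)//.
  by rewrite /t; move: j1; lra.
- move=> j; have -> : p + s = p - 2 + s + 2 by ring.
  by apply: Hc0 => //; rewrite mulr_gt0.
- move=> n; have y0 : 0 < be `^ s by rewrite powR_gt0.
  apply: (@le_trans _ _ (c0 * P * S * \sum_(j < n)
      Num.min ((2 `^ s) ^+ j * be `^ s) ((2 `^ s) ^+ j * be `^ s)^-1)); last first.
    by rewrite ler_wpM2l ?Hc1// !mulr_ge0// ltW.
  rewrite mulr_sumr; apply: ler_sum => j _.
  have e0 := t0 j; set e := t j in e0 *.
  have eE : (2 `^ s) ^+ j = e `^ (- s).
    rewrite -powR_mulrn ?powR_ge0// -powRrM /e /t -powR_invn// -powRrM.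
    by congr (_ `^ _); ring.
  rewrite eE /cutoff powRM ?(ltW e0)// -/P.
  have -> : e `^ (- p) * Num.min (be `^ s * e `^ (- (2 * s))) (4 `^ s * be `^ (- s)) * (c0 * (P * e `^ (p + s))) =
     c0 * P * (e `^ s * Num.min (be `^ s * e `^ (- (2 * s))) (4 `^ s * be `^ (- s))).
    have eD a b : e `^ (a + b) = e `^ a * e `^ b.
      by rewrite powRD// (gt_eqF e0) implybT.
    have ep : e `^ (- p) * e `^ p = 1 by rewrite -eD addNr powRr0.
    rewrite eD; set m := Num.min _ _.
    by rewrite -[RHS]mul1r -ep; ring.
  rewrite -[leRHS]mulrA ler_wpM2l ?mulr_ge0 ?(ltW c00) ?(ltW P0)//.
  rewrite minr_pMr ?powR_ge0// [leRHS]minr_pMr ?(ltW S0)// -/S.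
  have -> : e `^ s * (be `^ s * e `^ (- (2 * s))) = e `^ (- s) * be `^ s.
    rewrite mulrCA -powRD ?(gt_eqF e0) ?implybT//.
    by rewrite mulrC; congr (_ `^ _ * _); ring.
  have -> : e `^ s * (S * be `^ (- s)) = S * (e `^ (- s) * be `^ s)^-1.
    rewrite !powRN invfM invrK; ring.
  by rewrite le_min !ge_min lexx orbT andbT ler_peMl ?mulr_ge0 ?powR_ge0.
Qed.

End kernel.

(** * Energy of functions with a logarithmic singularity *)

Section test_functions.
Context {R : realType}.
Local Notation leb := (@lebesgue_measure R).
Local Notation leb2 := (leb \x leb)%E.
Implicit Types (w : plane R) (a z zeta : R[i]) (f df : R[i] -> R[i]).

(* Whichever of [A = |1 - conj(zeta) w|] and [B = |1 - conj(a) w|] is smaller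
   can absorb the other one. *)
Lemma cutoff_dominates (p s be A B : R) : 0 < p -> 0 < s -> 0 < be -> 0 < A -> be / 2 <= B ->
  A `^ (- p) * (be `^ s * B `^ (- (2 * s))) <= cutoff p s be A + cutoff p s be B.
Proof.
move=> p0 s0 be0 A0 Bb; have B0 : 0 < B by apply: lt_le_trans Bb; rewrite divr_gt0.
have hB : be `^ s * B `^ (- (2 * s)) <= 4 `^ s * be `^ (- s).
  apply: le_trans (_ : be `^ s * (be / 2) `^ (- (2 * s)) <= _).
    by rewrite ler_wpM2l ?powR_ge0//; apply: powRN_le => //; rewrite ?divr_gt0 ?mulr_ge0 ?(ltW s0).
  rewrite powRM ?(ltW be0)// mulrA -powRD ?(gt_eqF be0) ?implybT//.
  rewrite mulrC (_ : s + - (2 * s) = - s); last by ring.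
  rewrite ler_wpM2r ?powR_ge0// -powR_inv1// -powRrM.
  have -> : 4 = 2 `^ 2 :> R by rewrite (powR_mulrn 2)// expr2 -natrM.
  by rewrite -powRrM; apply: ler_powR; rewrite ?ler1n//; lra.
have [AB|/ltW BA] := leP A B.
  apply: le_trans (_ : cutoff p s be A <= _); last by rewrite lerDl cutoff_ge0.
  rewrite ler_wpM2l ?powR_ge0// le_min hB andbT ler_wpM2l ?powR_ge0//.
  by apply: powRN_le => //; rewrite mulr_ge0 ?(ltW s0).
apply: le_trans (_ : cutoff p s be B <= _); last by rewrite lerDr cutoff_ge0.
apply: ler_pM; rewrite ?mulr_ge0 ?powR_ge0//; first by apply: powRN_le; rewrite ?(ltW p0).
by rewrite le_min hB lexx.
Qed.

(** The model is log (1 - conj(zeta) z). The Moebius identity and [cutoff_dominates] split the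
    integrand into two kernels, for conj(zeta) and for conj(a), so the bound is uniform in zeta and
    a. *)
Lemma energy_of_kernel (p s : R) : 0 < p -> 0 < s -> 1 < s + p -> exists2 c : R, 0 < c &
  forall zeta df (M : R), modulus zeta = 1 -> 0 <= M ->
  (forall z, modulus z < 1 -> modulus (df z) * modulus (1 - zeta^*%C * z) <= M) ->
  energy_le p s df (c * M `^ p).
Proof.
move=> p0 s0 ps1; have [c c0 Hc] := kernel_integral p0 s0 ps1.
have pi0 : 0 < pi :> R by exact: pi_gt0.
exists (pi^-1 * (c + c)) => [|zeta df M z1 M0 HM a a1].
  by rewrite mulr_gt0 ?invr_gt0// addr_gt0.
pose be := 1 - modulus a ^+ 2.
have be0 : 0 < be by rewrite /be expr2; have := modulus_ge0 a; nra.
pose h w := (1 - modulus (cplx w) ^+ 2) `^ (p - 2 + s).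
pose psi (u : R[i]) w := cutoff p s be (modulus (1 - u * (cplx w : R[i]))).
have psi0 u w : 0 <= psi u w by exact: cutoff_ge0.
have h0 w : 0 <= h w by exact: powR_ge0.
have mh u : measurable_fun (@disk R) (fun w => h w * psi u w).
  apply: measurable_funM; first exact: measurable_disk_weight.
  by apply: measurable_funTS; exact: measurable_cutoff_near.
have mhE u : measurable_fun (@disk R) (fun w => (h w * psi u w)%:E).
  exact/measurable_EFinP.
have mD := @measurable_disk R.
pose g w := ((h w * psi zeta^*%C w)%:E + (h w * psi a^*%C w)%:E)%E.
have g0 w : (0 <= g w)%E by apply: adde_ge0; rewrite lee_fin mulr_ge0.
have mg : measurable_fun (@disk R) g by exact: emeasurable_funD.
apply: (@le_trans _ _ (\int[area]_(w in @disk R) ((M `^ p)%:E * g w))%E).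
  apply: ge0_le_integralW => // w wd.
  - by rewrite lee_fin mulr_ge0 ?dens_ge0 ?powR_ge0.
  - by apply: mule_ge0 (g0 w); rewrite lee_fin powR_ge0.
  rewrite /g -EFinD -EFinM lee_fin.
  have w1 : modulus (cplx w) < 1 := wd.
  have x0 := one_sub_sqr_modulus_gt0 wd.
  have nz : 1 - a^*%C * (cplx w : R[i]) != 0.
    by apply: modulus_lt1_neq0; rewrite ?modulus_conj ?(ltW a1).
  rewrite mobius_identity// -/be /dens -mulrDr /h /psi.
  set x := 1 - modulus (cplx w) ^+ 2 in x0 *.
  set A := modulus (1 - zeta^*%C * _); set B := modulus (1 - a^*%C * _).
  have A0 : 0 < A.
    by apply: lt_le_trans (one_sub_le_near _ _); rewrite ?modulus_conj ?z1 ?subr_gt0// ltW.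
  have B0 : 0 < B by rewrite modulus_gt0.
  have Bb : be / 2 <= B.
    apply: le_trans (_ : 1 - modulus a^*%C <= _).
      by rewrite modulus_conj /be expr2; have := modulus_ge0 a; nra.
    by apply: one_sub_le_near_sym; rewrite ?modulus_conj// ltW.
  have hd : modulus (df (cplx w)) `^ p <= M `^ p * A `^ (- p).
    have -> : A `^ (- p) = A^-1 `^ p.
      by rewrite -powR_inv1 ?(ltW A0)// -powRrM mulN1r.
    rewrite -powRM ?invr_ge0 ?(ltW A0)//; apply: ge0_ler_powR; rewrite ?nnegrE ?(ltW p0) ?modulus_ge0//.
      by rewrite mulr_ge0// invr_ge0 ltW.
    by rewrite ler_pdivlMr//; exact: HM.
  have -> : (be * x / B ^+ 2) `^ s = x `^ s * (be `^ s * B `^ (- (2 * s))).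
    rewrite !powRM ?invr_ge0 ?exprn_ge0 ?mulr_ge0 ?(ltW be0) ?(ltW x0) ?(ltW B0)//.
    rewrite -[B ^- 2]powR_invn ?(ltW B0)// -powRrM mulNr; ring.
  have -> : x `^ (p - 2 + s) = x `^ (p - 2) * x `^ s.
    by rewrite powRD// (gt_eqF x0) implybT.
  have H := cutoff_dominates p0 s0 be0 A0 Bb.
  apply: le_trans (_ : (M `^ p * A `^ (- p)) * x `^ (p - 2) * (x `^ s * (be `^ s * B `^ (- (2 * s)))) <= _).
    by rewrite ler_wpM2r ?mulr_ge0 ?powR_ge0// ler_wpM2r ?powR_ge0.
  have -> : (M `^ p * A `^ (- p)) * x `^ (p - 2) * (x `^ s * (be `^ s * B `^ (- (2 * s)))) =
    (M `^ p * (x `^ (p - 2) * x `^ s)) * (A `^ (- p) * (be `^ s * B `^ (- (2 * s)))) by ring.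
  by rewrite [leRHS]mulrA ler_wpM2l ?mulr_ge0 ?powR_ge0.
rewrite ge0_integral_mscale//=; last 2 first.
- by apply: measurable_funeM.
- by move=> w _; apply: mule_ge0 (g0 w); rewrite lee_fin powR_ge0.
rewrite ge0_integralZl// ?lee_fin ?powR_ge0// /g ge0_integralD//; last 2 first.
- by move=> w _; rewrite lee_fin mulr_ge0.
- by move=> w _; rewrite lee_fin mulr_ge0.
have b1 := Hc zeta^*%C be ltac:(by rewrite modulus_conj z1) be0.
have b2 := Hc a^*%C be ltac:(by rewrite modulus_conj ltW) be0.
have -> : (pi^-1 * (c + c) * M `^ p)%:E = (pi^-1%:E * ((M `^ p)%:E * (c%:E + c%:E)))%E.
  by rewrite -EFinD -!EFinM; congr (_%:E); ring.
rewrite lee_wpmul2l ?lee_fin ?invr_ge0 ?pi_ge0//.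
rewrite lee_wpmul2l ?lee_fin ?powR_ge0//.
exact: leeD b1 b2.
Qed.

End test_functions.

Section test_family.
Context {R : realType}.
Implicit Types (z zeta v : R[i]).

Lemma modulus_sum n (F : nat -> R[i]) : modulus (\sum_(k < n) F k) <= \sum_(k < n) modulus (F k).
Proof.
elim: n => [|n IH]; first by rewrite !big_ord0 modulus0.
by rewrite !big_ord_recr /= (le_trans (modulusD _ _))// lerD2r.
Qed.

Lemma Re_sum n (F : nat -> R[i]) : Re (\sum_(k < n) F k) = \sum_(k < n) Re (F k).
Proof.
elim: n => [|n IH]; first by rewrite !big_ord0.
by rewrite !big_ord_recr /= -IH; case: (\sum_(_ < n) _) => a b; case: (F n).
Qed.

Lemma cdiff_sum n (F dF : nat -> R[i] -> R[i]) z :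
  (forall k, cdiff (F k) z (dF k z)) ->
  cdiff (fun y => \sum_(k < n) F k y) z (\sum_(k < n) dF k z).
Proof.
move=> H; elim: n => [|n IH].
  rewrite big_ord0 (_ : (fun _ => _) = fun=> 0); first exact: cdiff_cst.
  by apply/funext => y; rewrite big_ord0.
rewrite big_ord_recr /= (_ : (fun y => _) = (fun y => \sum_(k < n) F k y + F n y)).
  exact: cdiffD.
by apply/funext => y; rewrite big_ord_recr.
Qed.

Lemma one_add_ge v : 0 <= Re v -> 1 <= modulus (1 + v) /\ modulus v <= modulus (1 + v).
Proof.
have sq (a b : R) : 0 <= a -> 0 <= b -> a ^+ 2 <= b ^+ 2 -> a <= b.
  by move=> a0 b0; rewrite ler_pXn2r ?nnegrE.
move=> v0; split; apply: sq; rewrite ?modulus_ge0 ?ler01// !sqr_modulus;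
  by case: v v0 => a b /= a0; rewrite ?expr1n !expr2; nra.
Qed.

Section family.
Variables (zeta : R[i]) (N : nat).
Hypothesis z1 : modulus zeta = 1.

Let W z := 1 - zeta^*%C * z.
Let v k z : R[i] := (2 ^+ k)%:C * W z.
(** A summand is near 1 while 2^k |W z| is small and decays geometrically afterwards, so [L] counts
    the dyadic scales between |W z| and 1, at most N+1 of them. *)
Let L z := \sum_(k < N.+1) (1 + v k z)^-1.
Let dL z := \sum_(k < N.+1) ((2 ^+ k)%:C * zeta^*%C / (1 + v k z) ^+ 2).
(* A dyadic substitute for [log (1 / W z) ^ 2 / N]. *)
Let f z := L z * L z * (N.+1%:R^-1)%:C.
Let df z := (L z * dL z + dL z * L z) * (N.+1%:R^-1)%:C.

Let Re_W z : modulus z < 1 -> 0 <= Re (W z).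
Proof.
move=> zlt; have : Re (zeta^*%C * z) <= modulus (zeta^*%C * z).
  by apply: le_trans (Re_le_modulus _); exact: ler_norm.
rewrite modulusM modulus_conj z1 mul1r /W => h.
have -> : Re (1 - zeta^*%C * z) = 1 - Re (zeta^*%C * z) by case: (_ * z).
lra.
Qed.

Let Re_v k z : modulus z < 1 -> 0 <= Re (v k z).
Proof.
move=> /Re_W h; have -> : Re (v k z) = 2 ^+ k * Re (W z).
  by rewrite /v; case: (W z) => a b /=; ring.
by rewrite mulr_ge0// exprn_ge0.
Qed.

Let modulus_v k z : modulus (v k z) = 2 ^+ k * modulus (W z).
Proof. by rewrite /v modulusM modulusC ger0_norm// exprn_ge0. Qed.

Let v_neq0 k z : modulus z < 1 -> 1 + v k z != 0.
Proof.
move=> zlt; have [h _] := one_add_ge (Re_v k zlt).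
by rewrite -modulus_gt0; lra.
Qed.

Let N0 : 0 < N.+1%:R :> R. Proof. by rewrite ltr0n. Qed.

Let modulus_f z : modulus (f z) = modulus (L z) ^+ 2 / N.+1%:R.
Proof. by rewrite /f !modulusM modulusC ger0_norm ?invr_ge0 ?(ltW N0)// expr2. Qed.

Let W_gt0 z : modulus z < 1 -> 0 < modulus (W z).
Proof.
move=> zlt; apply: lt_le_trans (one_sub_le_near _ (ltW zlt)); first by rewrite subr_gt0.
by rewrite modulus_conj z1.
Qed.

Lemma test_holo : holo f df.
Proof.
move=> z zlt.
have dW : cdiff W z (- zeta^*%C).
  have d : cdiff (fun y : R[i] => 1 + (- zeta^*%C) * y) z (0 + (- zeta^*%C * 1 + 0 * z)).
    apply: cdiffD; first exact: cdiff_cst.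
    by apply: cdiffM; [exact: cdiff_cst|exact: cdiff_id].
  rewrite (_ : W = fun y : R[i] => 1 + (- zeta^*%C) * y); last first.
    by apply/funext => y; rewrite /W mulNr.
  by move: d; rewrite add0r mulr1 mul0r addr0.
have dv k : cdiff (fun y => 1 + v k y) z (0 + ((2 ^+ k)%:C * - zeta^*%C + 0 * W z)).
  apply: cdiffD; first exact: cdiff_cst.
  by apply: cdiffM; [exact: cdiff_cst|exact: dW].
have dLz : cdiff L z (dL z).
  apply: (@cdiff_sum N.+1 (fun k y => (1 + v k y)^-1)
    (fun k y => (2 ^+ k)%:C * zeta^*%C / (1 + v k y) ^+ 2)) => k.
  have := @cdiffV _ (fun y => 1 + v k y) z _ (v_neq0 k zlt) (dv k).
  rewrite (_ : - (0 + ((2 ^+ k)%:C * - zeta^*%C + 0 * W z)) = (2 ^+ k)%:C * zeta^*%C)//.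
  by ring.
have := cdiffM (cdiffM dLz dLz) (cdiff_cst (N.+1%:R^-1)%:C z).
by rewrite mulr0 add0r.
Qed.

(** Away from zeta the k-th summand of [L] is at most 2^-k/(1-r), so |L|^2 is bounded independently
    of N and the division by N+1 remains. *)
Lemma test_small z r : modulus z <= r -> r < 1 ->
  modulus (f z) <= 4 / (1 - r) ^+ 2 / N.+1%:R.
Proof.
move=> zr r1; have zlt : modulus z < 1 by exact: le_lt_trans r1.
have d0 : 0 < 1 - r by rewrite subr_gt0.
have hW : 1 - r <= modulus (W z).
  apply: le_trans (one_sub_le_near _ (ltW zlt)); first by rewrite lerB.
  by rewrite modulus_conj z1.
have hL : modulus (L z) <= 2 / (1 - r).
  apply: le_trans (modulus_sum _ (fun k => (1 + v k z)^-1)) _.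
  apply: le_trans (_ : \sum_(k < N.+1) (2^-1) ^+ k / (1 - r) <= _).
    apply: ler_sum => k _; rewrite modulusV.
    have [_ h] := one_add_ge (Re_v k zlt); rewrite modulus_v in h.
    have k0 : 0 < 2 ^+ k :> R by rewrite exprn_gt0.
    rewrite exprVn -invfM lef_pV2 ?posrE ?mulr_gt0//.
      by apply: le_trans h; rewrite ler_pM2l.
    by apply: lt_le_trans h; rewrite mulr_gt0 ?W_gt0.
  rewrite -mulr_suml ler_pM2r ?invr_gt0//.
  rewrite [leRHS](_ : _ = (1 - 2^-1)^-1); last by field.
  by apply: geometric_sum_le; lra.
rewrite modulus_f ler_pM2r ?invr_gt0//.
have -> : 4 / (1 - r) ^+ 2 = (2 / (1 - r)) ^+ 2 by rewrite expr_div_n; congr (_ / _); ring.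
by rewrite lerXn2r ?nnegrE ?modulus_ge0 ?divr_ge0 ?(ltW d0).
Qed.

(** All N+1 summands have real part at least 1/100, because |1 + v| <= 10 and Re (1 + v) >= 1;
    squaring gives 10^4. The 9 is the constant of [box_near]. *)
Lemma test_large z : modulus z < 1 -> 2 ^+ N * modulus (W z) <= 9 ->
  N.+1%:R / 10 ^+ 4 <= modulus (f z).
Proof.
move=> zlt hz.
have hL : N.+1%:R / 100 <= modulus (L z).
  apply: le_trans (_ : Re (L z) <= _); last first.
    by apply: le_trans (Re_le_modulus _); exact: ler_norm.
  rewrite (Re_sum _ (fun k => (1 + v k z)^-1)); apply: le_trans (_ : \sum_(k < N.+1) 100^-1 <= _).
    by rewrite sumr_const card_ord -[leRHS]mulr_natl.
  apply: ler_sum => k _; have [h1 _] := one_add_ge (Re_v k zlt).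
  have h2 : modulus (1 + v k z) <= 10.
    rewrite (le_trans (modulusD _ _))// modulus1 modulus_v.
    have : 2 ^+ k * modulus (W z) <= 9.
      apply: le_trans hz; rewrite ler_wpM2r ?modulus_ge0// ler_weXn2l ?ler1n//.
      by rewrite -ltnS.
    lra.
  have h3 := Re_v k zlt; set x := v k z in h1 h2 h3 *.
  have -> : Re (1 + x)^-1 = Re (1 + x) / modulus (1 + x) ^+ 2.
    by rewrite sqr_modulus; case: (1 + x) => a b.
  have -> : Re (1 + x) = 1 + Re x by case: (x).
  have m0 : 0 < modulus (1 + x) by lra.
  rewrite ler_pdivlMr ?exprn_gt0// mulrC ler_pdivrMr//.
  by have : modulus (1 + x) ^+ 2 <= 100; [rewrite expr2; nra|lra].
rewrite modulus_f ler_pdivlMr//.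
have -> : N.+1%:R / 10 ^+ 4 * N.+1%:R = (N.+1%:R / 100) ^+ 2 :> R.
  rewrite expr_div_n mulrAC -expr2; congr (_ / _).
  by rewrite -!natrX.
by rewrite lerXn2r ?nnegrE ?modulus_ge0 ?divr_ge0 ?(ltW N0).
Qed.

(** With y = 2^k |W z|, a term of |dL| |W| is at most y/|1 + v|^2 <= min (y, 1/y). The remaining
    factor |L| <= N+1 is cancelled by the division. *)
Lemma test_deriv (c : R) : (forall (y : R) n, 0 < y ->
    \sum_(i < n) Num.min (2 ^+ i * y) (2 ^+ i * y)^-1 <= c) ->
  forall z, modulus z < 1 -> modulus (df z) * modulus (W z) <= 2 * c.
Proof.
move=> Hc z zlt; have W0 := W_gt0 zlt.
have hL : modulus (L z) <= N.+1%:R.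
  apply: le_trans (modulus_sum _ (fun k => (1 + v k z)^-1)) _; apply: le_trans (_ : \sum_(k < N.+1) 1 <= _).
    apply: ler_sum => k _; rewrite modulusV.
    by have [h _] := one_add_ge (Re_v k zlt); rewrite invf_le1//; lra.
  by rewrite sumr_const card_ord.
have hd : modulus (dL z) * modulus (W z) <= c.
  apply: le_trans (Hc _ N.+1 W0).
  apply: le_trans (ler_wpM2r (ltW W0) (modulus_sum _ (fun k => (2 ^+ k)%:C * zeta^*%C / (1 + v k z) ^+ 2))) _.
  rewrite mulr_suml; apply: ler_sum => k _.
  have [h1 h2] := one_add_ge (Re_v k zlt); rewrite modulus_v in h2.
  rewrite !modulusM modulusV modulusX modulus_conj z1 mulr1 modulusC ger0_norm ?exprn_ge0//.
  rewrite mulrAC; set y := 2 ^+ k * _ in h2 *; set m := modulus (1 + _) in h1 h2 *.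
  have y0 : 0 < y by rewrite mulr_gt0// exprn_gt0.
  have m0 : 0 < m by lra.
  rewrite le_min ler_pdivrMr ?exprn_gt0//; apply/andP; split.
    by rewrite ler_peMr ?(ltW y0)// expr2; nra.
  by rewrite ler_pdivrMr ?exprn_gt0// ler_pdivlMl// -expr2 lerXn2r ?nnegrE ?(ltW y0) ?(ltW m0).
have -> : modulus (df z) = 2 * (modulus (L z) * modulus (dL z)) / N.+1%:R.
  have two : (2 : R)%:C = 2 :> R[i] by rewrite rmorph_nat.
  have -> : df z = (2 : R)%:C * (L z * dL z) * (N.+1%:R^-1)%:C by rewrite two /df; ring.
  by rewrite !modulusM !modulusC !ger0_norm ?invr_ge0 ?(ltW N0).
have := modulus_ge0 (dL z); have := modulus_ge0 (L z) => hL0 hd0.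
rewrite mulrAC ler_pdivrMr//.
have -> : 2 * (modulus (L z) * modulus (dL z)) * modulus (W z) =
  2 * (modulus (L z) * (modulus (dL z) * modulus (W z))) by ring.
rewrite -[leRHS]mulrA ler_pM2l//.
rewrite [leRHS]mulrC; apply: ler_pM => //; by rewrite mulr_ge0// ltW.
Qed.

End family.

Lemma test_functions (p s : R) : 0 < p -> 0 < s -> 1 < s + p -> exists2 C : R, 0 < C &
  forall zeta N, modulus zeta = 1 -> exists f df,
  [/\ holo f df, energy_le p s df C,
      forall z, modulus z < 1 -> 2 ^+ N * modulus (zeta - z) <= 9 ->
        N.+1%:R / 10 ^+ 4 <= modulus (f z) &
      forall z r, modulus z <= r -> r < 1 -> modulus (f z) <= 4 / (1 - r) ^+ 2 / N.+1%:R].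
Proof.
move=> p0 s0 ps1; have [c c0 Hc] := energy_of_kernel p0 s0 ps1.
have q1 : 1 < 2 :> R by rewrite ltr1n.
have [c1 c10 Hc1] := min_geometric q1.
exists (c * (2 * c1) `^ p) => [|zeta N z1]; first by rewrite mulr_gt0 ?powR_gt0 ?mulr_gt0.
do 2!eexists; split.
- exact: (@test_holo zeta N z1).
- apply: (Hc zeta) => //; first by rewrite mulr_ge0 ?(ltW c10).
  exact: test_deriv.
- move=> z zlt h; apply: test_large => //; apply: le_trans h.
  rewrite ler_wpM2l ?exprn_ge0//.
  have -> : 1 - zeta^*%C * z = zeta^*%C * (zeta - z).
    by rewrite mulrBr conj_unit.
  by rewrite modulusM modulus_conj z1 mul1r.
- by move=> z r zr r1; exact: test_small.
Qed.

End test_family.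

(** * Norms and compact convergence *)

Section interface.
Context {R : realType}.
Local Notation C := (R[i]^o).
Implicit Types (w : plane R) (a z zeta : R[i]) (f : C -> C).
Implicit Types (mu : {measure set (plane R) -> \bar R}) (I : circle_arc R).

Lemma analytic_holo f : analytic f -> holo f (fun z => 'D_1 f z).
Proof. by move=> af z z1; apply: derivable_cdiff; exact: af. Qed.

Lemma holo_analytic f (df : R[i] -> R[i]) : holo f df ->
  analytic f /\ forall z, modulus z < 1 -> 'D_1 f z = df z.
Proof.
move=> hf; split=> z z1; have d := cdiff_derive (hf z z1).
  exact: ex_derive.
exact: derive_val.
Qed.

Lemma energy_le_ext (p s L : R) (df dg : R[i] -> R[i]) :
  (forall z, modulus z < 1 -> df z = dg z) -> energy_le p s df L -> energy_le p s dg L.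
Proof.
move=> E H a a1; apply: le_trans (H a a1); rewrite le_eqVlt; apply/orP; left; apply/eqP.
by apply: eq_integral => w; rewrite inE => wd; rewrite /dens E.
Qed.

Lemma powR_inv_cancel (p x : R) : 0 < p -> 0 <= x -> (x `^ p^-1) `^ p = x.
Proof. by move=> p0 x0; rewrite -powRrM mulVf ?gt_eqF// powRr1. Qed.

Lemma powR_cancel (p x : R) : 0 < p -> 0 <= x -> (x `^ p) `^ p^-1 = x.
Proof. by move=> p0 x0; rewrite -powRrM mulfV ?gt_eqF// powRr1. Qed.

(** Both [F_seminorm] and [T_norm] are p-th roots of suprema; this turns bounds on them into bounds
    on single terms. *)
Lemma ereal_sup_powR_le (p B : R) (S : set (\bar R)) : 0 < p -> 0 <= B -> S !=set0 ->
  (forall x, S x -> (0 <= x)%E) ->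
  ((ereal_sup S `^ p^-1 <= B%:E)%E <-> forall x, S x -> (x <= (B `^ p)%:E)%E).
Proof.
move=> p0 B0 [x0 Sx0] S0; have s0 : (0 <= ereal_sup S)%E.
  by apply: le_trans (S0 _ Sx0) _; exact: ereal_sup_ubound.
have pV : 0 < p^-1 by rewrite invr_gt0.
rewrite -[X in iff _ X]/(ubound S (B `^ p)%:E).
have -> : (ereal_sup S `^ p^-1 <= B%:E)%E <-> (ereal_sup S <= (B `^ p)%:E)%E.
  case: (ereal_sup S) s0 => [x||] // xge.
    rewrite poweR_EFin !lee_fin; split=> h.
      rewrite -(powR_inv_cancel p0 xge); apply: ge0_ler_powR; rewrite ?nnegrE ?powR_ge0 ?(ltW p0)//.
    rewrite -[leRHS](powR_cancel p0 B0); apply: ge0_ler_powR; rewrite ?nnegrE ?powR_ge0 ?(ltW pV)//.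
  by rewrite poweRyr ?gt_eqF// !leye_eq.
split=> [h x Sx|h]; first by apply: le_trans h; exact: ereal_sup_ubound.
exact: ge_ereal_sup.
Qed.

Lemma F_seminorm_le (p s N : R) f : 0 < p -> 0 <= N ->
  ((F_seminorm p (p - 2) s f <= N%:E)%E <-> energy_le p s (fun z => 'D_1 f z) (N `^ p)).
Proof.
move=> p0 N0; rewrite /F_seminorm ereal_sup_powR_le//; first last.
- by move=> x [a _ <-]; apply: integral_ge0 => w _; rewrite lee_fin !mulr_ge0 ?powR_ge0.
- by eexists; exists 0 => //; rewrite /unit_disk /= modulus0.
split=> [H a a1|H x [a a1 <-]]; last exact: H.
by apply: H; exists a.
Qed.

Lemma F_seminorm_fin (p s : R) f : 0 < p -> (F_seminorm p (p - 2) s f < +oo)%E ->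
  exists2 N, 0 <= N & F_seminorm p (p - 2) s f = N%:E.
Proof.
move=> p0; have := poweR_ge0 (ereal_sup [set \int[area]_(w in disk)
     (modulus ('D_1 f (cplx w)) `^ p
      * (1 - modulus (cplx w) ^+ 2) `^ (p - 2)
      * (1 - modulus (mobius a (cplx w)) ^+ 2) `^ s)%R%:E
     | a in @unit_disk R])%E p^-1.
rewrite -/(F_seminorm p (p - 2) s f).
by case: F_seminorm => [x||]// x0 _; exists x.
Qed.

Definition T_term (p s : R) mu f I : \bar R :=
  (((arc_len I `^ s)^-1)%:E * \int[mu]_(w in carleson_box I) (modulus (f (cplx w)) `^ p)%:E)%E.

Lemma T_term_ge0 p s mu f I : (0 <= T_term p s mu f I)%E.
Proof.
rewrite mule_ge0 ?lee_fin ?invr_ge0 ?powR_ge0//.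
by apply: integral_ge0 => w _; rewrite lee_fin powR_ge0.
Qed.

Lemma full_arc_subproof : (0 : R) < 1 /\ (1 : R) <= 1.
Proof. by rewrite ltr01 lexx. Qed.

(** Its box is the punctured disk, which gives access to the total mass away from the origin. *)
Definition full_arc : circle_arc R :=
  CircleArc 0 true true full_arc_subproof.1 full_arc_subproof.2.

Lemma T_norm_le (p s B : R) mu f : 0 < p -> 0 <= B ->
  ((T_norm p s mu f <= B%:E)%E <-> forall I, (T_term p s mu f I <= (B `^ p)%:E)%E).
Proof.
move=> p0 B0; rewrite /T_norm ereal_sup_powR_le//; first last.
- by move=> x [I _ <-]; exact: T_term_ge0.
- by eexists; exists full_arc.
split=> [H I|H x [I _ <-]]; last exact: H.
by apply: H; exists I.
Qed.

Lemma T_norm_ge0 p s mu f : (0 <= T_norm p s mu f)%E.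
Proof. exact: poweR_ge0. Qed.

Lemma measurable_analytic f : analytic f ->
  measurable_fun (@disk R) (fun w => Re (f (cplx w))) /\
  measurable_fun (@disk R) (fun w => Im (f (cplx w))).
Proof.
move=> /analytic_holo hf; have mD := @measurable_disk R.
have [|_ mr mi] := @modulus_continuous_measurable _ (@disk R) f mD; last by split.
by move=> w w1; exact: cdiff_continuous (hf _ w1).
Qed.

(** Extending f by 0 outside the disk gives a Borel function of the plane that agrees with it at
    every point of the disk. *)
Lemma analytic_mu_measurable mu f : analytic f -> mu_measurable mu f.
Proof.
move=> /measurable_analytic[mr mi]; have mD := @measurable_disk R.
exists (fun w => ((fun w => Re (f (cplx w))) \_ (@disk R) w, (fun w => Im (f (cplx w))) \_ (@disk R) w)).
  apply: measurable_fun_pair.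
    exact/(measurable_restrictT (fun w => Re (f (cplx w))) mD).
  exact/(measurable_restrictT (fun w => Im (f (cplx w))) mD).
apply: aeW => w wd; rewrite /cplx /= !patchE mem_set//=.
by case: (f _).
Qed.

Lemma ball_modulus (x y : C) (e : R) : ball x e%:C y <-> modulus (x - y) < e.
Proof. by rewrite -ball_normE /= -modulusE ltcR. Qed.

Lemma unif_on_compact (f : nat -> C -> C) (K : set C) (e : R) :
  cvg_unif_on_compacts f (fun=> 0) -> compact K -> K `<=` @unit_disk R -> 0 < e ->
  exists N, forall n, (N <= n)%N -> forall z, K z -> modulus (f n z) < e.
Proof.
move=> H cK KD e0.
have := H K cK KD [set h : {uniform` K -> C} | forall y, K y -> ball (0 : C) e%:C (h y)].
case.
  apply/uniform_nbhs; exists [set xy : C * C | ball xy.1 e%:C xy.2]; split => //.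
  have e0' : 0 < e%:C :> R[i] by rewrite ltcR.
  exact: (entourage_ball C (PosNum e0')).
move=> N _ HN; exists N => n Nn z Kz.
by have /ball_modulus := HN n Nn z Kz; rewrite sub0r modulusN.
Qed.

Lemma compact_in_disk (K : set C) : compact K -> K `<=` @unit_disk R ->
  exists2 r : R, r < 1 & forall z, K z -> modulus z <= r.
Proof.
move=> cK KD; have [->|/set0P K0] := eqVneq K set0; first by exists 0.
have cm : {within K, continuous (fun z : C => modulus z : R)}.
  apply: continuous_subspaceT => z.
  apply/(@cvgrPdist_lt _ _ _ (nbhs (z : C)) (nbhs_filter (z : C))) => e e0.
  have e0' : 0 < e%:C :> R[i] by rewrite ltcR.
  have := @nbhsx_ballx _ C z e%:C e0'; apply: filterS => y /ball_modulus.
  exact: le_lt_trans (modulus_dist _ _).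
have [c cK' Hc] := compact_EVT_max K0 cK cm.
exists (modulus c); first by apply: KD; rewrite inE in cK'.
by move=> z Kz; apply: Hc; rewrite inE.
Qed.

Lemma unif_on_compacts_of_disks (f : nat -> C -> C) :
  (forall r e : R, r < 1 -> 0 < e -> exists N, forall n, (N <= n)%N ->
     forall z, modulus z <= r -> modulus (f n z) < e) ->
  cvg_unif_on_compacts f (fun=> 0).
Proof.
move=> H K cK KD; have [r r1 Kr] := compact_in_disk cK KD.
move=> P /uniform_nbhs[E [entE sub]].
move: entE; rewrite -entourage_ballE => -[e /= e0 He].
(* Radii are elements of [R[i]]; being positive makes them real. *)
have eE : e = (Re e)%:C.
  by move: e0; rewrite ltcE /= => /andP[/eqP ie _]; case: e ie {He} => a b /= ->.
have e1 : 0 < Re e by move: e0; rewrite ltcE /= => /andP[].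
have [N HN] := H r (Re e) r1 e1.
exists N => // n Nn; apply: sub => z Kz; apply: He => /=.
by rewrite eE; apply/ball_modulus; rewrite sub0r modulusN; apply: HN => //; exact: Kr.
Qed.

End interface.

(** * Boundedness *)

Section boundedness.
Context {R : realType}.
Local Notation C := (R[i]^o).
Implicit Types (w : plane R) (z zeta : R[i]) (f : C -> C).
Implicit Types (mu : {measure set (plane R) -> \bar R}) (I : circle_arc R).

Lemma log_carleson_ratio_ge0 (p s : R) mu I : (0 <= log_carleson_ratio p s mu I)%E.
Proof. by rewrite mule_ge0// lee_fin mulr_ge0 ?invr_ge0 ?powR_ge0. Qed.

Lemma log_carlesonP (p s : R) mu : log_carleson p s mu <->
  exists2 K, 0 <= K & forall I, (log_carleson_ratio p s mu I <= K%:E)%E.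
Proof.
rewrite /log_carleson; set S := [set _ | _ in _]; split=> [|[K K0 H]]; last first.
  apply: (@le_lt_trans _ _ K%:E); last by rewrite ltry.
  by apply: ge_ereal_sup => x [I _ <-].
have ub I : (log_carleson_ratio p s mu I <= ereal_sup S)%E.
  by apply: ereal_sup_ubound; exists I.
have : (0 <= ereal_sup S)%E.
  exact: le_trans (log_carleson_ratio_ge0 p s mu full_arc) (ub _).
by case: (ereal_sup S) ub => [K||] // ub K0 _; exists K.
Qed.

Lemma F_normE (p s : R) f (M : R) : 0 < p -> F_space p (p - 2) s f ->
  (F_norm p (p - 2) s f <= M%:E)%E ->
  exists N, [/\ 0 <= N, modulus (f 0) + N <= M & energy_le p s (fun z => 'D_1 f z) (N `^ p)].
Proof.
move=> p0 [_ fin]; have [N N0 NE] := F_seminorm_fin p0 fin.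
rewrite /F_norm NE -EFinD lee_fin => h; exists N; split => //.
by apply: (F_seminorm_le s f p0 N0).1; rewrite NE.
Qed.

Lemma powRD_le_twice (p a b M : R) : 0 < p -> 0 <= a -> 0 <= b -> a + b <= M ->
  a `^ p + b `^ p <= 2 * M `^ p.
Proof.
move=> p0 a0 b0 abM; rewrite mulr2n mulrDl mul1r.
by apply: lerD; apply: ge0_ler_powR; rewrite ?nnegrE ?(ltW p0)//; lra.
Qed.

Lemma T_norm_bound (p s : R) : 0 < p -> 0 < s -> exists2 c : R, 0 < c &
  forall mu K f (M : R), 0 <= K -> 0 <= M ->
  (forall I, (log_carleson_ratio p s mu I <= K%:E)%E) -> F_space p (p - 2) s f ->
  (F_norm p (p - 2) s f <= M%:E)%E ->
  forall I, (T_term p s mu f I <= (c * K * M `^ p)%:E)%E.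
Proof.
move=> p0 s0; have [c c0 Hc] := box_embedding p0 s0.
exists (2 * c) => [|mu K f M K0 M0 HK Ff FM I]; first by rewrite mulr_gt0.
have [N [N0 fN eN]] := F_normE p0 Ff FM.
apply: le_trans (Hc mu K f _ _ I K0 HK (analytic_holo Ff.1) eN) _.
have h := powRD_le_twice p0 (modulus_ge0 _) N0 fN.
rewrite lee_fin; have -> : 2 * c * K * M `^ p = c * K * (2 * M `^ p) by ring.
by rewrite ler_wpM2l// mulr_ge0// ltW.
Qed.

Lemma bounded_of_log_carleson (p s : R) mu : 0 < p -> 0 < s ->
  log_carleson p s mu -> identity_bounded p (p - 2) s mu.
Proof.
move=> p0 s0 /log_carlesonP[K K0 HK]; have [c c0 Hc] := T_norm_bound p0 s0.
(* The constant in [identity_bounded] must be positive, while [K] may be 0. *)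
have K1 : 0 < K + 1 by rewrite ltr_wpDl.
have HK1 I : (log_carleson_ratio p s mu I <= (K + 1)%:E)%E.
  by apply: le_trans (HK I) _; rewrite lee_fin lerDl.
pose B := (c * (K + 1)) `^ p^-1; have B0 : 0 < B by rewrite powR_gt0// mulr_gt0.
exists B => // f Ff; have [af finf] := Ff.
have [N N0 NE] := F_seminorm_fin p0 finf.
have FE : F_norm p (p - 2) s f = (modulus (f 0) + N)%:E by rewrite /F_norm NE -EFinD.
have M0 : 0 <= modulus (f 0) + N by rewrite addr_ge0 ?modulus_ge0.
have TN : (T_norm p s mu f <= (B * (modulus (f 0) + N))%:E)%E.
  apply/T_norm_le => //; first by rewrite mulr_ge0 ?(ltW B0).
  move=> I; rewrite powRM ?(ltW B0)// powR_inv_cancel ?mulr_ge0 ?(ltW c0) ?(ltW K1)//.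
  by apply: Hc => //; [exact: ltW|rewrite FE].
split; last by rewrite FE -EFinM.
split; first exact: analytic_mu_measurable.
by apply: le_lt_trans TN _; rewrite ltry.
Qed.

Lemma ln_arc_le I N : 2 ^- N / 2 < arc_len I -> ln (2 / arc_len I) <= 2 * N.+1%:R.
Proof.
move=> h; have l0 := arc_len_gt0 I.
have e0 : 0 < 2 ^- N / 2 :> R by rewrite divr_gt0// pow2V_gt0.
have : 2 / arc_len I <= 2 ^+ N.+2.
  rewrite ler_pdivrMr// -ler_pdivrMl ?exprn_gt0//.
  apply: ltW; apply: le_lt_trans h; rewrite !exprS; rewrite le_eqVlt; apply/orP; left; apply/eqP.
  by field; rewrite expf_neq0.
move=> hl; apply: le_trans (_ : ln (2 ^+ N.+2) <= _).
  by rewrite ler_ln ?posrE ?divr_gt0 ?exprn_gt0.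
rewrite lnXn//.
have ln2 : ln 2 <= 1 :> R.
  by have := @le_ln1Dx R 1; rewrite (_ : 1 + 1 = 2) //; apply; lra.
rewrite -[leLHS]mulr_natl; apply: le_trans (_ : N.+2%:R * 1 <= _); first by rewrite ler_wpM2l.
by rewrite mulr1 -natrM ler_nat; lia.
Qed.

(** On the box |f| is at least (N+1)/10^4, and N+1 is at least half of log (2/|I|) by [ln_arc_le];
    the p-th power of the logarithm is thus produced by the integral of |f|^p. *)
Lemma ratio_le_test (p s : R) : 0 < p -> 0 < s -> exists2 A : R, 0 < A &
  forall mu I f N, 2 ^- N / 2 < arc_len I -> arc_len I <= 2 ^- N ->
  (forall z, modulus z < 1 -> 2 ^+ N * modulus (arc_mid I - z) <= 9 ->
     N.+1%:R / 10 ^+ 4 <= modulus (f z)) ->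
  (log_carleson_ratio p s mu I <= A%:E * T_term p s mu f I)%E.
Proof.
move=> p0 s0; pose q : R := 10 ^+ 4; have q0 : 0 < q by rewrite exprn_gt0.
exists ((2 * q) `^ p) => [|mu I f N h1 h2 H]; first by rewrite powR_gt0// mulr_gt0.
rewrite -/q in H.
have N0 : 0 < N.+1%:R :> R by rewrite ltr0n.
pose m := (N.+1%:R / q) `^ p.
have m0 : 0 <= m by exact: powR_ge0.
have mb := @measurable_box R I.
have b1 : (m%:E * mu (carleson_box I) <=
    \int[mu]_(w in carleson_box I) (modulus (f (cplx w)) `^ p)%:E)%E.
  rewrite -(integral_cst mu mb); apply: ge0_le_integralW => // w bw.
  - by rewrite lee_fin powR_ge0.
  have [/andP[_ w1] _] := bw.
  rewrite lee_fin; apply: ge0_ler_powR; rewrite ?nnegrE ?(ltW p0) ?modulus_ge0 ?divr_ge0 ?(ltW N0) ?(ltW q0)//.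
  apply: H => //; have wn : modulus (arc_mid I - (cplx w : R[i])) < 9 * arc_len I := box_near bw.
  have e0 : 0 < 2 ^+ N :> R by rewrite exprn_gt0.
  rewrite -ler_pdivlMl// mulrC; apply: le_trans (ltW wn) _; by rewrite ler_wpM2l.
have l0 : 0 <= (arc_len I `^ s)^-1 by rewrite invr_ge0 powR_ge0.
rewrite /log_carleson_ratio EFinM -muleA /T_term [X in (_ <= X)%E]muleCA.
apply: lee_wpmul2l; first by rewrite lee_fin.
apply: le_trans (lee_wpmul2l _ b1); last by rewrite lee_fin powR_ge0.
rewrite muleA -EFinM; apply: lee_wpmul2r => //; rewrite lee_fin /m.
rewrite -powRM ?divr_ge0 ?mulr_ge0 ?(ltW q0) ?(ltW N0)//.
have -> : 2 * q * (N.+1%:R / q) = 2 * N.+1%:R.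
  by rewrite -mulrA; congr (_ * _); rewrite mulrCA divff ?gt_eqF// mulr1.
by apply: ge0_ler_powR; rewrite ?nnegrE ?(ltW p0) ?(ltW (ln_arc_gt0 I)) ?mulr_ge0 ?(ltW N0)//; exact: ln_arc_le.
Qed.

Lemma test_functions_arc (p s : R) : 0 < p -> 0 < s -> 1 < s + p -> exists2 B : R, 0 < B &
  forall I, exists f N, [/\ F_space p (p - 2) s f, (F_norm p (p - 2) s f <= B%:E)%E,
    2 ^- N / 2 < arc_len I, arc_len I <= 2 ^- N &
    (forall z, modulus z < 1 -> 2 ^+ N * modulus (arc_mid I - z) <= 9 ->
       N.+1%:R / 10 ^+ 4 <= modulus (f z)) /\
    (forall z r, modulus z <= r -> r < 1 -> modulus (f z) <= 4 / (1 - r) ^+ 2 / N.+1%:R)].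
Proof.
move=> p0 s0 ps1; have [D D0 HD] := test_functions p0 s0 ps1.
(* The 4 bounds |f 0|, by the estimate on compact sets at r = 0. *)
exists (4 + D `^ p^-1) => [|I]; first by rewrite addr_gt0// powR_gt0.
have [N N1 N2] := dyadic_scale (arc_len_gt0 I) (arc_len_le1 I).
have [f [df [hf eD Hl Hs]]] := HD _ N (modulus_circle_pt (arc_start I + arc_len I / 2)).
have [af fE] := holo_analytic hf.
have sem : (F_seminorm p (p - 2) s f <= (D `^ p^-1)%:E)%E.
  apply: (F_seminorm_le s f p0 (powR_ge0 _ _)).2; rewrite powR_inv_cancel ?(ltW D0)//.
  by apply: energy_le_ext eD => z z1; rewrite fE.
exists f, N; split => //.
- by split => //; apply: le_lt_trans sem _; rewrite ltry.
- rewrite /F_norm EFinD leeD// lee_fin.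
  have := Hs 0 0; rewrite modulus0 subr0 expr1n divr1 => /(_ (lexx _) ltr01).
  move/le_trans; apply; rewrite ler_pdivrMr ?ltr0n// ler_peMr// ler1n//.
Qed.

Lemma log_carleson_of_bounded (p s : R) mu : 0 < p -> 0 < s -> 1 < s + p ->
  identity_bounded p (p - 2) s mu -> log_carleson p s mu.
Proof.
move=> p0 s0 ps1 [c c0 Hc]; have [A A0 HA] := ratio_le_test p0 s0.
have [B B0 HB] := test_functions_arc p0 s0 ps1.
apply/log_carlesonP; exists (A * (c * B) `^ p).
  by rewrite mulr_ge0 ?powR_ge0// ltW.
move=> I; have [f [N [Ff FB N1 N2 [Hl _]]]] := HB I.
apply: le_trans (HA mu I f N N1 N2 Hl) _.
have [_ TN] := Hc f Ff; rewrite EFinM; apply: lee_wpmul2l; first by rewrite lee_fin ltW.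
have cB : 0 <= c * B by rewrite mulr_ge0// ltW.
apply: (T_norm_le s mu f p0 cB).1; apply: le_trans TN _.
by rewrite EFinM lee_wpmul2l// lee_fin ltW.
Qed.

End boundedness.

(** * Compactness *)

Section vanishing.
Context {R : realType}.
Local Notation C := (R[i]^o).
Implicit Types (w : plane R) (z zeta : R[i]).
Implicit Types (mu : {measure set (plane R) -> \bar R}) (I : circle_arc R).

Lemma ereal_cvg0P (u : nat -> \bar R) : (forall n, (0 <= u n)%E) ->
  (u @ \oo --> 0%E) <->
  forall e : R, 0 < e -> exists N, forall n, (N <= n)%N -> (u n <= e%:E)%E.
Proof.
move=> u0; split=> [H e e0|H P [e /= e0 He]].
  have : nbhs (0%E : \bar R) [set x | (x <= e%:E)%E].
    exists e => // x; rewrite /ball_ /= sub0r normrN lee_fin => h.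
    by apply: le_trans (ltW h); exact: ler_norm.
  by move=> /H[N _ HN]; exists N => n Nn; exact: HN.
have e2 : 0 < e / 2 by rewrite divr_gt0.
have [N HN] := H _ e2; exists N => // n Nn.
move: (HN n Nn) (u0 n); rewrite /preimage /=; case: (u n) => [x||] //.
rewrite !lee_fin => h x0; apply: (He x) => /=.
by rewrite sub0r normrN ger0_norm//; lra.
Qed.

(** The closed disk is the image of a real rectangle under polar coordinates. *)
Lemma compact_disk_closed (r : R) : compact ([set z | modulus z <= r] : set C).
Proof.
have [r0|r0] := ltP r 0.
  rewrite (_ : [set z | _] = set0); first exact: compact0.
  apply/seteqP; split => z //= h; have := modulus_ge0 z; lra.
pose F (x : R * R) : C := (x.1)%:C * circle_pt x.2.
rewrite (_ : [set z | _] = F @` (`[0, r]%classic `*` `[0, 1]%classic)).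
  apply: continuous_compact; last by apply: compact_setX; exact: segment_compact.
  apply: continuous_subspaceT => x.
  have cr : {for x, continuous (fun y : R * R => y.1 * cos (2 * pi * y.2))}.
    apply: cvgM; first exact: cvg_fst.
    apply: (@continuous_comp _ _ _ (fun y : R * R => 2 * pi * y.2) cos); last exact: continuous_cos.
    by apply: cvgM; [exact: cvg_cst|exact: cvg_snd].
  have ci : {for x, continuous (fun y : R * R => y.1 * sin (2 * pi * y.2))}.
    apply: cvgM; first exact: cvg_fst.
    apply: (@continuous_comp _ _ _ (fun y : R * R => 2 * pi * y.2) sin); last exact: continuous_sin.
    by apply: cvgM; [exact: cvg_cst|exact: cvg_snd].
  move=> P /nbhs_ballP[e e0 He].
  have eE : e = (Re e)%:C.
    by move: e0; rewrite /= ltcE /= => /andP[/eqP ie _]; case: e ie {He} => a b /= ->.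
  have e1 : 0 < Re e / 2 by move: e0; rewrite /= ltcE /= => /andP[_ ?]; rewrite divr_gt0.
  have n1 : nbhs x [set y : R * R | ball (x.1 * cos (2 * pi * x.2)) (Re e / 2)
      (y.1 * cos (2 * pi * y.2))] := cr _ (nbhsx_ballx _ _ e1).
  have n2 : nbhs x [set y : R * R | ball (x.1 * sin (2 * pi * x.2)) (Re e / 2)
      (y.1 * sin (2 * pi * y.2))] := ci _ (nbhsx_ballx _ _ e1).
  suff : nbhs x (F @^-1` P) by [].
  apply: filterS2 n1 n2 => y h1 h2; apply: He; rewrite eE; apply/ball_modulus.
  apply: le_lt_trans (modulus_le_ReIm _) _.
  have FE (v : R * R) : F v = (v.1 * cos (2 * pi * v.2)) +i* (v.1 * sin (2 * pi * v.2)).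
    by rewrite /F /circle_pt; simpc.
  rewrite !FE /=; move: h1 h2; rewrite /ball /= /ball_ /= => h1 h2; lra.
apply/seteqP; split => [z /= zr|z [[rho t] /= [h1 h2] <-]]; last first.
  rewrite /F /= modulusM modulusC modulus_circle_pt mulr1.
  by move: h1; rewrite in_itv /= => /andP[? ?]; rewrite ger0_norm.
have [u u1 zE] := polar z; have [t th tE] := circle_pt_surj 2^-1 u1.
exists (modulus z, t); last by rewrite /F /= -tE -zE.
split; rewrite /= in_itv /= ?modulus_ge0//.
by move: th; rewrite ler_norml => /andP[]; lra.
Qed.

Lemma pdisk_full : @pdisk R `<=` carleson_box (@full_arc R).
Proof.
move=> w wp; have w0 := pdisk_neq0 wp; have /andP[h1 h2] := wp.
have [u1 zE] := unit_polar w0 erefl.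
split; first by rewrite /= subrr; apply/andP.
have [t th tE] := circle_pt_surj 2^-1 u1; exists t; last by rewrite -tE.
rewrite /arc_param /= in_itv /= add0r.
by move: th; rewrite ler_norml => /andP[]; lra.
Qed.

(** Arcs of length at least d have bounded factors in the ratio, so for them only the mass of the
    box counts. *)
Lemma ratio_big (p s : R) mu I (d m : R) : 0 < p -> 0 < s -> 0 < d -> d <= arc_len I -> 0 <= m ->
  (mu (carleson_box I) <= m%:E)%E ->
  (log_carleson_ratio p s mu I <= (d `^ (- s) * ln (2 / d) `^ p * m)%:E)%E.
Proof.
move=> p0 s0 d0 dl m0 hm; have l0 := arc_len_gt0 I.
have ln0 := ln_arc_gt0 I.
have hln : ln (2 / arc_len I) <= ln (2 / d).
  by rewrite ler_ln ?posrE ?divr_gt0// ler_pM2l// lef_pV2 ?posrE.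
rewrite /log_carleson_ratio [leRHS]EFinM; apply: lee_pmul => //.
  by rewrite lee_fin mulr_ge0 ?invr_ge0 ?powR_ge0.
rewrite lee_fin -powRN; apply: ler_pM; rewrite ?powR_ge0//.
  by apply: powRN_le => //; exact: ltW.
by apply: ge0_ler_powR; rewrite ?nnegrE ?(ltW p0) ?(ltW ln0) ?(le_trans (ltW ln0) hln).
Qed.

Lemma full_box_finite (p s : R) mu : log_carleson p s mu ->
  (mu (carleson_box (@full_arc R)) < +oo)%E.
Proof.
move=> /log_carlesonP[K K0 HK]; apply: le_lt_trans ((ratio_box p s mu full_arc K).1 (HK _)) _.
by rewrite ltry.
Qed.

Lemma measurable_outer (r : R) : measurable [set w : plane R | r <= modulus (cplx w)].
Proof.
rewrite (_ : [set w | _] = [set w : plane R | modulus (cplx w) \in `[r, +oo[]).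
  exact: measurable_modulus_itv.
by apply/seteqP; split => w /=; rewrite in_itv /= andbT.
Qed.

Lemma tail_small mu (e : R) : (mu (carleson_box (@full_arc R)) < +oo)%E -> 0 < e ->
  exists r : R, [/\ 0 < r, r < 1 &
    (mu (@pdisk R `&` [set w | r <= modulus (cplx w)]%R) <= e%:E)%E].
Proof.
move=> fin e0.
(* The exponent n+1 keeps the inner radius positive. The sets decrease to the empty set, and
   finiteness of the mass gives continuity from above. *)
pose F n := @pdisk R `&` [set w : plane R | 1 - 2 ^- n.+1 <= modulus (cplx w)].
have mF n : measurable (F n).
  by apply: measurableI; [exact: measurable_pdisk|exact: measurable_outer].
have F0 : \bigcap_n F n = set0.
  apply/seteqP; split => w // H; have [/andP[_ w1] _] := H 0%N I.
  have d0 : 0 < 1 - modulus (cplx w) by rewrite subr_gt0.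
  have [N hN] := pow2V_small d0; have [_ /= h] := H N I.
  have := @pow2VS R N; have := @pow2V_gt0 R N; lra.
have cv : mu \o F @ \oo --> 0%E.
  rewrite -(measure0 mu) -F0; apply: nonincreasing_cvg_mu => //.
  - apply: le_lt_trans fin; apply: le_measure; rewrite ?inE//; first exact: measurable_box.
    by move=> w [/pdisk_full].
  - by rewrite F0; exact: measurable0.
  move=> m n mn; apply/subsetPset => w [wp /= h]; split => //=.
  apply: le_trans h; rewrite lerB// lef_pV2 ?posrE ?exprn_gt0//.
  by rewrite ler_weXn2l ?ler1n.
have [N HN] := (ereal_cvg0P (fun n => measure_ge0 mu (F n))).1 cv e e0.
exists (1 - 2 ^- N.+1); split; last exact: HN.
  have := @pow2VS R N; have : 2 ^- N <= 1 :> R.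
    by rewrite invf_le1 ?exprn_gt0// exprn_ege1// ler1n.
  lra.
by have := @pow2V_gt0 R N.+1; lra.
Qed.

(** Short arcs are handled by the vanishing condition, as restricting [mu] only lowers the ratio;
    for long arcs the whole restricted mass is small by [tail_small]. *)
Lemma tail_ratio (p s : R) mu (eta : R) : 0 < p -> 0 < s -> vanishing_log_carleson p s mu -> 0 < eta ->
  exists2 r : R, r < 1 & forall I,
    (log_carleson_ratio p s (mrestr mu (measurable_outer r)) I <= eta%:E)%E.
Proof.
move=> p0 s0 [lc van] eta0; have [d d0 Hd] := van eta eta0.
have fin := full_box_finite lc.
pose d' := Num.min d 1; have d'0 : 0 < d' by rewrite lt_min d0 ltr01.
pose k := d' `^ (- s) * ln (2 / d') `^ p.
have k0 : 0 <= k by rewrite mulr_ge0 ?powR_ge0.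
have k1 : 0 < k + 1 by rewrite ltr_wpDl.
have ek : 0 < eta / (k + 1) by rewrite divr_gt0.
have [r [r0 r1 Hr]] := tail_small fin ek; exists r => // I.
have [Id|Id] := ltP (arc_len I) d'.
  have := Hd I (lt_le_trans Id _); rewrite ge_min lexx => /(_ isT)/ltW; apply: le_trans.
  rewrite /log_carleson_ratio; apply: lee_wpmul2l.
    by rewrite lee_fin mulr_ge0 ?invr_ge0 ?powR_ge0.
  rewrite /= /mrestr; apply: le_measure; rewrite ?inE.
  - by apply: measurableI; [exact: measurable_box|exact: measurable_outer].
  - exact: measurable_box.
  - exact: subIsetl.
apply: le_trans (@ratio_big p s _ I d' (eta / (k + 1)) p0 s0 d'0 Id (ltW ek) _) _.
  apply: le_trans Hr; rewrite /= /mrestr; apply: le_measure; rewrite ?inE.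
  - by apply: measurableI; [exact: measurable_box|exact: measurable_outer].
  - by apply: measurableI; [exact: measurable_pdisk|exact: measurable_outer].
  - by move=> w [/box_pdisk].
rewrite lee_fin -/k mulrCA ler_piMr ?(ltW eta0)// ler_pdivrMr// mul1r lerDl//.
Qed.

Lemma vanishing_compactness (p s : R) mu (f : nat -> C -> C) : 0 < p -> 0 < s ->
  vanishing_log_carleson p s mu -> F_bounded p (p - 2) s f ->
  cvg_unif_on_compacts f (fun=> 0) -> (fun n => T_norm p s mu (f n)) @ \oo --> 0%E.
Proof.
move=> p0 s0 van [Ff [M0 HM0]] cv.
have [lc _] := van; have [K K0 HK] := (log_carlesonP p s mu).1 lc.
have [c c0 Hc] := T_norm_bound p0 s0.
pose M := `|M0|; have HM n : (F_norm p (p - 2) s (f n) <= M%:E)%E.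
  by apply: le_trans (HM0 n) _; rewrite lee_fin ler_norm.
have M_ge0 : 0 <= M by exact: normr_ge0.
apply/(ereal_cvg0P (fun n => T_norm_ge0 p s mu (f n))) => e e0.
have ep : 0 < e `^ p by rewrite powR_gt0.
(* Since log (2/|I|) >= ln 2, this bounds |I|^-s mu(S(I)) for all arcs. *)
pose K' := K * (ln 2) `^ (- p); have K'0 : 0 <= K' by rewrite mulr_ge0 ?powR_ge0.
pose X := c * M `^ p; have X0 : 0 <= X by rewrite mulr_ge0 ?powR_ge0// ltW.
(* [eta] makes the outer part contribute at most e^p/2 through [T_norm_bound], and [th], the uniform
   bound on |z| <= r, does the same for the inner part. *)
pose eta := e `^ p / 2 / (X + 1); have eta0 : 0 < eta by rewrite !divr_gt0// ltr_wpDl.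
pose th := (e `^ p / 2 / (K' + 1)) `^ p^-1.
have th0 : 0 < th by rewrite powR_gt0// !divr_gt0// ltr_wpDl.
have thp : th `^ p = e `^ p / 2 / (K' + 1).
  by rewrite powR_inv_cancel// !divr_ge0 ?powR_ge0// addr_ge0.
have [r r1 Hr] := tail_ratio p0 s0 van eta0.
have sub : [set z | modulus z <= r] `<=` @unit_disk R.
  by move=> z /= h; exact: le_lt_trans r1.
have [N HN] := unif_on_compact cv (@compact_disk_closed r) sub th0.
exists N => n Nn; apply/T_norm_le => //; first exact: ltW.
move=> I; set nu : {measure set (plane R) -> \bar R} := mrestr mu (measurable_outer r).
pose E := [set w : plane R | r <= modulus (cplx w)].
have mE : measurable E by exact: measurable_outer.
pose B := carleson_box I; have mB : measurable B by exact: measurable_box.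
pose g w := (modulus (f n (cplx w)) `^ p)%:E.
have g0 w : (0 <= g w)%E by rewrite lee_fin powR_ge0.
have Bd : B `<=` @disk R by move=> w /box_pdisk/pdisk_disk.
have mg : measurable_fun B g.
  apply/measurable_EFinP; apply: (measurableT_comp (measurable_powR p)).
  have hf := analytic_holo (Ff n).1; apply: measurable_funS Bd _; first exact: measurable_disk.
  have [|h _ _ //] := @modulus_continuous_measurable _ (@disk R) (f n) (@measurable_disk R).
  by move=> w w1; exact: cdiff_continuous (hf _ w1).
have l0 : 0 <= (arc_len I `^ s)^-1 by rewrite invr_ge0 powR_ge0.
(* Off [E] the function is below [th]; on [E] the measures [mu] and [nu] coincide. *)
have split_int : (\int[mu]_(w in B) g w <=
    (th `^ p)%:E * mu B + \int[nu]_(w in B) g w)%E.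
  have mC : measurable (~` E) by exact: measurableC.
  rewrite -{1}(setIT B) -(setUv E) setIUr setUC ge0_integral_setU//; last 4 first.
  - exact: measurableI.
  - exact: measurableI.
  - by rewrite -setIUr [_ `|` E]setUC setUv setIT.
  - by apply/disj_setPS => w [[_ h1] [_ h2]].
  apply: leeD.
    apply: (@le_trans _ _ (\int[mu]_(w in B) (th `^ p)%:E)%E); last by rewrite integral_cst.
    apply: ge0_le_integralW => [w []//|w _|w _|w [Bw Ew]] //.
      by rewrite lee_fin powR_ge0.
    rewrite lee_fin; apply: ge0_ler_powR; rewrite ?nnegrE ?(ltW p0) ?modulus_ge0 ?(ltW th0)//.
    apply: ltW; apply: HN => //=; rewrite leNgt; apply/negP => h; apply: Ew.
    exact: ltW h.
  have -> : (\int[mu]_(w in B `&` E) g w = \int[nu]_(w in B `&` E) g w)%E.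
    apply: eq_measure_integral => A mA AE; rewrite /nu /= /mrestr setIidl//.
    by move=> w /AE[].
  by apply: ge0_le_integralW => // w [].
rewrite /T_term -/B -/g; apply: le_trans (lee_wpmul2l _ split_int) _; first by rewrite lee_fin.
have h1 : (((arc_len I `^ s)^-1)%:E * mu B <= K'%:E)%E.
  have hb := (ratio_box p s mu I K).1 (HK I).
  apply: le_trans (lee_wpmul2l _ hb) _; first by rewrite lee_fin.
  have ls : arc_len I `^ s != 0 by rewrite gt_eqF// powR_gt0 ?arc_len_gt0.
  rewrite -EFinM lee_fin (_ : _ * _ = K * ln (2 / arc_len I) `^ (- p)); last by field.
  rewrite /K' ler_wpM2l//; apply: powRN_le; rewrite ?(ltW p0) ?ln2_gt0//.
  rewrite ler_ln ?posrE ?divr_gt0 ?arc_len_gt0// ler_pdivlMr ?arc_len_gt0//.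
  by rewrite ler_piMr// arc_len_le1.
have h2 := Hc nu eta (f n) M (ltW eta0) M_ge0 Hr (Ff n) (HM n) I.
rewrite ge0_muleDr//; last 2 first.
- by rewrite mule_ge0 ?lee_fin ?powR_ge0.
- exact: integral_ge0.
have -> : e `^ p = e `^ p / 2 + e `^ p / 2 by field.
rewrite EFinD; apply: leeD.
  rewrite muleCA; apply: le_trans (lee_wpmul2l _ h1) _; first by rewrite lee_fin powR_ge0.
  rewrite -EFinM lee_fin thp mulrAC ler_pdivrMr ?ltr_wpDl//.
  by rewrite ler_wpM2l ?divr_ge0 ?(ltW ep)// lerDl.
apply: le_trans h2 _; rewrite lee_fin.
have -> : c * eta * M `^ p = e `^ p / 2 * (X / (X + 1)) by rewrite /eta /X; ring.
by rewrite ler_piMr ?divr_ge0 ?(ltW ep)// ler_pdivrMr ?ltr_wpDl// mul1r lerDl.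
Qed.

End vanishing.

(** * Necessity of the vanishing condition *)

Section compactness_vanishing.
Context {R : realType}.
Local Notation C := (R[i]^o).
Implicit Types (w : plane R) (z zeta : R[i]).
Implicit Types (mu : {measure set (plane R) -> \bar R}) (I : circle_arc R).

Definition null_sequences_vanish (p s : R) mu := forall f : nat -> C -> C,
  F_bounded p (p - 2) s f -> cvg_unif_on_compacts f (fun=> 0) ->
  (fun n => T_norm p s mu (f n)) @ \oo --> 0%E.

Lemma F_space_cst (p s : R) (k : R[i]) : 0 < p ->
  F_space p (p - 2) s (fun=> k) /\ F_norm p (p - 2) s (fun=> k) = (modulus k)%:E.
Proof.
move=> p0; have hk : holo (fun=> k) (fun=> 0 : R[i]) by move=> z _; exact: cdiff_cst.
have [ak kE] := holo_analytic hk.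
have e0 : energy_le p s (fun=> 0 : R[i]) 0.
  move=> a a1; rewrite integral0_eq// => w _.
  by rewrite /dens modulus0 powR0 ?gt_eqF// !mul0r.
have sem : (F_seminorm p (p - 2) s (fun=> k) <= 0%:E)%E.
  apply: (F_seminorm_le s _ p0 (lexx 0)).2; rewrite powR0 ?gt_eqF//.
  by apply: energy_le_ext e0 => z z1; rewrite kE.
have [N N0 NE] : exists2 N, 0 <= N & F_seminorm p (p - 2) s (fun=> k) = N%:E.
  by apply: F_seminorm_fin => //; apply: le_lt_trans sem _; rewrite ltry.
have N00 : N = 0.
  by apply/eqP; rewrite eq_le N0 andbT -lee_fin -NE.
split; first by split => //; rewrite NE ltry.
by rewrite /F_norm NE N00 adde0.
Qed.

Lemma full_box_finite_of_null (p s : R) mu : 0 < p -> 0 < s -> null_sequences_vanish p s mu ->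
  (mu (carleson_box (@full_arc R)) < +oo)%E.
Proof.
move=> p0 s0 H; pose f (n : nat) : C -> C := fun=> (n.+1%:R^-1)%:C.
have kn (n : nat) : modulus ((n.+1%:R^-1 : R)%:C) = n.+1%:R^-1.
  by rewrite modulusC ger0_norm.
have Fb : F_bounded p (p - 2) s f.
  split=> [n|]; first by have [] := F_space_cst s ((n.+1%:R^-1)%:C) p0.
  exists 1 => n; have [_ ->] := F_space_cst s ((n.+1%:R^-1)%:C) p0.
  by rewrite lee_fin kn invf_le1 ?ltr0n// ler1n.
have cv : cvg_unif_on_compacts f (fun=> 0).
  apply: unif_on_compacts_of_disks => r e _ e0; exists (Num.bound e^-1) => n Nn z _.
  rewrite kn -[ltRHS]invrK ltf_pV2 ?posrE ?invr_gt0 ?ltr0n//.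
  have eV : 0 <= e^-1 by rewrite invr_ge0 ltW.
  by apply: lt_le_trans (archi_boundP eV) _; rewrite ler_nat leqW.
have [N HN] := (ereal_cvg0P (fun n => T_norm_ge0 p s mu (f n))).1 (H f Fb cv) 1 ltr01.
have := (T_norm_le s mu (f N) p0 ler01).1 (HN N (leqnn _)) full_arc.
rewrite powR1 /T_term /= powR1 invr1 mul1e /f kn integral_cst; last exact: measurable_box.
have c0 : 0 < N.+1%:R^-1 `^ p :> R by rewrite powR_gt0// invr_gt0 ltr0n.
rewrite -(lee_pdivlMl _ _ c0) => /le_lt_trans; apply.
by rewrite -EFinM ltry.
Qed.

(** An arc with a ratio of at least e yields a function whose T-norm is bounded below in terms of e
    alone. The constants [A] and [B] do not depend on n, so these functions form a bounded sequence
    as the arcs shrink. *)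
Lemma bad_function (p s : R) mu (e : R) : 0 < p -> 0 < s -> 1 < s + p -> exists2 B : R, 0 < B &
  exists2 A : R, 0 < A & forall (n : nat) I, arc_len I < 2 ^- n.+1 ->
  (e%:E <= log_carleson_ratio p s mu I)%E ->
  exists f : C -> C, [/\ F_space p (p - 2) s f, (F_norm p (p - 2) s f <= B%:E)%E,
    (forall z r, modulus z <= r -> r < 1 -> modulus (f z) <= 4 / (1 - r) ^+ 2 / n.+1%:R) &
    forall b : R, 0 <= b -> (T_norm p s mu f <= b%:E)%E -> e <= A * b `^ p].
Proof.
move=> p0 s0 ps1; have [B B0 HB] := test_functions_arc p0 s0 ps1.
have [A A0 HA] := ratio_le_test p0 s0.
exists B => //; exists A => // n I In eI.
have [f [N [Ff FB N1 N2 [Hl Hs]]]] := HB I.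
exists f; split => //.
  move=> z r zr r1; apply: le_trans (Hs z r zr r1) _.
  (* From 2^-(N+1) < |I| < 2^-(n+1); the decay on compact sets can then be stated with n in place of
     N. *)
  have nN : (n <= N)%N.
    rewrite leqNgt; apply/negP => Nn; have := lt_trans N1 In.
    by rewrite -pow2VS ltf_pV2 ?posrE ?exprn_gt0// ltr_eXn2l ?ltr1n// !ltnS leqNgt (leqW Nn)/=.
  by rewrite ler_wpM2l ?divr_ge0 ?sqr_ge0// lef_pV2 ?posrE ?ltr0n// ler_nat.
move=> b b0 Tb; rewrite -lee_fin; apply: le_trans eI _.
apply: le_trans (HA mu I f N N1 N2 Hl) _; rewrite EFinM; apply: lee_wpmul2l.
  by rewrite lee_fin ltW.
exact: (T_norm_le s mu f p0 b0).1.
Qed.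

Lemma compactness_vanishing (p s : R) mu : 0 < p -> 0 < s -> 1 < s + p ->
  null_sequences_vanish p s mu -> vanishing_log_carleson p s mu.
Proof.
move=> p0 s0 ps1 H; have fin := full_box_finite_of_null p0 s0 H.
have van (e : R) : 0 < e -> exists2 d : R, 0 < d &
    forall I, arc_len I < d -> (log_carleson_ratio p s mu I < e%:E)%E.
  move=> e0; apply: contrapT => nd.
  have [B B0 [A A0 HA]] := bad_function mu e p0 s0 ps1.
  have bad n : exists f : C -> C, [/\ F_space p (p - 2) s f,
      (F_norm p (p - 2) s f <= B%:E)%E,
      (forall z r, modulus z <= r -> r < 1 -> modulus (f z) <= 4 / (1 - r) ^+ 2 / n.+1%:R) &
      forall b : R, 0 <= b -> (T_norm p s mu f <= b%:E)%E -> e <= A * b `^ p].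
    have [I [In eI]] : exists I, arc_len I < 2 ^- n.+1 /\ (e%:E <= log_carleson_ratio p s mu I)%E.
      apply: contrapT => nI; apply: nd; exists (2 ^- n.+1); first exact: pow2V_gt0.
      move=> I In; rewrite ltNge; apply/negP => eI; apply: nI; by exists I.
    exact: HA In eI.
  have [f Hf] := choice bad.
  have Fb : F_bounded p (p - 2) s f.
    by split; [move=> n; have [] := Hf n|exists B => n; have [] := Hf n].
  have cv : cvg_unif_on_compacts f (fun=> 0).
    apply: unif_on_compacts_of_disks => r t r1 t0.
    pose k := 4 / (1 - r) ^+ 2; have k0 : 0 <= k / t.
      by rewrite !divr_ge0 ?sqr_ge0// ltW.
    exists (Num.bound (k / t)) => n Nn z zr; have [_ _ hs _] := Hf n.
    apply: le_lt_trans (hs z r zr r1) _; rewrite -/k ltr_pdivrMr ?ltr0n// mulrC -ltr_pdivrMr//.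
    by apply: lt_le_trans (archi_boundP k0) _; rewrite ler_nat leqW.
  (* With this [b] the lower bound reads e <= A b^p = e/2. *)
  pose b := (e / (2 * A)) `^ p^-1; have b0 : 0 < b by rewrite powR_gt0// divr_gt0// mulr_gt0.
  have [N HN] := (ereal_cvg0P (fun n => T_norm_ge0 p s mu (f n))).1 (H f Fb cv) b b0.
  have [_ _ _ /(_ b (ltW b0) (HN N (leqnn _)))] := Hf N.
  rewrite powR_inv_cancel ?divr_ge0 ?mulr_ge0 ?(ltW A0) ?(ltW e0)//.
  have -> : A * (e / (2 * A)) = e / 2 by field; rewrite gt_eqF.
  lra.
(* The logarithmic Carleson condition itself: ratios of short arcs are below 1 by the limit just
   proved, and those of the others are controlled by the finite mass of the punctured disk. *)
split => //; have [d d0 Hd] := van 1 ltr01.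
have m0 : (0 <= mu (carleson_box (@full_arc R)))%E by exact: measure_ge0.
have [m mE] : exists m : R, mu (carleson_box (@full_arc R)) = m%:E.
  by exists (fine (mu (carleson_box (@full_arc R)))); rewrite fineK// ge0_fin_numE.
rewrite mE lee_fin in m0.
apply/log_carlesonP; exists (Num.max 1 (d `^ (- s) * ln (2 / d) `^ p * m)).
  by rewrite le_max ler01.
move=> I; have [Id|Id] := ltP (arc_len I) d.
  by apply: le_trans (ltW (Hd I Id)) _; rewrite lee_fin le_max lexx.
apply: le_trans (ratio_big p0 s0 d0 Id m0 _) _; last by rewrite lee_fin le_max lexx orbT.
rewrite -mE; apply: le_measure; rewrite ?inE; do ?exact: measurable_box.
by move=> w /box_pdisk/pdisk_full.
Qed.

End compactness_vanishing.

(* A Borel measure on the disk is a Borel measure on the plane carried by [disk]. *)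
Theorem theorem3p1 (R : realType) (p s : R)
    (mu : {measure set (plane R) -> \bar R}) :
  0 < s -> 0 < p -> 1 < s + p -> mu (~` disk) = 0%E ->
  (identity_bounded p (p - 2) s mu <-> log_carleson p s mu)
  /\
  ((forall f : nat -> R[i]^o -> R[i]^o,
      F_bounded p (p - 2) s f ->
      cvg_unif_on_compacts f (fun=> 0) ->
      (fun n => T_norm p s mu (f n)) @ \oo --> 0%E)
   <-> vanishing_log_carleson p s mu).
Proof.
move=> s0 p0 ps1 _; split; split.
- exact: log_carleson_of_bounded.
- exact: bounded_of_log_carleson.
- exact: compactness_vanishing.
- by move=> van f; exact: vanishing_compactness.
Qed.
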